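(* For every data type D (generated by the grammar: the natural numbers N; a finite set A quasi-ordered by ≤, written A_≤; finite products D_1 × … × D_k; finite disjoint sums D_1 + … + D_k; finite words D^*; finite multisets D^⊛), the sobrification S(D_a) of D with its Alexandroff topology is Noetherian, and is computed as follows: S(N_a) = N_ω (N with a new top element ω); S((A_≤)_a) = A_≤; S((D_1 × … × D_k)_a) = S((D_1)_a) × … × S((D_k)_a); S((D_1 + … + D_k)_a) = S((D_1)_a) + … + S((D_k)_a); S(D^* ) is the set of products on D modulo ≡, ordered by ⊑; S(D^⊛) is the set of ⊛-products on D modulo ≡, ordered by ⊑. Moreover, for any data type D, equality and ordering (inclusion) in S(D_a) are decidable in the polynomial hierarchy.
   Context: Data types are ordered as follows: finite products pointwise; finite disjoint sums summand-wise (elements of different summands incomparable); X^* (finite words over a poset X) by the embedding quasi-ordering: w ≤^* w' iff, writing w = a_1…a_m, w' can be written w_0 a'_1 w_1 … a'_m w_m with a_j ≤ a'_j for all j; X^⊛ (finite multisets over X) by: {|x_1,…,x_m|} ≤^⊛ {|y_1,…,y_n|} iff there is an injective r:{1..m}→{1..n} with x_i ≤ y_{r(i)} for all i. For a space X, S(X) denotes its sobrification (the set of irreducible closed subsets, ordered by inclusion, with the upper topology); X_a is X with its Alexandroff topology (opens = upward closed sets). Products on X (for words): for A,B ⊆ X^*, AB = {ww' | w∈A, w'∈B}, A^* = words on A, A^? = A ∪ {ε}. Atomic expressions are C^? with C ∈ S(X), or A^* with A a nonempty finite subset of S(X); products are finite sequences e_1…e_k of atomic expressions, denoting the concatenation of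 the denotations, where C^? denotes C ∪ {ε} and A^* denotes (⋃_{C∈A} C)^*. Atomic expressions are ordered by: C^? ⊑ C'^? iff C ⊆ C'; C^? ⊑ A'^* iff C ⊆ C' for some C' ∈ A'; A^* ⋢ C'^?; A^* ⊑ A'^* iff every C ∈ A is included in some C' ∈ A'. Products are quasi-ordered by: eP ⊑ e'P' iff (1) e ⋢ e' and eP ⊑ P', or (2) e = C^?, e' = C'^?, C ⊆ C' and P ⊑ P', or (3) e' = A'^*, e ⊑ A'^* and P ⊑ e'P'. ⊛-products on X: for A,B ⊆ X, A ⊙ B = {m ⊎ m' | m∈A, m'∈B}, A^⊛ = multisets of elements of A, and C^{?} (multiset version) = {{|x|} | x ∈ C} ∪ {empty multiset}. A ⊛-product is A^⊛ ⊙ C_1^? ⊙ … ⊙ C_n^? with A a finite subset of S(X) and C_i ∈ S(X), denoting (⋃_{C∈A} C)^⊛ ⊙ C_1^? ⊙ … ⊙ C_n^?. For P = A^⊛ ⊙ C_1^? ⊙ … ⊙ C_m^? and P' = A'^⊛ ⊙ C'_1^? ⊙ … ⊙ C'_n^?, P ⊑ P' iff (1) every C ∈ A is included in some C' ∈ A', and (2) letting I be the set of indices i such that C_i ⊆ C' for no C' ∈ A', there is an injective r: I → {1,…,n} with C_i ⊆ C'_{r(i)} for all i ∈ I. In both cases, ≡ is ⊑ ∩ ⊒. *)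

(* Defs.v *)
From HB Require Import structures.
From Corelib Require Import BinNums.
From Stdlib Require List.
From mathcomp Require Import all_boot all_order all_algebra.
From mathcomp Require Import finmap multiset.
From mathcomp Require Import all_classical topology.

Set Implicit Arguments.
Unset Strict Implicit.
Unset Printing Implicit Defensive.

Local Open Scope classical_set_scope.

Definition alexandroff (T : choiceType) (le : T -> T -> Prop) : Type := T.

Section Alexandroff.
Variables (T : choiceType) (le : T -> T -> Prop).

HB.instance Definition _ := Choice.on (alexandroff le).

Definition up_closed (U : set (alexandroff le)) : Prop :=
  forall x y : T, le x y -> U x -> U y.

Let up_closedT : up_closed setT.
Proof. by []. Qed.

Let up_closedI : setI_closed up_closed.
Proof. by move=> U V uU uV x y xy [Ux Vx]; split; [exact: uU Ux|exact: uV Vx]. Qed.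

Let up_closed_bigU (I : Type) (f : I -> set (alexandroff le)) :
  (forall i, up_closed (f i)) -> up_closed (\bigcup_i f i).
Proof. by move=> uf x y xy [i _ fix_]; exists i => //; exact: (uf i x y). Qed.

HB.instance Definition _ :=
  isOpenTopological.Build (alexandroff le) up_closedT up_closedI up_closed_bigU.
End Alexandroff.

Definition noetherian (X : topologicalType) : Prop :=
  forall U : set X, open U -> compact U.

Definition irreducible_closed (X : topologicalType) (C : set X) : Prop :=
  [/\ closed C, C !=set0 &
      forall F G : set X, closed F -> closed G -> C `<=` F `|` G ->
        C `<=` F \/ C `<=` G].

Record sobrification (X : topologicalType) := Sobrification {
  sob_set :> set X;
  sob_irreducible : irreducible_closed sob_set }.

Section SobrificationTopology.
Variable X : topologicalType.

HB.instance Definition _ := gen_eqMixin (sobrification X).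
HB.instance Definition _ := gen_choiceMixin (sobrification X).

Definition sob_le (C C' : sobrification X) : Prop :=
  sob_set C `<=` sob_set C'.

(* The upper topology is the coarsest one in which every principal ideal
   [set C' | sob_le C' C] is closed. *)
Definition upper_subbase : set (set (sobrification X)) :=
  [set U | exists C, U = ~` [set C' | sob_le C' C]].

HB.instance Definition _ :=
  isSubBaseTopological.Build (sobrification X) upper_subbase id.
End SobrificationTopology.

(* [presents le den] says that [den] induces an isomorphism of ordered sets
   from the quotient of [E] by the equivalence [le x y /\ le y x] onto the
   sobrification of [X], ordered by inclusion. *)
Definition represents (E : Type) (X : topologicalType) (den : E -> set X) :=
  forall C : set X, irreducible_closed C <-> exists e, den e = C.

Definition presents (E : Type) (le : E -> E -> Prop) (X : topologicalType)
    (den : E -> set X) : Prop :=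
  represents den /\ forall e e', le e e' <-> den e `<=` den e'.

Definition family_le (k : nat) (T : 'I_k -> Type)
    (le : forall i, T i -> T i -> Prop) (x y : forall i, T i) : Prop :=
  forall i, le i (x i) (y i).

Definition sum_le (k : nat) (T : 'I_k -> Type)
    (le : forall i, T i -> T i -> Prop) (x y : {i : 'I_k & T i}) : Prop :=
  exists (i : 'I_k) (a b : T i), [/\ x = Tagged T a, y = Tagged T b & le i a b].

Definition word_le (T : choiceType) (le : T -> T -> Prop) (w w' : seq T) :=
  exists2 s : seq T, subseq s w' & List.Forall2 le w s.

Definition multiset_le (T : choiceType) (le : T -> T -> Prop)
    (m m' : multiset T) : Prop :=
  exists2 r : 'I_(size m) -> 'I_(size m'), injective r &
    forall i, le (tnth (in_tuple m) i) (tnth (in_tuple m') (r i)).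

(* N_omega is [option nat], with [None] for omega. *)
Definition nomega_le (x y : option nat) : Prop :=
  match x, y with
  | _, None => True
  | None, Some _ => False
  | Some m, Some n => m <= n
  end.

Definition nomega_den (x : option nat) : set nat :=
  if x is Some n then [set m | m <= n] else setT.

Definition family_den (k : nat) (T : 'I_k -> choiceType) (E : 'I_k -> Type)
    (den : forall i, E i -> set (T i)) (e : forall i, E i) :
    set {dffun forall i, T i} :=
  [set x | forall i, den i (e i) (x i)].

Definition sum_den (k : nat) (T : 'I_k -> choiceType) (E : 'I_k -> Type)
    (den : forall i, E i -> set (T i)) (e : {i : 'I_k & E i}) :
    set {i : 'I_k & T i} :=
  [set x | exists2 a, den (tag e) (tagged e) a & x = Tagged T a].

(* The parameter [I] is a type of names for the elements of S(X): it is S(X)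
   itself in the description of S(D^* ), and a type of finite expressions in
   the decision problems. *)

Section WordProducts.
Variable I : Type.

(* [Star C A] is the atomic expression whose nonempty set is C :: A. *)
Inductive atom := Opt of I | Star of I & seq I.

Variable leI : I -> I -> Prop.

Definition atom_le (e e' : atom) : Prop :=
  match e, e' with
  | Opt C, Opt C' => leI C C'
  | Opt C, Star C' A' => List.Exists (leI C) (C' :: A')
  | Star _ _, Opt _ => False
  | Star C A, Star C' A' =>
      List.Forall (fun B => List.Exists (leI B) (C' :: A')) (C :: A)
  end.

(* The empty product is below every product, and e :: P is never below the
   empty one. *)
Inductive product_le : seq atom -> seq atom -> Prop :=
| ProductNil Q : product_le [::] Q
| ProductSkip e P e' P' :
    ~ atom_le e e' -> product_le (e :: P) P' -> product_le (e :: P) (e' :: P')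
| ProductOpt C P C' P' :
    leI C C' -> product_le P P' -> product_le (Opt C :: P) (Opt C' :: P')
| ProductStar e P C' A' P' :
    atom_le e (Star C' A') -> product_le P (Star C' A' :: P') ->
    product_le (e :: P) (Star C' A' :: P').

Variables (T : choiceType) (den : I -> set T).

Definition cat_words (A B : set (seq T)) : set (seq T) :=
  [set w | exists u v, [/\ A u, B v & w = u ++ v]].

Definition union_den (A : seq I) : set T :=
  [set a | List.Exists (fun C => den C a) A].

Definition atom_den (e : atom) : set (seq T) :=
  match e with
  | Opt C => [set w | w = [::] \/ exists2 a, den C a & w = [:: a]]
  | Star C A => [set w | forall a, a \in w -> union_den (C :: A) a]
  end.

Definition product_den (P : seq atom) : set (seq T) :=
  foldr (fun e L => cat_words (atom_den e) L) [set [::]] P.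
End WordProducts.

(* The product of A and C_1, ..., C_n is the pair (A, [:: C_1; ...; C_n]). *)

Section MultisetProducts.
Variables (I : Type) (leI : I -> I -> Prop).

Definition mproduct_le (P P' : seq I * seq I) : Prop :=
  let covered C := List.Exists (leI C) P'.1 in
  let Cs := in_tuple P.2 in let Cs' := in_tuple P'.2 in
  List.Forall covered P.1 /\
  exists2 r : {i : 'I_(size P.2) | ~ covered (tnth Cs i)} -> 'I_(size P'.2),
    injective r & forall i, leI (tnth Cs (sval i)) (tnth Cs' (r i)).

Variables (T : choiceType) (den : I -> set T).

Definition sum_multisets (A B : set (multiset T)) : set (multiset T) :=
  [set m | exists u v, [/\ A u, B v & m = (u `+` v)%mset]].

Definition mopt_den (C : I) : set (multiset T) :=
  [set m | m = mset0 \/ exists2 a, den C a & m = [mset a]%mset].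

Definition mstar_den (A : seq I) : set (multiset T) :=
  [set m | forall a, a \in m -> union_den den A a].

Definition mproduct_den (P : seq I * seq I) : set (multiset T) :=
  foldl (fun M C => sum_multisets M (mopt_den C)) (mstar_den P.1) P.2.
End MultisetProducts.

Inductive datatype :=
| DNat
| DFin (d : Order.disp_t) (A : finPreorderType d)
| DProd (k : nat) (D : 'I_k -> datatype)
| DSum (k : nat) (D : 'I_k -> datatype)
| DWords (D : datatype)
| DMultisets (D : datatype).

Fixpoint carrier (D : datatype) : choiceType :=
  match D with
  | DNat => nat
  | DFin _ A => A
  | DProd k D => {dffun forall i : 'I_k, carrier (D i)}
  | DSum k D => {i : 'I_k & carrier (D i)}
  | DWords D => seq (carrier D)
  | DMultisets D => multiset (carrier D)
  end.

Fixpoint data_le (D : datatype) : carrier D -> carrier D -> Prop :=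
  match D return carrier D -> carrier D -> Prop with
  | DNat => fun m n => m <= n
  | DFin _ A => fun a b => (a <= b)%O
  | DProd k D => fun x y => family_le (fun i => @data_le (D i)) x y
  | DSum k D => sum_le (fun i => @data_le (D i))
  | DWords D => word_le (@data_le D)
  | DMultisets D => multiset_le (@data_le D)
  end.

(* [data_space D] is D_a and [sob D] is S(D_a). *)
Definition data_space (D : datatype) : topologicalType :=
  alexandroff (@data_le D).

Definition sob (D : datatype) : topologicalType :=
  sobrification (data_space D).

Definition sob_den (D : datatype) (C : sob D) : set (carrier D) := sob_set C.

Fixpoint expr (D : datatype) : Type :=
  match D with
  | DNat => option nat
  | DFin _ A => A
  | DProd k D => forall i : 'I_k, expr (D i)
  | DSum k D => {i : 'I_k & expr (D i)}
  | DWords D => seq (atom (expr D))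
  | DMultisets D => seq (expr D) * seq (expr D)
  end.

Fixpoint expr_den (D : datatype) : expr D -> set (carrier D) :=
  match D return expr D -> set (carrier D) with
  | DNat => nomega_den
  | DFin _ A => fun a => [set b : A | (b <= a)%O]
  | DProd k D => family_den (fun i => @expr_den (D i))
  | DSum k D => sum_den (fun i => @expr_den (D i))
  | DWords D => product_den (@expr_den D)
  | DMultisets D => mproduct_den (@expr_den D)
  end.

Definition word := seq bool.

(* Self-delimiting binary encodings: each item of a list is preceded by
   [true], and [false] closes the list. *)
Definition enc_list (I : Type) (enc : I -> word) (s : seq I) : word :=
  foldr (fun x w => true :: enc x ++ w) [:: false] s.

Fixpoint pos_bits (p : positive) : word :=
  match p with
  | xH => [:: true]
  | xO p => false :: pos_bits p
  | xI p => true :: pos_bits p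
  end.

Definition nat_bits (n : nat) : word :=
  if bin_of_nat n is Npos p then pos_bits p else [::].

Definition enc_nat (n : nat) : word := enc_list (fun b => [:: b]) (nat_bits n).

Definition enc_atom (I : Type) (enc : I -> word) (e : atom I) : word :=
  match e with
  | Opt C => false :: enc C
  | Star C A => true :: enc_list enc (C :: A)
  end.

Fixpoint enc_expr (D : datatype) : expr D -> word :=
  match D return expr D -> word with
  | DNat => fun x => if x is Some n then true :: enc_nat n else [:: false]
  | DFin _ A => fun a => enc_nat (enum_rank a)
  | DProd k D => fun e =>
      flatten [seq @enc_expr (D i) (e i) | i <- enum 'I_k]
  | DSum k D => fun e =>
      enc_nat (tag e) ++ @enc_expr (D (tag e)) (tagged e)
  | DWords D => enc_list (enc_atom (@enc_expr D))
  | DMultisets D => fun P =>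
      enc_list (@enc_expr D) P.1 ++ enc_list (@enc_expr D) P.2
  end.

Inductive move := GoLeft | GoRight | Stay.

(* A deterministic Turing machine with [n] input tapes and [tm_work] work
   tapes. A symbol is [None] (blank), a bit, or an auxiliary symbol; a machine
   halts in the states where [tm_verdict] is defined. *)
Record machine (n : nat) := Machine {
  tm_state : finType;
  tm_aux : finType;
  tm_work : nat;
  tm_start : tm_state;
  tm_verdict : tm_state -> option bool;
  tm_delta : tm_state -> {ffun 'I_(n + tm_work) -> option (bool + tm_aux)} ->
    tm_state * {ffun 'I_(n + tm_work) -> option (bool + tm_aux) * move} }.

Section Run.
Variables (n : nat) (M : machine n).

Definition symbol : Type := option (bool + tm_aux M).

(* A two-way infinite tape: the symbols to the left of the head, nearest first,
   and the scanned symbol followed by those to its right; blank beyond. *)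
Definition tape : Type := seq symbol * seq symbol.

Definition tape_read (t : tape) : symbol := head None t.2.

Definition tape_act (t : tape) (a : symbol * move) : tape :=
  let: (l, r) := (t.1, a.1 :: behead t.2) in
  match a.2 with
  | GoLeft => (behead l, head None l :: r)
  | GoRight => (a.1 :: l, behead r)
  | Stay => (l, r)
  end.

Definition config : Type := tm_state M * ('I_(n + tm_work M) -> tape).

Definition tm_step (c : config) : config :=
  if tm_verdict c.1 is Some _ then c else
  let: (q, act) := tm_delta c.1 [ffun j => tape_read (c.2 j)] in
  (q, fun j => tape_act (c.2 j) (act j)).

Definition tm_init (x : n.-tuple word) : config :=
  (tm_start M,
   fun j => match fintype.split j with
            | inl i => ([::], [seq Some (inl b) | b <- tnth x i])
            | inr _ => ([::], [::])
            end).

Definition tm_result (t : nat) (x : n.-tuple word) : option bool :=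
  tm_verdict (iter t tm_step (tm_init x)).1.
End Run.

Definition input_size (n : nat) (x : n.-tuple word) : nat :=
  \sum_(i < n) size (tnth x i).

Definition polytime (n : nat) (L : n.-tuple word -> Prop) : Prop :=
  exists (M : machine n) (p : {poly nat}), forall x,
    exists2 b : bool, tm_result M p.[input_size x]%R x = Some b &
      (b <-> L x).

(* [sigma_p k] is the level Sigma_k^p: a language of Sigma_{k+1}^p is obtained
   from the complement of a language of Sigma_k^p by an existential quantifier
   over words of polynomially bounded length. *)
Fixpoint sigma_p (k n : nat) (L : n.-tuple word -> Prop) : Prop :=
  match k with
  | 0 => polytime L
  | k'.+1 => exists (p : {poly nat}) (L' : n.+1.-tuple word -> Prop),
      sigma_p k' L' /\
      forall x : n.-tuple word, L x <->
        exists2 u : word, (size u <= p.[input_size x]%R)%N &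
          ~ L' [tuple of u :: x]
  end.

Definition polynomial_hierarchy (n : nat) (L : n.-tuple word -> Prop) : Prop :=
  exists k, sigma_p k L.

(* The language of the pairs of encodings of expressions whose denotations are
   related by [R]. *)
Definition expr_problem (D : datatype)
    (R : set (carrier D) -> set (carrier D) -> Prop) (x : 2.-tuple word) :=
  exists e e' : expr D,
    x = [tuple enc_expr e; enc_expr e'] /\ R (expr_den e) (expr_den e').

(* Main.v *)
(* Irreducible closed sets of an Alexandroff space are ideals (directed downsets),
   and in a well-quasi-order every downset is a finite union of ideals. For words,
   removing from a product the words above a given one leaves a finite union of
   products; as the complement of a downset has a finite basis (Higman), every
   downset is a finite union of products, hence every ideal is a product. Ideals of
   multisets are images of ideals of words, since the multiset ordering is the
   image of the word ordering.

   The relations in the polynomial hierarchy contain those decided by one-way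
   multi-head automata and are closed under connectives, quantifiers with short
   witnesses, and iteration of length-decreasing steps (guess the sequence of
   configurations, then check all its consecutive pairs). In this logic, inclusion
   of encoded expressions is definable by recursion on the data type: inclusion of
   products is a greedy left-to-right consumption of both products, and inclusion
   of multiset products is a greedy matching. *)

Require Import Defs.
From Corelib Require Import BinNums.
From Stdlib Require List.
From mathcomp Require Import all_boot all_order all_algebra.
From mathcomp Require Import finmap multiset.
From mathcomp Require Import all_classical topology.
From mathcomp Require Import zify.

Set Implicit Arguments.
Unset Strict Implicit.
Unset Printing Implicit Defensive.

Local Open Scope classical_set_scope.

(** * Well-quasi-orders and ideals *)

(** The theory of ideals is stated for an arbitrary type [E] of names and a denotation [den] whose
    values are the ideals. It is used twice, with [sob D] for the description of the sobrification
    and with [expr D] for the decision problems, so that each syntactic ordering is compared with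
    inclusion only once.

    The complexity bound avoids programming Turing machines. One-way heads cannot reread a word, so
    automata serve only for elementary comparisons such as equality, concatenation or the doubling
    of bits; the rest is obtained by quantifying over factors of the words in the context. The price
    is an alternation depth that grows with the nesting of the data type, but this depth is constant
    once [D] is fixed.

    An iterated relation has to shrink its left argument: this bounds the number of configurations
    and their sizes, hence the length of the guessed run. The orderings on products are therefore
    recast as rewriting of pairs of codes that get shorter. *)

Section Ideals.
Variables (T : choiceType) (le : T -> T -> Prop).

Definition downset (F : set T) : Prop := forall x y, le x y -> F y -> F x.

Definition ideal (C : set T) : Prop :=
  [/\ downset C, C !=set0 &
      forall x y, C x -> C y -> exists z, [/\ C z, le x z & le y z]].

Definition wqo : Prop :=
  forall f : nat -> T, exists i j, i < j /\ le (f i) (f j).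

Definition quasi_order : Prop :=
  (forall x, le x x) /\ (forall x y z, le x y -> le y z -> le x z).

Lemma closed_downset (F : set (alexandroff le)) : closed F <-> downset F.
Proof.
split=> [/closed_openC FC x y xy Fy|dF].
  by apply: contrapT => nFx; exact: (FC x y xy nFx).
rewrite -[F]setCK; apply: open_closedC.
by move=> x y xy /= nFx Fy; apply: nFx; exact: dF xy Fy.
Qed.

Lemma downset_ideal C : ideal C -> downset C.
Proof. by case. Qed.

Hypothesis le_qo : quasi_order.

Lemma downsetD F x : downset F -> downset (F `\` le x).
Proof.
move=> dF y z yz [Fz nxz]; split; first exact: dF Fz.
by move=> xy; apply: nxz; exact: le_qo.2 xy yz.
Qed.

Lemma ideal_principal x : ideal [set y | le y x].
Proof.
split=> [y z yz zx | | y z yx zx]; first exact: le_qo.2 yz zx.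
  by exists x; exact: le_qo.1.
by exists x; split=> //; exact: le_qo.1.
Qed.

(** A point of [C] outside [F] and one outside [G] have an upper bound in [C], which lies outside
    both downsets. *)
Lemma ideal_subU C F G : ideal C -> downset F -> downset G ->
  C `<=` F `|` G -> C `<=` F \/ C `<=` G.
Proof.
move=> [_ _ dirC] dF dG CFG; apply: contrapT => /not_orP[nF nG].
have [x [Cx nFx]] : exists x, C x /\ ~ F x.
  apply: contrapT => /forallNP H; apply: nF => x Cx; apply: contrapT => nFx.
  exact: (H x).
have [y [Cy nGy]] : exists x, C x /\ ~ G x.
  apply: contrapT => /forallNP H; apply: nG => y Cy; apply: contrapT => nGy.
  exact: (H y).
have [z [Cz xz yz]] := dirC _ _ Cx Cy.
by case: (CFG z Cz) => [/(dF _ _ xz)|/(dG _ _ yz)].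
Qed.

(** If [x] and [y] had no common upper bound in [C], then [C] minus the points above [x] and [C]
    minus the points above [y] would be closed sets covering [C], each missing one of its points. *)
Lemma irreducible_ideal (C : set (alexandroff le)) :
  irreducible_closed C <-> ideal C.
Proof.
split=> [[/closed_downset dC C0 irrC] | iC].
  split=> // x y Cx Cy; apply: contrapT => nz.
  have cl z : closed (C `\` le z : set (alexandroff le)).
    by apply/closed_downset; exact: downsetD.
  case: (irrC _ _ (cl x) (cl y)) => [z Cz | | ].
  - have [xz|nxz] := pselect (le x z); last by left.
    have [yz|nyz] := pselect (le y z); last by right.
    by case: nz; exists z.
  - by move=> /(_ x Cx)[_]; apply; exact: le_qo.1.
  - by move=> /(_ y Cy)[_]; apply; exact: le_qo.1.
split; first by apply/closed_downset; case: iC.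
  by case: iC.
move=> F G /closed_downset dF /closed_downset dG; exact: ideal_subU.
Qed.

Section UnionDen.
Variables (E : Type) (den : E -> set T).
Lemma union_den_nil : union_den den [::] = set0.
Proof. by apply/seteqP; split=> x // H; inversion H. Qed.

Lemma union_den_cons e (s : seq E) :
  union_den den (e :: s) = den e `|` union_den den s.
Proof. by apply/seteqP; split=> x; rewrite /union_den /= List.Exists_cons. Qed.

Lemma union_den_cat (s t : seq E) :
  union_den den (s ++ t) = union_den den s `|` union_den den t.
Proof. by apply/seteqP; split=> x; rewrite /union_den /= List.Exists_app. Qed.

End UnionDen.

Section Family.
Variables (E : Type) (den : E -> set T).
Hypothesis den_ideal : forall e, ideal (den e).

Lemma downset_union_den (s : seq E) : downset (union_den den s).
Proof.
move=> x y xy; elim: s => [|e s IHs]; first by rewrite union_den_nil.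
rewrite union_den_cons => -[ey|/IHs ?]; last by right.
by left; exact: (downset_ideal (den_ideal e)) xy ey.
Qed.

Lemma ideal_sub_union_den C s : ideal C ->
  C `<=` union_den den s -> List.Exists (fun e => C `<=` den e) s.
Proof.
move=> iC; elim: s => [|e s IHs] Cs.
  by case: iC => _ [x Cx] _; have := Cs x Cx; rewrite union_den_nil.
case: (@ideal_subU C (den e) (union_den den s)) => //.
- exact: downset_ideal (den_ideal e).
- exact: downset_union_den.
- by move: Cs; rewrite union_den_cons.
- by move=> ?; left.
- by move=> /IHs ?; right.
Qed.

Lemma ideal_sub_union_denP C s : ideal C ->
  C `<=` union_den den s <-> List.Exists (fun e => C `<=` den e) s.
Proof.
move=> iC; split=> [|H x Cx]; first exact: ideal_sub_union_den.
by elim: H => {s} [e s /(_ x Cx) ex|e s _ IH]; rewrite union_den_cons; [left|right].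
Qed.

(* Noetherian induction: a counterexample which is not an ideal is the union of
   two proper downsets, one of which is again a counterexample. *)
Lemma downset_union_ideals F :
  (forall C, ideal C -> exists e, den e = C) -> wqo -> downset F ->
  exists s : seq E, F = union_den den s.
Proof.
move=> denP wq dF; apply: contrapT => nF.
pose B := {F | downset F /\ ~ exists s : seq E, F = union_den den s}.
have next (G : B) : exists H : B,
    sval H `<=` sval G /\ exists x, sval G x /\ ~ sval H x.
  case: G => G [dG nG] /=.
  have split_G : exists HK : set T * set T,
        [/\ downset HK.1, downset HK.2,
            HK.1 `<=` G /\ exists x, G x /\ ~ HK.1 x,
            HK.2 `<=` G /\ exists x, G x /\ ~ HK.2 x &
            G `<=` HK.1 `|` HK.2].
    have [G0|/set0P G0] := eqVneq G set0.
      case: nG; exists [::].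
      by rewrite G0 union_den_nil.
    apply: contrapT => /forallNP nHK; case: nG.
    have iG : ideal G.
      split=> // x y Gx Gy; apply: contrapT => nz.
      apply: (nHK (G `\` le x, G `\` le y)); split=> /=.
      - exact: downsetD.
      - exact: downsetD.
      - split; first by move=> ? [].
        by exists x; split=> // -[_]; apply; exact: le_qo.1.
      - split; first by move=> ? [].
        by exists y; split=> // -[_]; apply; exact: le_qo.1.
      - move=> z Gz; have [xz|nxz] := pselect (le x z); last by left.
        have [yz|nyz] := pselect (le y z); last by right.
        by case: nz; exists z.
    have [e eG] := denP G iG; exists [:: e].
    by rewrite union_den_cons union_den_nil setU0.
  have [[H K]] := split_G.
  move=> [dH dK [HG [x [Gx nHx]]] [KG [y [Gy nKy]]] GHK].
  have [[s Hs]|nH] := pselect (exists s : seq E, H = union_den den s); last first.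
    by exists (exist _ H (conj dH nH)) => /=; split=> //; exists x.
  have [[t Kt]|nK] := pselect (exists s : seq E, K = union_den den s); last first.
    by exists (exist _ K (conj dK nK)) => /=; split=> //; exists y.
  case: nG; exists (s ++ t); rewrite union_den_cat -Hs -Kt.
  by apply/seteqP; split=> // z [/HG|/KG].
have [nx nxP] := choice next.
pose G n := iter n nx (exist _ F (conj dF nF)).
(* [x n] is in the [n]-th counterexample and not in the next one. A good pair [i < j] would put
   [x i], which is below [x j], in the downset [G i.+1]. *)
have [x xP] := choice (fun n => (nxP (G n)).2).
have [i [j [ij xij]]] := wq x.
have decr : sval (G j) `<=` sval (G i.+1).
  elim: j ij {xij} => // j IHj; rewrite ltnS leq_eqVlt => /orP[/eqP-> //|/IHj].
  by apply: subset_trans; exact: (nxP (G j)).1.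
apply: (xP i).2; apply: (svalP (G i.+1)).1 xij _.
by apply: decr; exact: (xP j).1.
Qed.
End Family.

(** If no finite list were a basis, every finite list in [U] could be extended by a point of [U]
    above none of its entries; iterating this gives a bad sequence. *)
Lemma upset_finite_basis (U : set T) : wqo ->
  (forall x y, le x y -> U x -> U y) ->
  exists s : seq T, (forall x, x \in s -> U x) /\
    forall y, U y -> exists2 x, x \in s & le x y.
Proof.
move=> wq uU; apply: contrapT => nb.
have next (s : seq T) : (forall x, x \in s -> U x) ->
    exists y, U y /\ forall x, x \in s -> ~ le x y.
  move=> sU; apply: contrapT => /forallNP H; apply: nb; exists s; split=> // y Uy.
  apply: contrapT => nx; apply: (H y); split=> // x xs xy.
  by apply: nx; exists x.
(* [U] is nonempty, since the empty list is not a basis. [y0] is the default value that makes the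
   choice total on lists. *)
have [y0 [Uy0 _]] : exists y, U y /\ forall x, x \in [::] -> ~ le x y by exact: next.
have {next} next (s : seq T) : exists y, (forall x, x \in s -> U x) ->
    U y /\ forall x, x \in s -> ~ le x y.
  have [/next[y yP]|nU] := pselect (forall x, x \in s -> U x).
    by exists y.
  by exists y0.
have [g gP] := choice next.
pose S n := iter n (fun s => g s :: s) [::].
have SU n : forall x, x \in S n -> U x.
  elim: n => // n IHn x; rewrite inE => /orP[/eqP->|/IHn //].
  exact: (gP _ IHn).1.
have [i [j [ij le_ij]]] := wq (fun n => g (S n)).
apply: (gP (S j) (SU j)).2 le_ij.
elim: j ij => // j IHj; rewrite ltnS leq_eqVlt => /orP[/eqP->|/IHj ?].
  by rewrite /= inE eqxx.
by rewrite /= inE; apply/orP; right.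
Qed.

(** Indices with no later term above them are bounded, as otherwise they would form a bad sequence.
    Beyond the bound [N], larger terms can be followed forever. *)
Lemma wqo_monotone_subsequence (a : nat -> T) : wqo ->
  exists phi : nat -> nat, (forall i j, i < j -> phi i < phi j) /\
    forall i j, i < j -> le (a (phi i)) (a (phi j)).
Proof.
move=> wq.
have [N NP] : exists N, forall n, N <= n -> exists m, n < m /\ le (a n) (a m).
  apply: contrapT => /forallNP H.
  have /choice[t tP] N :
      exists t, N <= t /\ forall m, t < m -> ~ le (a t) (a m).
    apply: contrapT => /forallNP nt; apply: (H N) => n Nn.
    apply: contrapT => nm; apply: (nt n); split=> // m nlm anm.
    by apply: nm; exists m.
  pose u n := iter n (fun k => t k.+1) (t 0).
  have u_incr i j : i < j -> u i < u j.
    elim: j => // j IHj; rewrite ltnS leq_eqVlt => /orP[/eqP->|/IHj ij].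
      exact: (tP (u j).+1).1.
    by apply: ltn_trans ij _; exact: (tP (u j).+1).1.
  have [i [j [ij]]] := wq (a \o u); rewrite /=.
  by case: i ij => [|i] ij; apply: (tP _).2; exact: u_incr ij.
have /choice[s sP] n : exists m, N <= n -> n < m /\ le (a n) (a m).
  have [Nn|nN] := boolP (N <= n); last by exists 0.
  by have [m mP] := NP n Nn; exists m.
pose phi n := iter n s N.
have phiN n : N <= phi n.
  elim: n => //= n IHn; apply: (leq_trans IHn); exact: ltnW (sP _ IHn).1.
exists phi; split=> i j.
  elim: j => // j IHj; rewrite ltnS leq_eqVlt => /orP[/eqP->|/IHj ij].
    exact: (sP _ (phiN j)).1.
  by apply: ltn_trans ij _; exact: (sP _ (phiN j)).1.
elim: j => // j IHj; rewrite ltnS leq_eqVlt => /orP[/eqP->|/IHj ij].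
  exact: (sP _ (phiN j)).2.
by apply: le_qo.2 ij _; exact: (sP _ (phiN j)).2.
Qed.

End Ideals.

Lemma wqo_eq (T : finType) : @wqo T eq.
Proof.
move=> f; apply: contrapT => H.
have /leq_card : injective (fun i : 'I_#|T|.+1 => f i).
  move=> i j fij; apply: val_inj; case: (ltngtP i j) => // ij; case: H.
    by exists i, j.
  by exists j, i.
by rewrite card_ord ltnn.
Qed.

Lemma wqo_nat : @wqo nat leq.
Proof.
move=> f; have [n nP] : exists n, forall m, n < m -> f n <= f m.
  apply: contrapT => /forallNP H.
  have /choice[t tP] n : exists m, f m < f n.
    apply: contrapT => /forallNP nt; apply: (H n) => m _.
    by rewrite leqNgt; apply/negP; exact: nt.
  have {}tP k : f (iter k t 0) + k <= f 0.
    elim: k => [|k IHk]; first by rewrite addn0.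
    by rewrite /= addnS; have := tP (iter k t 0); lia.
  by have := tP (f 0).+1; lia.
by exists n, n.+1; split=> //; exact: nP.
Qed.

(** * Words *)

Section Words.
Variables (T : choiceType) (le : T -> T -> Prop).
Local Notation "u ≤w v" := (word_le le u v) (at level 70).

Lemma word_le_nil w : [::] ≤w w.
Proof. by exists [::]; [exact: sub0seq | exact: List.Forall2_nil]. Qed.

Lemma word_le_consr a w w' : w ≤w w' -> w ≤w a :: w'.
Proof. by move=> [s sw ws]; exists s => //; exact: subseq_trans sw (subseq_cons _ _). Qed.

Lemma word_le_cons a b w w' : le a b -> w ≤w w' -> a :: w ≤w b :: w'.
Proof.
move=> ab [s sw ws]; exists (b :: s); first by rewrite /= eqxx.
exact: List.Forall2_cons.
Qed.

Lemma word_le_cons_inv a b w w' :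
  a :: w ≤w b :: w' -> (le a b /\ w ≤w w') \/ a :: w ≤w w'.
Proof.
move=> [s]; case: s => [|c s].
  by move=> _ H; inversion H.
rewrite /=; case: eqP => [-> sw|_ sw] H.
  by inversion H; subst; left; split=> //; exists s.
by right; exists (c :: s).
Qed.

Lemma word_le0 w : w ≤w [::] -> w = [::].
Proof. by move=> [s]; rewrite subseq0 => /eqP-> H; inversion H. Qed.

(** This treats the embedding as the relation generated by three rules: the empty word, skipping a
    letter on the right, matching two letters. *)
Lemma word_le_ind (P : seq T -> seq T -> Prop) :
  (forall w, P [::] w) ->
  (forall a w w', w ≤w w' -> P w w' -> P w (a :: w')) ->
  (forall a b w w', le a b -> w ≤w w' -> P w w' -> P (a :: w) (b :: w')) ->
  forall w w', w ≤w w' -> P w w'.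
Proof.
move=> Pn Pr Pc w w'; elim: w' w => [|b w' IHw] [|a w] //.
  by move=> /word_le0.
move=> /word_le_cons_inv[[ab ww]|ww]; first by apply: Pc => //; exact: IHw.
by apply: Pr => //; exact: IHw.
Qed.

Lemma word_le_cat u u' v v' : u ≤w u' -> v ≤w v' -> u ++ v ≤w u' ++ v'.
Proof.
move=> uu vv; elim/word_le_ind: uu => {u u'} [w|a w w' _ ww|a b w w' ab _ ww].
- elim: w => // a w IHw; exact: word_le_consr.
- exact: word_le_consr.
- exact: word_le_cons.
Qed.

Lemma word_le_catr w u v : w ≤w u ++ v ->
  exists w1 w2, [/\ w = w1 ++ w2, w1 ≤w u & w2 ≤w v].
Proof.
elim: u w => [|b u IHu] w /= wuv.
  by exists [::], w; split=> //; exact: word_le_nil.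
case: w wuv => [|a w].
  by move=> _; exists [::], [::]; split=> //; exact: word_le_nil.
move=> /word_le_cons_inv[[ab /IHu[w1 [w2 [-> w1u w2v]]]]|/IHu[w1 [w2 [-> w1u w2v]]]].
  by exists (a :: w1), w2; split=> //; exact: word_le_cons.
by exists w1, w2; split=> //; exact: word_le_consr.
Qed.

Lemma word_le_mem w w' a : w ≤w w' -> a \in w -> exists2 b, b \in w' & le a b.
Proof.
move=> ww; elim/word_le_ind: ww => {w w'} // [c w w' _ IH|c b w w' cb _ IH].
  by move=> /IH[b bw ab]; exists b => //; rewrite inE bw orbT.
rewrite inE => /orP[/eqP->|/IH[d dw ad]].
  by exists b => //; rewrite inE eqxx.
by exists d => //; rewrite inE dw orbT.
Qed.

Hypothesis le_qo : quasi_order le.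

Lemma word_le_qo : quasi_order (word_le le).
Proof.
split=> [w|u v w uv vw].
  by elim: w => [|a w IHw]; [exact: word_le_nil | apply: word_le_cons => //; exact: le_qo.1].
move: u uv; elim/word_le_ind: vw => {v w} [w u /word_le0->|a v w _ IH u /IH|].
- exact: word_le_nil.
- exact: word_le_consr.
move=> a b v w ab _ IH [|c u] uv; first exact: word_le_nil.
case/word_le_cons_inv: uv => [[ca /IH uw]|/IH]; last exact: word_le_consr.
by apply: word_le_cons => //; exact: le_qo.2 ca ab.
Qed.

(* Nash-Williams: the tails of the letters of a minimal bad sequence, along an
   increasing subsequence of its first letters, form a smaller bad sequence. *)
Theorem higman : wqo le -> wqo (word_le le).
Proof.
move=> wq f0; apply: contrapT => nf0.
pose bad (f : nat -> seq T) := forall i j, i < j -> ~ f i ≤w f j.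
pose agree n (f h : nat -> seq T) := forall i, i < n -> h i = f i.
have bad0 : bad f0 by move=> i j ij fij; apply: nf0; exists i, j.
(* Among the bad sequences that agree with [f] before [n], [g] has a shortest [n]-th word. *)
have minimal n (f : {f | bad f}) : exists g : {g | bad g},
    agree n (sval f) (sval g) /\ forall h, bad h -> agree n (sval f) h ->
      size (sval g n) <= size (h n).
  suff H k (h : nat -> seq T) : bad h -> agree n (sval f) h -> size (h n) < k ->
      exists g : {g | bad g}, agree n (sval f) (sval g) /\
        forall h, bad h -> agree n (sval f) h -> size (sval g n) <= size (h n).
    by apply: (H (size (sval f n)).+1 (sval f)) => //; exact: svalP.
  elim: k h => // k IHk h bh ah; rewrite ltnS => hk.
  have [[h' [bh' ah' lt_h']]|nh] := pselect (exists h', [/\ bad h',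
      agree n (sval f) h' & size (h' n) < size (h n)]).
    by apply: (IHk h') => //; exact: leq_trans lt_h' hk.
  exists (exist _ h bh); split=> //= h' bh' ah'; rewrite leqNgt; apply/negP => ?.
  by apply: nh; exists h'.
have /choice[st stP] (nf : nat * {f | bad f}) := minimal nf.1 nf.2.
(* [F n] is the bad sequence after [n] minimisations. Entries up to [n] no longer change after stage
   [n.+1], so the diagonal [g] is again bad. *)
pose F := fix F n := if n is n'.+1 then st (n', F n') else exist _ f0 bad0.
pose g n := sval (F n.+1) n.
have Fg m i : i < m -> sval (F m) i = g i.
  elim: m => // m IHm; rewrite ltnS leq_eqVlt => /orP[/eqP->//|im].
  by rewrite -(IHm im); exact: (stP (m, F m)).1.
have bad_g : bad g.
  by move=> i j ij; rewrite -(Fg j.+1 i (leqW ij)); exact: (svalP (F j.+1)).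
have min_g n h : bad h -> agree n g h -> size (g n) <= size (h n).
  move=> bh ah; apply: (stP (n, F n)).2 => //= i lin.
  by rewrite Fg // ah.
have /choice[hd hdP] n : exists aw : T * seq T, g n = aw.1 :: aw.2.
  case gn : (g n) => [|a w]; last by exists (a, w).
  by case: (bad_g n n.+1) => //; rewrite gn; exact: word_le_nil.
have [phi [phi_incr le_phi]] :=
  wqo_monotone_subsequence le_qo (fun n => (hd n).1) wq.
(* The entries of [g] before the first selected index, then the tails of the selected words. This is
   bad, yet shorter than [g] at [phi 0]. *)
pose h i := if i < phi 0 then g i else (hd (phi (i - phi 0))).2.
have : size (g (phi 0)) <= size (h (phi 0)).
  apply: min_g => [i j ij|i]; last by rewrite /h => ->.
  rewrite /h; case: (ltnP j (phi 0)) => [j0|j0].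
    by rewrite (ltn_trans ij j0); exact: bad_g.
  have phi_ge k : phi 0 <= phi k by case: k => // k; exact: ltnW (phi_incr _ _ _).
  case: ltnP => i0 hij.
    apply: (bad_g i (phi (j - phi 0))); first exact: leq_trans i0 (phi_ge _).
    by rewrite (hdP (phi _)); exact: word_le_consr.
  apply: (bad_g (phi (i - phi 0)) (phi (j - phi 0))); first by apply: phi_incr; lia.
  by rewrite !hdP; apply: word_le_cons => //; apply: le_phi; lia.
by rewrite /h ltnn subnn hdP ltnn.
Qed.

End Words.

(** * Multisets *)

Section Multisets.
Variables (T : choiceType) (le : T -> T -> Prop).

Lemma Forall2_size A B (R : A -> B -> Prop) s t :
  List.Forall2 R s t -> size s = size t.
Proof. by elim=> //= ? ? ? ? _ _ ->. Qed.

Lemma Forall2_nth A B (R : A -> B -> Prop) x y s t :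
  List.Forall2 R s t <->
    size s = size t /\ forall i, i < size s -> R (nth x s i) (nth y t i).
Proof.
split=> [H|[]].
  split; first exact: Forall2_size H.
  by elim: H => // a b s' t' ab _ IH [|i] //=; exact: IH.
elim: s t => [|a s IHs] [|b t] // sz H.
move: sz => [/IHs st]; apply: List.Forall2_cons; first exact: (H 0).
by apply: st => i; exact: (H i.+1).
Qed.

Lemma multiset_leP (m m' : multiset T) : multiset_le le m m' <->
  exists s r, perm_eq (enum_mset m') (s ++ r) /\ List.Forall2 le (enum_mset m) s.
Proof.
split=> [[r r_inj rP]|[s [r [m'sr ms]]]].
  pose t i := tnth (in_tuple (enum_mset m')) i.
  exists [seq t (r i) | i <- enum 'I_(size (enum_mset m))].
  exists [seq t i | i <- enum 'I_(size (enum_mset m')) & i \notin codom r].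
  split.
    have m'E : map t (enum 'I_(size (enum_mset m'))) = enum_mset m'.
      exact: (map_tnth_enum (in_tuple (enum_mset m'))).
    apply: (@perm_trans _ (map t (enum 'I_(size (enum_mset m'))))).
      by rewrite m'E.
    rewrite (map_comp t r) -map_cat; apply: perm_map; apply: uniq_perm.
    - exact: enum_uniq.
    - rewrite cat_uniq map_inj_uniq ?enum_uniq //= filter_uniq ?enum_uniq // andbT.
      apply/hasPn => i; rewrite mem_filter => /andP[+ _].
      by rewrite /codom /image_mem.
    - move=> i; rewrite mem_enum mem_cat mem_filter mem_enum /= andbT.
      by rewrite -[_ \in map _ _]/(i \in codom r) orbN.
  suff : List.Forall2 le
      (map (tnth (in_tuple (enum_mset m))) (enum 'I_(size (enum_mset m))))
      [seq t (r i) | i <- enum 'I_(size (enum_mset m))].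
    by rewrite (map_tnth_enum (in_tuple (enum_mset m))).
  elim: (enum _) => [|i e IHe]; first exact: List.Forall2_nil.
  by apply: List.Forall2_cons => //; exact: rP.
(* The case of an empty [m] is separate because it offers no default element for [nth]. *)
have [m0|] := eqVneq (size (enum_mset m)) 0.
  have F (i : 'I_(size (enum_mset m))) : False by case: i; rewrite m0.
  exists (fun i => False_rect _ (F i)); first by move=> i; case: (F i).
  by move=> i; case: (F i).
case em : (enum_mset m) ms => [|x0 mm] // ms _.
have /(perm_iotaP x0)[Is Isp srE] : perm_eq (s ++ r) (enum_mset m') by rewrite perm_sym.
have sz := Forall2_size ms.
have szI : size Is = size (enum_mset m') by rewrite (perm_size Isp) size_iota.
have lt_sI i : i < size s -> i < size Is.
  move=> /leq_trans; apply.
  by have := congr1 size srE; rewrite size_cat size_map => <-; exact: leq_addr.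
(* The partner of the [i]-th entry sits at the position that the permutation [Is] gives to the
   [i]-th entry of [s]. *)
have rlt (i : 'I_(size (x0 :: mm))) : nth 0 Is i < size (enum_mset m').
  have : nth 0 Is i \in Is by apply: mem_nth; apply: lt_sI; rewrite -sz.
  by rewrite (perm_mem Isp) mem_iota.
rewrite /multiset_le em; exists (fun i => Ordinal (rlt i)) => [i j|i].
  move=> /(congr1 val)/= /eqP; rewrite nth_uniq ?lt_sI -?sz //.
    by move=> /eqP/val_inj.
  by rewrite (perm_uniq Isp) iota_uniq.
have iI : i < size Is by apply: lt_sI; rewrite -sz.
have [_ /(_ i (ltn_ord i))] := (Forall2_nth le x0 x0 _ _).1 ms.
have -> : nth x0 s i = nth x0 (s ++ r) i by rewrite nth_cat -sz ltn_ord.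
by rewrite srE (nth_map 0) // !(tnth_nth x0).
Qed.

Lemma word_le_multiset w w' : word_le le w w' ->
  multiset_le le (seq_mset w) (seq_mset w').
Proof.
move=> [s /perm_to_subseq[r w'sr] ws]; apply/multiset_leP.
case: w => [|x0 w] in ws *.
  exists [::], (enum_mset (seq_mset w')); split=> //.
  have -> : enum_mset (seq_mset ([::] : seq T)) = [::].
    by apply: perm_nilP; exact: perm_eq_seq_mset.
  exact: List.Forall2_nil.
have /(perm_iotaP x0)[Is Isp mE] := perm_eq_seq_mset (x0 :: w).
have [sz wsP] := (Forall2_nth le x0 x0 _ _).1 ws.
exists [seq nth x0 s i | i <- Is], r; split.
  apply: perm_trans (perm_eq_seq_mset _) _; apply: perm_trans w'sr _.
  by rewrite perm_cat2r perm_sym; apply/(perm_iotaP x0); exists Is; rewrite // -sz.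
rewrite mE.
have: all (fun i => i < size (x0 :: w)) Is.
  by apply/allP => i; rewrite (perm_mem Isp) mem_iota.
elim: Is {Isp mE} => [|i Is IHI] /=; first by move=> _; exact: List.Forall2_nil.
by move=> /andP[iw /IHI ?]; apply: List.Forall2_cons => //; exact: wsP.
Qed.

(** The enumeration of the larger multiset is imposed; the smaller one is rearranged to follow
    it. *)
Lemma multiset_le_word m w' : multiset_le le m (seq_mset w') ->
  exists w, m = seq_mset w /\ word_le le w w'.
Proof.
move=> /multiset_leP[s [r [w'sr ms]]].
have {}w'sr : perm_eq w' (s ++ r).
  by apply: perm_trans w'sr; rewrite perm_sym perm_eq_seq_mset.
pose o := map Some (enum_mset m) ++ nseq (size r) None.
case: w' w'sr => [|x0 w'] /=.
  rewrite perm_sym => /perm_nilP; case: s ms {o} => // ms _.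
  have m0 : enum_mset m = [::] by inversion ms.
  exists [::]; split; last exact: word_le_nil.
  by rewrite -[m]seq_mset_id m0.
move=> /(perm_iotaP x0)[Is Isp w'E].
have szo : size o = size (s ++ r).
  by rewrite !size_cat size_map size_nseq (Forall2_size ms).
pose w := pmap id [seq nth None o i | i <- Is]; exists w; split.
  rewrite -[m]seq_mset_id; apply/eq_seq_msetP.
  have -> : enum_mset m = pmap id o.
    rewrite /o pmap_cat -[LHS]cats0; congr (_ ++ _).
      by elim: (enum_mset m) => //= a l <-.
    by elim: (size r).
  apply: perm_pmap; rewrite perm_sym; apply/(perm_iotaP None).
  by exists Is; rewrite // szo.
rewrite w'E /w; have: all (fun i => i < size o) Is.
  by apply/allP => i; rewrite (perm_mem Isp) mem_iota szo.
elim: Is {Isp w'E w} => [|i Is IHI] /=; first by move=> _; exact: word_le_nil.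
move=> /andP[io /IHI IH]; case oi : (nth None o i) => [a|] /=; last exact: word_le_consr.
apply: word_le_cons => //; move: oi; rewrite /o !nth_cat size_map -(Forall2_size ms).
case: ltnP => i_m; last by rewrite nth_nseq; case: ifP.
rewrite (nth_map x0) // => -[<-].
by have [_] := (Forall2_nth le x0 x0 _ _).1 ms; apply.
Qed.

Hypothesis le_qo : quasi_order le.

(** Transitivity is inherited from words: starting with an enumeration of the largest multiset, the
    two smaller ones lift in turn. *)
Lemma multiset_le_qo : quasi_order (multiset_le le).
Proof.
split=> [m|m1 m2 m3].
  rewrite -[m]seq_mset_id; apply: word_le_multiset; exact: (word_le_qo le_qo).1.
rewrite -[m3]seq_mset_id => le12 /multiset_le_word[w2 [m2E le23]].
move: le12; rewrite m2E => /multiset_le_word[w1 [-> le12]].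
by apply: word_le_multiset; exact: (word_le_qo le_qo).2 le12 le23.
Qed.

Lemma wqo_multiset : wqo le -> wqo (multiset_le le).
Proof.
move=> wq f; have [i [j [ij fij]]] := higman le_qo wq (fun n => enum_mset (f n)).
exists i, j; split=> //; rewrite -[f i]seq_mset_id -[f j]seq_mset_id.
exact: word_le_multiset.
Qed.

End Multisets.

(** A monotone subsequence is extracted for one coordinate after the other. The statement unfolds
    [wqo] because the dependent functions are not given as a [choiceType] here. *)
Lemma wqo_family (k : nat) (T : 'I_k -> choiceType)
    (le : forall i, T i -> T i -> Prop) :
  (forall i, quasi_order (@le i)) -> (forall i, wqo (@le i)) ->
  forall f : nat -> forall i, T i, exists i j, i < j /\ family_le le (f i) (f j).
Proof.
move=> qo wq f.
have H (s : seq 'I_k) : exists phi : nat -> nat,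
    (forall i j, i < j -> phi i < phi j) /\
    forall i j, i < j -> forall a, a \in s -> le a (f (phi i) a) (f (phi j) a).
  elim: s => [|a s [phi [phi_incr phiP]]]; first by exists id.
  have [psi [psi_incr psiP]] :=
    wqo_monotone_subsequence (qo a) (fun n => f (phi n) a) (wq a).
  exists (phi \o psi); split=> i j ij; first exact/phi_incr/psi_incr.
  move=> b; rewrite inE => /orP[/eqP->|bs]; first exact: psiP.
  by apply: phiP bs; exact: psi_incr.
have [phi [phi_incr phiP]] := H (enum 'I_k).
exists (phi 0), (phi 1); split; first exact: phi_incr.
by move=> i; apply: phiP => //; rewrite mem_enum.
Qed.

Section Sums.
Variables (k : nat) (T : 'I_k -> choiceType) (le : forall i, T i -> T i -> Prop).

Lemma sum_le_Tagged i (a b : T i) :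
  sum_le le (Tagged T a) (Tagged T b) <-> le a b.
Proof.
split=> [[j [c [d [ac bd]]]]|ab]; last by exists i, a, b.
have ij : j = i := esym (congr1 tag ac).
subst j; move/eqP: ac; rewrite eq_Tagged => /eqP/= ->.
by move/eqP: bd; rewrite eq_Tagged => /eqP/= ->.
Qed.

Lemma sum_le_tag x y : sum_le le x y -> tag x = tag y.
Proof. by move=> [i [a [b [-> ->]]]]. Qed.
End Sums.

(** * Products of words *)

Section WordProducts.
Variables (T : choiceType) (le : T -> T -> Prop).
Hypothesis le_qo : quasi_order le.
Variables (E : Type) (den : E -> set T).
Hypothesis den_ideal : forall e, ideal le (den e).

Local Notation pden := (product_den den).
Local Notation wle := (word_le le).

Definition star_words (H : set T) : set (seq T) :=
  [set w | forall a, a \in w -> H a].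

Definition opt_words (H : set T) : set (seq T) :=
  [set w | w = [::] \/ exists2 a, H a & w = [:: a]].

Lemma star_words_cons H a w : star_words H (a :: w) <-> H a /\ star_words H w.
Proof.
split=> [Hw|[Ha Hw] b]; last by rewrite inE => /orP[/eqP->|/Hw].
by split=> [|b bw]; apply: Hw; rewrite inE ?eqxx // bw orbT.
Qed.

Lemma star_words_cat H u v :
  star_words H (u ++ v) <-> star_words H u /\ star_words H v.
Proof.
split=> [Hw|[Hu Hv] a]; last by rewrite mem_cat => /orP[/Hu|/Hv].
by split=> a au; apply: Hw; rewrite mem_cat au ?orbT.
Qed.

Lemma opt_star_words H : opt_words H `<=` star_words H.
Proof. by move=> w [->|[a Ha ->]] b //; rewrite inE => /eqP->. Qed.

Lemma ideal_cat_words A B : ideal wle A -> ideal wle B -> ideal wle (cat_words A B).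
Proof.
move=> [dA [a0 A0] dirA] [dB [b0 B0] dirB]; split.
- move=> x y xy [u [v [Au Bv yE]]]; move: xy; rewrite yE => /word_le_catr.
  by move=> [u' [v' [-> /dA/(_ Au) ? /dB/(_ Bv) ?]]]; exists u', v'.
- by exists (a0 ++ b0), a0, b0.
- move=> _ _ [u1 [v1 [Au1 Bv1 ->]]] [u2 [v2 [Au2 Bv2 ->]]].
  have [u [Au uu1 uu2]] := dirA _ _ Au1 Au2.
  have [v [Bv vv1 vv2]] := dirB _ _ Bv1 Bv2.
  by exists (u ++ v); split; [exists u, v | exact: word_le_cat | exact: word_le_cat].
Qed.

Lemma ideal_star_words H : downset le H -> ideal wle (star_words H).
Proof.
move=> dH; split; last 1 first.
- move=> u v Hu Hv; exists (u ++ v); split; first exact/star_words_cat.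
    by rewrite -{1}[u]cats0; apply: word_le_cat; [exact: (word_le_qo le_qo).1 | exact: word_le_nil].
  by rewrite -{1}[v]cat0s; apply: word_le_cat; [exact: word_le_nil | exact: (word_le_qo le_qo).1].
- by move=> u v uv Hv a /(word_le_mem uv)[b /Hv Hb]; move/dH; exact.
- by exists [::].
Qed.

Lemma ideal_opt_words H : ideal le H -> ideal wle (opt_words H).
Proof.
move=> [dH [h0 H0] dirH].
have up w : opt_words H w -> exists2 a, H a & wle w [:: a].
  move=> [->|[a Ha ->]]; first by exists h0 => //; exact: word_le_nil.
  by exists a => //; exact: (word_le_qo le_qo).1.
split; last 1 first.
- move=> u v /up[a Ha ua] /up[b Hb vb]; have [c [Hc ac bc]] := dirH _ _ Ha Hb.
  exists [:: c]; split; first by right; exists c.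
    apply: (word_le_qo le_qo).2 ua _.
    by apply: word_le_cons => //; exact: word_le_nil.
  apply: (word_le_qo le_qo).2 vb _.
  by apply: word_le_cons => //; exact: word_le_nil.
- move=> u v uv [vE|[a Ha vE]]; subst v; first by left; exact: word_le0 uv.
  case: u uv => [|b u]; first by left.
  move=> /word_le_cons_inv[[ba /word_le0->]|/word_le0 //].
  by right; exists b => //; exact: dH ba Ha.
- by exists [::]; left.
Qed.

Lemma ideal_atom e : ideal wle (atom_den den e).
Proof.
case: e => [C|C A]; first exact: ideal_opt_words.
by apply: ideal_star_words; exact: downset_union_den.
Qed.

Lemma ideal_product P : ideal wle (pden P).
Proof.
elim: P => [|e P IHP]; last by apply: ideal_cat_words => //; exact: ideal_atom.
split; [by move=> x y xy yE; move: xy; rewrite yE; exact: word_le0 | by exists [::] |].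
by move=> x y -> ->; exists [::]; split=> //; exact: word_le_nil.
Qed.

Lemma downset_product P : downset wle (pden P).
Proof. exact: downset_ideal (ideal_product P). Qed.

Lemma product_nil P : pden P [::].
Proof.
by have [dP [w Pw] _] := ideal_product P; apply: dP Pw; exact: word_le_nil.
Qed.

Lemma atom_nil e : atom_den den e [::].
Proof. by case: e => [C|C A] //; left. Qed.

Lemma product_consr e P : pden P `<=` pden (e :: P).
Proof. by move=> w Pw; exists [::], w; split=> //; exact: atom_nil. Qed.

Lemma cat_words_sub A A' B B' :
  A `<=` A' -> B `<=` B' -> @cat_words T A B `<=` cat_words A' B'.
Proof. by move=> AA BB _ [u [v [/AA ? /BB ? ->]]]; exists u, v. Qed.

Lemma star_absorb C A P :
  cat_words (atom_den den (Star C A)) (pden (Star C A :: P)) `<=` pden (Star C A :: P).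
Proof.
move=> _ [u [_ [Au [v [w [Av Pw ->]]] ->]]]; exists (u ++ v), w.
by split=> //; [exact/star_words_cat | rewrite catA].
Qed.

Definition finite_union (F : set (seq T)) : Prop :=
  exists s, F = union_den pden s.

Lemma finite_union0 : finite_union set0.
Proof. by exists [::]; rewrite union_den_nil. Qed.

Lemma finite_unionU F G : finite_union F -> finite_union G -> finite_union (F `|` G).
Proof. by move=> [s ->] [t ->]; exists (s ++ t); rewrite union_den_cat. Qed.

Lemma finite_union_product P : finite_union (pden P).
Proof. by exists [:: P]; rewrite union_den_cons union_den_nil setU0. Qed.

Lemma cat_words_setUl A B C :
  @cat_words T (A `|` B) C = cat_words A C `|` cat_words B C.
Proof.
apply/seteqP; split=> [_ [u [v [[?|?] ? ->]]]|_ [|] [u [v [? ? ->]]]];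
  [left|right| |]; exists u, v; split=> //; [by left|by right].
Qed.

Lemma cat_words_setUr A B C :
  @cat_words T A (B `|` C) = cat_words A B `|` cat_words A C.
Proof.
apply/seteqP; split=> [_ [u [v [? [?|?] ->]]]|_ [|] [u [v [? ? ->]]]];
  [left|right| |]; exists u, v; split=> //; [by left|by right].
Qed.

Lemma cat_words0 A : cat_words A set0 = set0 :> set (seq T).
Proof. by apply/seteqP; split=> [w [u [v []]]|]. Qed.

Lemma cat_0words A : cat_words set0 A = set0 :> set (seq T).
Proof. by apply/seteqP; split=> [w [u [v []]]|]. Qed.

Lemma product_den_cat P Q : pden (P ++ Q) = cat_words (pden P) (pden Q).
Proof.
elim: P => [|e P IHP] /=.
  apply/seteqP; split=> [w Qw|_ [_ [v [-> Qv ->]]]] //.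
  by exists [::], w.
rewrite IHP; apply/seteqP; split=> [_ [u [_ [eu [v [w [Pv Qw ->]]] ->]]]|].
  by exists (u ++ v), w; split=> //; [exists u, v | rewrite catA].
move=> _ [_ [w [[u [v [eu Pv ->]]] Qw ->]]].
by exists u, (v ++ w); split=> //; [exists v, w | rewrite catA].
Qed.

Lemma finite_union_cat F G :
  finite_union F -> finite_union G -> finite_union (cat_words F G).
Proof.
move=> [s ->] [t ->]; elim: s => [|P s IHs].
  by rewrite union_den_nil cat_0words; exact: finite_union0.
rewrite union_den_cons cat_words_setUl; apply: finite_unionU => // {IHs}.
elim: t => [|Q t IHt]; first by rewrite union_den_nil cat_words0; exact: finite_union0.
rewrite union_den_cons cat_words_setUr; apply: finite_unionU => //.
by rewrite -product_den_cat; exact: finite_union_product.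
Qed.

Hypothesis den_all : forall C, ideal le C -> exists e, den e = C.
Hypothesis le_wqo : wqo le.

Lemma finite_union_star H : downset le H -> finite_union (star_words H).
Proof.
move=> /(downset_union_ideals le_qo den_all le_wqo)[[|C A] ->].
  (* A starred atom carries a nonempty set, so the star of the empty set is rendered by the empty
     product. *)
  exists [:: [::]]; rewrite !union_den_cons !union_den_nil setU0.
  apply/seteqP; split=> [[|a w] // /(_ a)|w ->] //.
  by rewrite inE eqxx => /(_ isT).
suff -> : star_words (union_den den (C :: A)) = pden [:: Star C A].
  exact: finite_union_product.
apply/seteqP; split=> [w Hw|_ [u [_ [Hu -> ->]]]]; last by rewrite cats0.
by exists w, [::]; split=> //; rewrite cats0.
Qed.

Lemma finite_union_opt H : downset le H -> finite_union (opt_words H).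
Proof.
move=> /(downset_union_ideals le_qo den_all le_wqo)[s ->].
elim: s => [|C s IHs].
  suff -> : opt_words (union_den den [::]) = pden [::].
    exact: finite_union_product.
  by apply/seteqP; split=> [w [//|[a]]|w ->]; [rewrite union_den_nil | left].
suff -> : opt_words (union_den den (C :: s)) =
    pden [:: Opt C] `|` opt_words (union_den den s).
  by apply: finite_unionU => //; exact: finite_union_product.
rewrite union_den_cons; apply/seteqP; split=> [w [->|[a [aC|aH] ->]]|].
- by right; left.
- by left; exists [:: a], [::]; split=> //; right; exists a.
- by right; right; exists a.
move=> w [[u [_ [[->|[a aC ->]] -> ->]]]|[->|[a aH ->]]]; [by left| |by left|].
  by right; exists a => //; left.
by right; exists a => //; right.
Qed.

(** No letter of [u] can host [a], so the embedding starts inside [v]. *)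
Lemma word_le_skip H a w u v :
  star_words (H `\` le a) u -> wle (a :: w) (u ++ v) -> wle (a :: w) v.
Proof.
elim: u => //= b u IHu /star_words_cons[[_ nab] uH].
by case/word_le_cons_inv => [[]|/(IHu uH)].
Qed.

Lemma word_le_catl_drop u v w : wle w v -> wle w (u ++ v).
Proof. by move=> wv; rewrite -[w]cat0s; apply: word_le_cat => //; exact: word_le_nil. Qed.

Lemma word_le_behead a w v : wle (a :: w) v -> wle w v.
Proof.
by move=> h; apply: (word_le_qo le_qo).2 h; apply: word_le_consr; exact: (word_le_qo le_qo).1.
Qed.

(** The cases are whether the optional letter hosts [a]. If it does, the remainder must avoid [w]
    only. The first term still allows every letter of [C], to remain a downset: at most one letter
    before a word avoiding [w] cannot create [a :: w]. *)
Lemma opt_product_remove C P a w :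
  pden (Opt C :: P) `\` wle (a :: w) =
  cat_words (opt_words (den C)) (pden P `\` wle w) `|`
  cat_words (opt_words (den C `\` le a)) (pden P `\` wle (a :: w)).
Proof.
apply/seteqP; split=> [_ [[o [v [[->|[b bC ->]] Pv ->]] nle]]|x].
- right; exists [::], v; split=> //; by left.
- have [ab|nab] := pselect (le a b).
    left; exists [:: b], v; split=> //; first by right; exists b.
    by split=> // wv; apply: nle; exact: word_le_cons.
  right; exists [:: b], v; split=> //; first by right; exists b.
  by split=> // wv; apply: nle; exact: word_le_consr.
move=> [[o [v [oC [Pv nle] ->]]]|[o [v [oC [Pv nle] ->]]]].
  split; first by exists o, v.
  move: oC => [->|[b bC ->]] /=; first by move=> /word_le_behead.
  by move=> /word_le_cons_inv[[]|/word_le_behead].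
split.
  exists o, v; split=> //.
  by case: oC => [->|[b [bC _] ->]]; [left | right; exists b].
by move=> /(word_le_skip (opt_star_words oC)).
Qed.

(** The starred word is cut at its first letter above [a]. Before it, letters avoid [a]; after it,
    the rest of the starred word and [P] together avoid [w]. The second term is the case without
    such a letter. *)
Lemma star_product_remove C A P a w (H := union_den den (C :: A)) :
  pden (Star C A :: P) `\` wle (a :: w) =
  cat_words (star_words (H `\` le a))
    (cat_words (opt_words H) (pden (Star C A :: P) `\` wle w)) `|`
  cat_words (star_words (H `\` le a)) (pden P `\` wle (a :: w)).
Proof.
apply/seteqP; split=> [_ [[u [v [uH Pv ->]] nle]]|x].
  have [nau|[u1 [b [u2 [uE u1H ab]]]]] : star_words (H `\` le a) u \/
      exists u1 b u2, [/\ u = u1 ++ b :: u2, star_words (H `\` le a) u1 & le a b].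
    elim: u uH {nle} => [|b u IHu]; first by left.
    move=> /star_words_cons[bH /IHu uH].
    have [ab|nab] := pselect (le a b); first by right; exists [::], b, u.
    case: uH => [uH|[u1 [c [u2 [-> u1H ac]]]]]; first by left; apply/star_words_cons.
    by right; exists (b :: u1), c, u2; split=> //; apply/star_words_cons.
  - right; exists u, v; split=> //; split=> // awv.
    by apply: nle; exact: word_le_catl_drop.
  - left; exists u1, (b :: u2 ++ v); rewrite uE -catA; split=> //.
    move: uH; rewrite uE => /star_words_cat[_ /star_words_cons[bH u2H]].
    exists [:: b], (u2 ++ v); split=> //; first by right; exists b.
    split; first by exists u2, v.
    move=> wuv; apply: nle; rewrite uE -catA; apply: word_le_catl_drop.
    exact: word_le_cons.
have sub : star_words (H `\` le a) `<=` star_words H.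
  by move=> u uH b /uH[].
move=> [[u [_ [uH [o [v [oH [Pv nle] ->]]] ->]]]|[u [v [uH [Pv nle] ->]]]].
  split.
    have := @star_absorb C A P (u ++ (o ++ v)); apply.
    exists u, (o ++ v); split=> //; first exact: sub.
    by apply: star_absorb; exists o, v; split=> //; exact: opt_star_words.
  move=> /(word_le_skip uH); case: oH => [->|[b bH ->]] /=.
    by move=> /word_le_behead.
  by move=> /word_le_cons_inv[[]|/word_le_behead].
split; first by exists u, v; split=> //; exact: sub.
by move=> /(word_le_skip uH).
Qed.

(** Two inductions are nested: the outer one on [w] removes the shorter word from any finite union,
    the inner one on the product removes [a :: w] from its tail. *)
Lemma finite_union_remove w F : finite_union F -> finite_union (F `\` wle w).
Proof.
elim: w F => [|a w IHw] F [s ->].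
  suff -> : union_den pden s `\` wle [::] = set0 by exact: finite_union0.
  by apply/seteqP; split=> // v [_]; apply; exact: word_le_nil.
elim: s => [|P s IHs].
  by rewrite union_den_nil set0D; exact: finite_union0.
rewrite union_den_cons setDUl; apply: finite_unionU => // {s IHs}.
have dH H : downset le H -> downset le (H `\` le a) by exact: downsetD.
elim: P => [|[C|C A] P IHP].
- suff -> : pden [::] `\` wle (a :: w) = pden [::].
    exact: finite_union_product.
  by apply/seteqP; split=> [v []|v ->] //; split=> // /word_le0.
- rewrite opt_product_remove; apply: finite_unionU; apply: finite_union_cat => //.
  + by apply: finite_union_opt; exact: downset_ideal (den_ideal C).
  + by apply: IHw; exact: finite_union_product.
  + by apply/finite_union_opt/dH; exact: downset_ideal (den_ideal C).
- have dU : downset le (union_den den (C :: A)) by exact: downset_union_den.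
  rewrite star_product_remove; apply: finite_unionU; apply: finite_union_cat => //.
  + exact/finite_union_star/dH.
  + apply: finite_union_cat; first exact: finite_union_opt.
    by apply: IHw; exact: finite_union_product.
  + exact/finite_union_star/dH.
Qed.

Lemma downset_finite_union F : downset wle F -> finite_union F.
Proof.
move=> dF.
have [|s [sF sP]] := upset_finite_basis (U := ~` F) (higman le_qo le_wqo).
  by move=> x y xy nFx Fy; apply: nFx; exact: dF xy Fy.
suff : finite_union [set w | forall x, x \in s -> ~ wle x w].
  congr finite_union; apply/seteqP; split=> w /=.
    by move=> H; apply: contrapT => /sP[x /H].
  by move=> Fw x /sF nFx xw; apply: nFx; exact: dF xw Fw.
(* The basis of the complement is removed word by word, starting from all words, which are the star
   of [setT]. *)
elim: s {sF sP} => [|x s IHs].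
  suff -> : [set w | forall x, x \in [::] -> ~ wle x w] = star_words setT.
    exact: finite_union_star.
  by apply/seteqP; split.
suff -> : [set w | forall y, y \in x :: s -> ~ wle y w] =
    [set w | forall y, y \in s -> ~ wle y w] `\` wle x by exact: finite_union_remove.
apply/seteqP; split=> w /= H.
  by split=> [y ys|]; apply: H; rewrite inE ?eqxx // ys orbT.
by move=> y; rewrite inE => /orP[/eqP->|]; [exact: H.2 | exact: H.1].
Qed.

Theorem ideal_wordsP L : ideal wle L <-> exists P, pden P = L.
Proof.
split=> [iL|[P <-]]; last exact: ideal_product.
have [s Ls] := downset_finite_union (downset_ideal iL).
have : L `<=` union_den pden s by rewrite -Ls.
move=> /(ideal_sub_union_den ideal_product iL).
move=> /List.Exists_exists[P [Ps LP]]; exists P; apply/seteqP; split=> // w Pw.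
by rewrite Ls; apply/List.Exists_exists; exists P.
Qed.

End WordProducts.

(** * Inclusion of products of words *)

Section WordInclusion.
Variables (T : choiceType) (le : T -> T -> Prop).
Hypothesis le_qo : quasi_order le.
Variables (E : Type) (leE : E -> E -> Prop) (den : E -> set T).
Hypothesis den_ideal : forall e, ideal le (den e).
Hypothesis leEP : forall e e', leE e e' <-> den e `<=` den e'.

Local Notation pden := (product_den den).
Local Notation wle := (word_le le).

Lemma ExistsE C A : List.Exists (leE C) A <-> den C `<=` union_den den A.
Proof.
rewrite (ideal_sub_union_denP den_ideal) //.
by split; apply: List.Exists_impl => e /leEP.
Qed.

Lemma ForallE A B :
  List.Forall (fun C => List.Exists (leE C) B) A <->
  union_den den A `<=` union_den den B.
Proof.
elim: A => [|C A IHA].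
  by rewrite union_den_nil; split=> // _.
rewrite union_den_cons List.Forall_cons_iff IHA ExistsE.
by split=> [[CB AB]|CAB]; [rewrite subUset | move: CAB; rewrite subUset].
Qed.

Lemma atom_le_sub e e' : atom_le leE e e' -> atom_den den e `<=` atom_den den e'.
Proof.
case: e e' => [C|C A] [C'|C' A'] //=.
- by move=> /leEP CC w [->|[a aC ->]]; [left|right; exists a => //; exact: CC].
- move=> /ExistsE CA w [->//|[a aC ->]] b; rewrite inE => /eqP->; exact: CA.
- by move=> /ForallE AA w Aw b /Aw/AA.
Qed.

(** A word of the left side is modified so that [e'] cannot absorb its first letter. If some letter
    of [e] is foreign to [e'], it is prefixed to the word, or, for an optional letter, replaces it
    by an upper bound of both, given by directedness. The word obtained then lies in [Q], and so
    does the original one, below it. *)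
Lemma product_skip e e' P Q : downset wle Q -> ~ atom_le leE e e' ->
  cat_words (atom_den den e) P `<=` cat_words (atom_den den e') Q ->
  cat_words (atom_den den e) P `<=` Q.
Proof.
move=> dQ nee PQ.
(* [H'] is the set of letters that [e'] can produce. *)
pose H' := if e' is Star C A then union_den den (C :: A) else
  if e' is Opt C then den C else set0.
have e'H : atom_den den e' `<=` star_words H'.
  by case: e' @H' {nee PQ} => [C|C A] //; exact: opt_star_words.
have strip z w : ~ H' z -> cat_words (atom_den den e') Q (z :: w) -> Q (z :: w).
  move=> nz [[|a u] [v [eu Qv]]] /=; first by move=> ->.
  move=> [zE wE]; case: nz; rewrite zE; apply: (e'H _ eu).
  by rewrite inE eqxx.
case: e nee PQ => [C|C A] nee PQ.
  have [a aC naH] : exists2 a, den C a & ~ H' a.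
    apply: contrapT => na; apply: nee.
    have CH : den C `<=` H'.
      by move=> a aC; apply: contrapT => naH; apply: na; exists a.
    by case: (e') @H' CH {e'H strip na PQ} => [C'|C' A'] /= CH; [exact/leEP | exact/ExistsE].
  have dH : downset le H'.
    case: (e') @H' {e'H strip naH nee PQ} => [C'|C' A'].
      exact: downset_ideal (den_ideal C').
    exact: (downset_union_den den_ideal).
  have up z p : den C z -> P p -> le a z -> Q (z :: p).
    move=> zC Pp az; apply: strip; first by move/(dH _ _ az).
    by apply: PQ; exists [:: z], p; split=> //; right; exists z.
  move=> _ [o [p [[->|[c cC ->]] Pp ->]]] /=.
    apply: dQ (up a p aC Pp (le_qo.1 _)).
    by apply: word_le_consr; exact: (word_le_qo le_qo).1.
  have [_ _ /(_ _ _ aC cC)[z [zC az cz]]] := den_ideal C.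
  apply: dQ (up z p zC Pp az).
  by apply: word_le_cons => //; exact: (word_le_qo le_qo).1.
move=> _ [u [p [uA Pp ->]]].
have ext a : union_den den (C :: A) a -> cat_words (atom_den den e') Q (a :: u ++ p).
  by move=> aA; apply: PQ; exists (a :: u), p; split=> //; apply/star_words_cons.
have shrink a : Q (a :: u ++ p) -> Q (u ++ p).
  by apply: dQ; apply: word_le_consr; exact: (word_le_qo le_qo).1.
(* A starred [e] against an optional [e']: one extra letter [c] is supplied for [e'] to absorb, so
   that [u ++ p] is left to [Q]. *)
case: e' @H' e'H strip nee ext {PQ} => [C'|C' A'] H' e'H strip nee ext.
  have [_ [c cC] _] := den_ideal C.
  have /ext[o [q [[->|[b bC ->]] Qq /= H]]] : union_den den (C :: A) c.
    by rewrite union_den_cons; left.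
    by apply: (shrink c); rewrite H.
  by case: H => _ ->.
have [a aA naH] : exists2 a, union_den den (C :: A) a & ~ union_den den (C' :: A') a.
  apply: contrapT => na; apply: nee; apply/ForallE => a aA.
  by apply: contrapT => naH; apply: na; exists a.
by apply: (shrink a); apply: (strip a (u ++ p) naH); exact: ext.
Qed.

(** Soundness follows the rules. For completeness, the test [atom_le e e'] dictates the rule, and
    the sum of the lengths decreases in each case. *)
Theorem product_leP P Q : product_le leE P Q <-> pden P `<=` pden Q.
Proof.
split.
  elim=> {P Q} [Q _ ->|e P e' P' _ _ IH|C P C' P' CC _ IH|e P C' A' P' ee _ IH].
  - exact: (product_nil le_qo den_ideal).
  - by apply: subset_trans IH _; exact: product_consr.
  - by apply: cat_words_sub IH; apply: (@atom_le_sub (Opt C) (Opt C')).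
  - apply: subset_trans (@star_absorb T E den C' A' P').
    by apply: cat_words_sub => //; exact: atom_le_sub ee.
have [n] := ubnP (size P + size Q); elim: n P Q => // n IHn [|e P] Q sz PQ.
  exact: ProductNil.
case: Q => [|e' Q] in sz PQ *.
  (* Denotations of names are nonempty, so a nonempty product contains a nonempty word. *)
  have [a [w Pw]] : exists a w, pden (e :: P) (a :: w).
    case: e {sz PQ} => [C|C A]; have [_ [a aC] _] := den_ideal C; exists a, [::].
      by exists [:: a], [::]; split=> //; [right; exists a | exact: (product_nil le_qo den_ideal P)].
    exists [:: a], [::]; split=> //; last exact: (product_nil le_qo den_ideal P).
    by move=> b; rewrite inE => /eqP->; rewrite union_den_cons; left.
  by have := PQ _ Pw.
have dQ := downset_product le_qo den_ideal.
have [ee|nee] := pselect (atom_le leE e e'); last first.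
  apply: ProductSkip => //; apply: IHn; first by move: sz => /=; lia.
  exact: product_skip (dQ Q) nee PQ.
case: e' => [C'|C' A'] in ee sz PQ *.
  case: e => // C in ee sz PQ *; apply: ProductOpt => //.
  apply: IHn => [|p Pp]; first by move: sz => /=; lia.
  have [_ [c cC] _] := den_ideal C.
  (* Prefixing [c] to [p] uses up the optional atom on the left. On the right, either [C'] takes
     [c], or [Q] contains [c :: p] and hence [p]. *)
  have /PQ[o [q [[->|[b bC ->]] Qq /= H]]] : pden (Opt C :: P) (c :: p).
    - by exists [:: c], p; split=> //; right; exists c.
    - by apply: dQ Qq; rewrite -[q]H; apply: word_le_consr; exact: (word_le_qo le_qo).1.
    - by case: H => _ ->.
apply: ProductStar => //; apply: IHn; first by move: sz => /=; lia.
by apply: subset_trans PQ; exact: product_consr.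
Qed.

End WordInclusion.

(** * Products of multisets *)

Section MultisetProducts.
Variables (T : choiceType) (le : T -> T -> Prop).
Hypothesis le_qo : quasi_order le.
Variables (E : Type) (den : E -> set T).
Hypothesis den_ideal : forall e, ideal le (den e).

Local Notation pden := (product_den den).
Local Notation wle := (word_le le).
Local Notation mle := (multiset_le le).

Lemma seq_mset_cat (u v : seq T) :
  seq_mset (u ++ v) = (seq_mset u `+` seq_mset v)%mset.
Proof. by apply/msetP => a; rewrite msetE2 !mset_seqE count_cat. Qed.

Lemma seq_mset_nil : seq_mset [::] = mset0 :> multiset T.
Proof. by apply/msetP => a; rewrite mset_seqE mset0E. Qed.

Lemma seq_mset_seq1 (a : T) : seq_mset [:: a] = [mset a]%mset.
Proof. by apply/msetP => b; rewrite mset_seqE msetnE /= addn0 eq_sym; case: eqP. Qed.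

Lemma mem_seq_mset (w : seq T) (a : T) : (a \in seq_mset w) = (a \in w).
Proof. by rewrite in_mset mset_seqE -has_count has_pred1. Qed.

(** This brings multiset products back to words: a starred word followed by a product of optional
    atoms, up to permutation. *)
Lemma mproduct_denE A Cs m : mproduct_den den (A, Cs) m <->
  exists u v, [/\ star_words (union_den den A) u, pden (map (@Opt E) Cs) v &
    m = seq_mset (u ++ v)].
Proof.
(* The left fold accumulates its first argument, hence the statement for every [M]. *)
have foldlE (M : set (multiset T)) :
    foldl (fun M C => sum_multisets M (mopt_den den C)) M Cs m <->
    exists m0 v, [/\ M m0, pden (map (@Opt E) Cs) v & m = (m0 `+` seq_mset v)%mset].
  elim: Cs M => [|C Cs IHCs] M /=.
    split=> [Mm|[m0 [v [Mm0 -> ->]]]]; last by rewrite seq_mset_nil msetD0.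
    by exists m, [::]; split=> //; rewrite seq_mset_nil msetD0.
  rewrite IHCs; split.
    move=> [_ [v [[m1 [m2 [Mm1 Cm2 ->]]] Cv ->]]].
    have [o [oC ->]] : exists o, opt_words (den C) o /\ m2 = seq_mset o.
      case: Cm2 => [->|[a aC ->]]; first by exists [::]; rewrite seq_mset_nil; split=> //; left.
      by exists [:: a]; rewrite seq_mset_seq1; split=> //; right; exists a.
    exists m1, (o ++ v); split=> //; first by exists o, v.
    by rewrite seq_mset_cat msetDA.
  move=> [m0 [_ [Mm0 [o [v [oC Cv ->]]] ->]]].
  exists (m0 `+` seq_mset o)%mset, v; split=> //; last by rewrite seq_mset_cat msetDA.
  exists m0, (seq_mset o); split=> //.
  by case: oC => [->|[a aC ->]]; [left; rewrite seq_mset_nil | right; exists a; rewrite ?seq_mset_seq1].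
rewrite /mproduct_den foldlE; split=> [[m0 [v [Am0 Cv ->]]]|[u [v [Au Cv ->]]]].
  exists (enum_mset m0), v; split=> //.
  by rewrite seq_mset_cat seq_mset_id.
exists (seq_mset u), v; split=> //; last by rewrite seq_mset_cat.
by move=> a; rewrite mem_seq_mset => /Au.
Qed.

Definition stars (P : seq (atom E)) : seq E :=
  flatten [seq if e is Star C A then C :: A else [::] | e <- P].

Definition opts (P : seq (atom E)) : seq E :=
  flatten [seq if e is Opt C then [:: C] else [::] | e <- P].

(** Once the order of letters is forgotten, all starred sets merge into one and the optional atoms
    can be moved to the end. *)
Lemma image_product P :
  seq_mset @` pden P = mproduct_den den (stars P, opts P).
Proof.
have key w : pden P w -> exists u v, [/\ star_words (union_den den (stars P)) u,
    pden (map (@Opt E) (opts P)) v & perm_eq w (u ++ v)].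
  elim: P w => [|e P IHP] w0 /=; first by move=> ->; exists [::], [::].
  move=> [o [w [eo /IHP[u [v [Pu Pv wuv]]] ->]]].
  case: e eo => [C|C A] eo; rewrite /stars /opts /=.
    exists u, (o ++ v); split=> //; first by exists o, v.
    by rewrite perm_sym perm_catCA perm_cat2l perm_sym.
  exists (o ++ u), v; split=> //; last by rewrite -catA perm_cat2l.
  by rewrite -cat_cons union_den_cat; apply/star_words_cat; split=> a /=; [left; exact: eo | right; exact: Pu].
have yek u v : star_words (union_den den (stars P)) u ->
    pden (map (@Opt E) (opts P)) v -> exists2 w, pden P w & perm_eq w (u ++ v).
  elim: P {key} u v => [|e P IHP] u v.
    rewrite /stars /= union_den_nil => Hu ->; exists [::] => //.
    by case: u Hu => // a u /(_ a); rewrite inE eqxx => /(_ isT).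
  case: e => [C|C A]; rewrite /stars /opts /=.
    move=> Hu [o [v' [oC /(IHP _ _ Hu)[w Pw wuv] ->]]].
    exists (o ++ w); first by exists o, w.
    by rewrite perm_sym perm_catCA perm_cat2l perm_sym.
  rewrite -cat_cons union_den_cat => Hu Hv.
  (* A letter of the merged star goes to the first starred atom if that atom allows it, and
     otherwise to the remaining ones. *)
  pose p a := `[< union_den den (C :: A) a >].
  have Hu2 : star_words (union_den den (stars P)) (seq.filter (predC p) u).
    by move=> a; rewrite mem_filter => /andP[/asboolP na /Hu[]].
  have [w Pw wuv] := IHP _ _ Hu2 Hv.
  exists (seq.filter p u ++ w).
    by exists (seq.filter p u), w; split=> // a; rewrite mem_filter => /andP[/asboolP].
  apply: perm_trans (_ : perm_eq _ (seq.filter p u ++ (seq.filter (predC p) u ++ v))) _.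
    by rewrite perm_cat2l.
  by rewrite catA perm_cat2r perm_filterC.
apply/seteqP; split=> [_ [w /key[u [v [Pu Pv wuv]]] <-]|m].
  by apply/mproduct_denE; exists u, v; split=> //; apply/eq_seq_msetP.
move=> /mproduct_denE[u [v [/yek Pu /Pu[w Pw wuv] ->]]].
by exists w => //; apply/eq_seq_msetP.
Qed.

Lemma ideal_image (L : set (seq T)) : ideal wle L -> ideal mle (seq_mset @` L).
Proof.
move=> [dL [w0 Lw0] dirL]; split.
- move=> m y my [w Lw wy]; move: my; rewrite -wy => /multiset_le_word[w' [-> ww]].
  by exists w' => //; exact: dL ww Lw.
- by exists (seq_mset w0), w0.
- move=> _ _ [u Lu <-] [v Lv <-]; have [w [Lw uw vw]] := dirL _ _ Lu Lv.
  exists (seq_mset w); split; first (by exists w); exact: word_le_multiset.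
Qed.

Lemma ideal_mproduct P : ideal mle (mproduct_den den P).
Proof.
(* A word product whose image is the given one; the starred atom is omitted when [A] is empty. *)
case: P => A Cs; pose sA := if A is C :: A' then [:: Star C A'] else [::].
have [starsE optsE] : stars (sA ++ map (@Opt E) Cs) = A /\ opts (sA ++ map (@Opt E) Cs) = Cs.
  rewrite /stars /opts !map_cat !flatten_cat -!map_comp.
  have -> : flatten [seq ((fun e => if e is Star C B then C :: B else [::]) \o @Opt E) i
      | i <- Cs] = [::] by elim: (Cs).
  have -> : flatten [seq ((fun e => if e is Opt C then [:: C] else [::]) \o @Opt E) i
      | i <- Cs] = Cs by elim: (Cs) => //= C Cs' ->.
  by rewrite cats0 /sA; case: (A) => //= C A'; rewrite cats0.
have := ideal_image (ideal_product le_qo den_ideal (sA ++ map (@Opt E) Cs)).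
by rewrite image_product starsE optsE.
Qed.

Hypothesis den_all : forall C, ideal le C -> exists e, den e = C.
Hypothesis le_wqo : wqo le.

(** The words enumerating members of [L] form a downset, in general not directed. It is a finite
    union of products, and irreducibility of [L] selects one of their images. *)
Theorem ideal_multisetsP L : ideal mle L <-> exists P, mproduct_den den P = L.
Proof.
split=> [iL|[P <-]]; last exact: ideal_mproduct.
have dL : downset wle [set w | L (seq_mset w)].
  move=> u v uv Lv; apply: (downset_ideal iL) Lv; exact: word_le_multiset.
have [s sE] := downset_finite_union le_qo den_ideal den_all le_wqo dL.
have mem_s w : L (seq_mset w) <-> union_den pden s w by rewrite -sE.
have : L `<=` union_den (fun P => seq_mset @` pden P) s.
  move=> m; rewrite -{1}[m]seq_mset_id => /mem_s; apply: List.Exists_impl => P Pm.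
  by exists (enum_mset m) => //; rewrite seq_mset_id.
move=> /(ideal_sub_union_den (fun P => ideal_image (ideal_product le_qo den_ideal P)) iL).
move=> /List.Exists_exists[P [Ps LP]]; exists (stars P, opts P).
rewrite -image_product; apply/seteqP; split=> // _ [w Pw <-]; apply/mem_s.
by apply/List.Exists_exists; exists P.
Qed.

End MultisetProducts.

(** * Inclusion of products of multisets *)

Section MultisetInclusion.
Variables (T : choiceType) (le : T -> T -> Prop).
Hypothesis le_qo : quasi_order le.
Variables (E : Type) (leE : E -> E -> Prop) (den : E -> set T).
Hypothesis den_ideal : forall e, ideal le (den e).
Hypothesis leEP : forall e e', leE e e' <-> den e `<=` den e'.

Local Notation opts_den Cs := (product_den den (map (@Opt E) Cs)).

(* A greedy form of [mproduct_le]: the elements of the first list are matched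
   one after the other, each one using up its partner. *)
Inductive matching (cov : E -> Prop) : seq E -> seq E -> Prop :=
| MatchNil Q : matching cov [::] Q
| MatchCov C Cs Q : cov C -> matching cov Cs Q -> matching cov (C :: Cs) Q
| MatchTake C Cs C' Q1 Q2 : leE C C' -> matching cov Cs (Q1 ++ Q2) ->
    matching cov (C :: Cs) (Q1 ++ C' :: Q2).

(** [js] records which optional factor produced each letter. Distinctness of its entries later
    yields the injectivity required by [mproduct_le]. *)
Lemma opts_den_nth Cs v : opts_den Cs v -> exists js : seq nat,
  [/\ size js = size v, uniq js, all (fun j => j < size Cs) js &
      forall i x0 e0, i < size v -> den (nth e0 Cs (nth 0 js i)) (nth x0 v i)].
Proof.
elim: Cs v => [|C Cs IHCs] v; first by move=> ->; exists [::].
move=> [o [w [oC /IHCs[js [sz ujs ljs Hjs]] ->]]].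
have sP : all (fun j => j < (size Cs).+1) [seq j.+1 | j <- js].
  by rewrite all_map.
case: oC => [->|[a aC ->]].
  exists (map S js); split=> //; first by rewrite size_map.
    by rewrite map_inj_uniq // => ? ? [].
  by move=> i x0 e0 iw; rewrite (nth_map 0) ?sz //=; exact: Hjs.
exists (0 :: map S js); split=> //=; first by rewrite size_map sz.
  by rewrite map_inj_uniq ?ujs ?andbT => [|? ? []] //; apply/negP => /mapP[].
by move=> [|i] x0 e0 //= iw; rewrite (nth_map 0) ?sz //=; exact: Hjs.
Qed.

Lemma opts_den_full Cs w : List.Forall2 den Cs w -> opts_den Cs w.
Proof.
by elim=> // C a Cs' w' Ca _ IH; exists [:: a], w'; split=> //; right; exists a.
Qed.

Lemma opts_den_size Cs v : opts_den Cs v -> size v <= size Cs.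
Proof.
elim: Cs v => [|C Cs IHCs] v; first by move=> ->.
by move=> [o [w [[->|[a _ ->]] /IHCs sz ->]]] //=; exact: leqW.
Qed.

Lemma opts_den_insert Q1 C Q2 o v : opt_words (den C) o ->
  opts_den (Q1 ++ Q2) v -> exists2 w, opts_den (Q1 ++ C :: Q2) w & perm_eq (o ++ v) w.
Proof.
move=> oC; elim: Q1 v => [|D Q1 IHQ] v; first by exists (o ++ v) => //; exists o, v.
move=> [d [w [dD /IHQ[x Qx owx] ->]]]; exists (d ++ x); first by exists d, x.
by rewrite perm_catCA perm_cat2l.
Qed.

Lemma matching_sub A' Cs Q :
  matching (fun C => List.Exists (leE C) A') Cs Q ->
  forall A, List.Forall (fun C => List.Exists (leE C) A') A ->
  mproduct_den den (A, Cs) `<=` mproduct_den den (A', Q).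
Proof.
move=> H A /(ForallE den_ideal leEP) AA m /mproduct_denE[u [v [Au Cv ->]]].
have {A AA Au} Au : star_words (union_den den A') u by move=> a /Au/AA.
(* The starred part [u] varies in the induction, since a covered optional letter moves into it. *)
apply/mproduct_denE; elim: H u v Au Cv => {Cs Q} [Q|C Cs Q|C Cs C' Q1 Q2].
- move=> u v Au ->; exists u, [::]; split=> //.
  exact: (product_nil le_qo den_ideal).
- move=> /(ExistsE den_ideal leEP) CA _ IH u _ Au [o [v [oC Cv ->]]].
  have oA : star_words (union_den den A') o.
    by move=> a /(opt_star_words oC)/CA.
  have /IH/(_ Cv)[u' [v' [? ? E']]] : star_words (union_den den A') (u ++ o).
    exact/star_words_cat.
  by exists u', v'; split=> //; rewrite catA.
- move=> /leEP CC _ IH u _ Au [o [v [oC Cv ->]]].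
  have [u' [v' [Au' Qv' /eq_seq_msetP E']]] := IH _ _ Au Cv.
  have oC' : opt_words (den C') o.
    by case: oC => [->|[a aC ->]]; [left | right; exists a => //; exact: CC].
  have [w Qw wE] := opts_den_insert oC' Qv'.
  exists u', w; split=> //; apply/eq_seq_msetP.
  apply: perm_trans (_ : perm_eq _ (o ++ (u' ++ v'))) _.
    by rewrite perm_catCA perm_cat2l.
  by rewrite perm_catCA perm_cat2l.
Qed.

Lemma mproduct_le_matching A Cs A' Q : mproduct_le leE (A, Cs) (A', Q) ->
  List.Forall (fun C => List.Exists (leE C) A') A /\
  matching (fun C => List.Exists (leE C) A') Cs Q.
Proof.
set cov := fun C => List.Exists (leE C) A'; move=> [/= Acov [r r_inj rP]]; split=> //; clear Acov.
(* The injection on a dependent subtype becomes a function on positions, constrained only at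
   uncovered ones; this form survives induction on [Cs]. *)
have [f [f_inj fQ fP]] : exists f : nat -> nat,
    [/\ forall i j e, i < size Cs -> j < size Cs -> ~ cov (nth e Cs i) ->
          ~ cov (nth e Cs j) -> f i = f j -> i = j,
        forall i e, i < size Cs -> ~ cov (nth e Cs i) -> f i < size Q &
        forall i e, i < size Cs -> ~ cov (nth e Cs i) ->
          leE (nth e Cs i) (nth e Q (f i))].
  case CsE : (Cs) => [|e0 Cs']; first by exists id; split.
  rewrite -CsE.
  have /choice[f fP] (i : nat) : exists j, forall (li : i < size Cs)
      (nc : ~ cov (tnth (in_tuple Cs) (Ordinal li))),
      j = r (exist _ (Ordinal li) nc) :> nat.
    have [li|nli] := pselect (i < size Cs); last by exists 0.
    have [c|nc] := pselect (cov (tnth (in_tuple Cs) (Ordinal li))); first by exists 0 => li' nc; case: nc; rewrite (bool_irrelevance li' li).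
    exists (r (exist _ (Ordinal li) nc)) => li' nc'.
    by congr (nat_of_ord (r _)); apply: eq_exist; apply: val_inj.
  have covE i (li : i < size Cs) e : nth e Cs i = tnth (in_tuple Cs) (Ordinal li).
    by rewrite (tnth_nth e).
  exists f; split.
  - move=> i j e li lj; rewrite (covE i li) (covE j lj) => nci ncj.
    rewrite (fP i li nci) (fP j lj ncj) => /val_inj/r_inj.
    by move=> /(congr1 (fun x => val (sval x))).
  - by move=> i e li; rewrite (covE i li) => nci; rewrite (fP i li nci).
  - move=> i e li; rewrite (covE i li) => nci; rewrite (fP i li nci).
    have := rP (exist _ (Ordinal li) nci).
    by rewrite /= [X in leE _ X](tnth_nth e).
elim: Cs {r r_inj rP} Q f f_inj fQ fP => [|C Cs IHCs] Q f f_inj fQ fP.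
  exact: MatchNil.
have [c|nc] := pselect (cov C).
  apply: MatchCov => //; apply: (IHCs Q (f \o S)) => /=.
  - move=> i j e li lj nci ncj fij.
    exact: succn_inj (f_inj i.+1 j.+1 e li lj nci ncj fij).
  - by move=> i e li nci; exact: (fQ i.+1 e).
  - by move=> i e li nci; exact: (fP i.+1 e).
have lQ := fQ 0 C isT nc.
have := fP 0 C isT nc; rewrite /=.
have QE : take (f 0) Q ++ nth C Q (f 0) :: drop (f 0).+1 Q = Q.
  by rewrite -drop_nth // cat_take_drop.
move=> lC; rewrite -QE; apply: MatchTake => //.
have f0 i e : i < size Cs -> ~ cov (nth e Cs i) -> f i.+1 <> f 0.
  by move=> li nci /(f_inj i.+1 0 e li isT nci nc).
have szt : size (take (f 0) Q) = f 0 by rewrite size_takel // ltnW.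
(* Removing the partner at position [f 0] shifts all later positions down by one. *)
apply: (IHCs _ (fun i => unbump (f 0) (f i.+1))).
- move=> i j e li lj nci ncj; have := f0 i e li nci; have := f0 j e lj ncj.
  rewrite /unbump => fj fi fij; have fE : f i.+1 = f j.+1.
    by move: fi fj fij; case: (ltngtP (f 0) (f i.+1)); case: (ltngtP (f 0) (f j.+1)); lia.
  exact: succn_inj (f_inj i.+1 j.+1 e li lj nci ncj fE).
- move=> i e li nci; rewrite size_cat szt size_drop.
  have := f0 i e li nci; have := fQ i.+1 e li nci.
  by rewrite /unbump; lia.
- move=> i e li nci; have := fP i.+1 e li nci => /=.
  have := f0 i e li nci; rewrite nth_cat szt nth_drop /unbump => nf.
  have [ltf|gef] := ltnP (f i.+1) (f 0).
    have -> : (f 0 < f i.+1) = false by lia.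
    by rewrite subn0 ltf nth_take.
  have -> : (f 0 < f i.+1) = true by lia.
  have -> : (f i.+1 - true < f 0) = false by lia.
  by have -> : (f 0).+1 + (f i.+1 - true - f 0) = f i.+1 by lia.
Qed.

(** Each condition is forced by a test multiset: many copies of one starred letter, then one
    well-chosen letter per optional factor. How the right side decomposes the second multiset gives
    the injection. *)
Lemma sub_mproduct_le A Cs A' Q :
  mproduct_den den (A, Cs) `<=` mproduct_den den (A', Q) ->
  mproduct_le leE (A, Cs) (A', Q).
Proof.
move=> sub; split=> /=.
  apply/(ForallE den_ideal leEP) => a Aa.
  (* The optional factors take at most [size Q] letters, so one of the [(size Q).+1] copies of [a]
     falls in the star. *)
  have : mproduct_den den (A, Cs) (seq_mset (nseq (size Q).+1 a)).
    apply/mproduct_denE; exists (nseq (size Q).+1 a), [::]; split.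
    - by move=> b; rewrite mem_nseq => /andP[_ /eqP->].
    - exact: (product_nil le_qo den_ideal).
    - by rewrite cats0.
  move=> /sub/mproduct_denE[[|b u] [v [Au Qv /eq_seq_msetP E']]].
    have := perm_size E'; rewrite size_nseq /= => sz.
    by have := opts_den_size Qv; rewrite -sz ltnn.
  have : b \in nseq (size Q).+1 a by rewrite (perm_mem E') inE eqxx.
  by rewrite mem_nseq => /andP[_ /eqP <-]; apply: Au; rewrite inE eqxx.
set cov := fun C => List.Exists (leE C) A'.
have wit C : exists c, den C c /\ (~ cov C ->
    ~ union_den den A' c /\ forall C', List.In C' Q -> den C' c -> leE C C').
  have [c|nc] := pselect (cov C).
    by have [_ [a aC] _] := den_ideal C; exists a.
  (* [F] collects the starred sets and the optional ones that do not contain [C]. By irreducibility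
     their union misses a letter of [C], which can then be matched only with a factor above [C]. *)
  pose F := A' ++ seq.filter (fun C' => ~~ `[< leE C C' >]) Q.
  have [c [cC ncF]] : exists c, den C c /\ ~ union_den den F c.
    apply: contrapT => /forallNP H.
    have : den C `<=` union_den den F.
      by move=> a aC; apply: contrapT => na; exact: (H a).
    rewrite (ideal_sub_union_denP den_ideal) // => /List.Exists_app[CA|].
      by apply: nc; apply: List.Exists_impl CA => C' /leEP.
    move=> /List.Exists_exists[C' [C'F /leEP CC']].
    elim: (Q) C'F => //= D Q' IH; case: asboolP => //= nD [DC'|//].
    by apply: nD; rewrite DC'.
  exists c; split=> // _; move: ncF; rewrite /F union_den_cat => /not_orP[ncA ncF].
  split=> // C' C'Q C'c; apply: contrapT => nCC'; apply: ncF.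
  apply/List.Exists_exists; exists C'; split=> //.
  elim: (Q) C'Q => //= D Q' IH [->|/IH H].
    by case: asboolP => //= _; left.
  by case: ifP => // _; right.
have [g gP] := choice wit.
have : mproduct_den den (A, Cs) (seq_mset (map g Cs)).
  apply/mproduct_denE; exists [::], (map g Cs); split=> //.
  apply: opts_den_full; elim: (Cs) => //= C Cs' IH.
  by apply: List.Forall2_cons => //; exact: (gP C).1.
move=> /sub/mproduct_denE[u [v [Au Qv /eq_seq_msetP]]].
have [js [szjs ujs ljs jsP]] := opts_den_nth Qv.
have [Cs0|] := eqVneq (size Cs) 0.
  move=> _.
  have F (i : {i : 'I_(size Cs) | ~ cov (tnth (in_tuple Cs) i)}) : False.
    by case: i => [[i li] _]; move: li; rewrite Cs0.
  exists (fun i => False_rect _ (F i)); first by move=> i; case: (F i).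
  by move=> i; case: (F i).
case CsE : (Cs) => [|e0 Cs'] // _; rewrite -CsE.
pose x0 := g e0; rewrite perm_sym => uvg.
have /(perm_iotaP x0)[Is Isp gE] : perm_eq (map g Cs) (u ++ v) by rewrite perm_sym.
have szI : size Is = size (u ++ v) by rewrite (perm_size Isp) size_iota.
have szC : size Cs = size Is by rewrite -(size_map g) gE size_map.
(* The position in [v] of the letter chosen for the [i]-th factor; an uncovered factor cannot have
   its letter in the starred part [u]. *)
pose p (i : nat) := nth 0 Is i - size u.
have pP (i : 'I_(size Cs)) : ~ cov (tnth (in_tuple Cs) i) ->
    [/\ size u <= nth 0 Is i, p i < size v & nth x0 v (p i) = g (tnth (in_tuple Cs) i)].
  move=> nc; have gi : g (tnth (in_tuple Cs) i) = nth x0 (u ++ v) (nth 0 Is i).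
    rewrite (tnth_nth e0) /= -(nth_map _ x0) // gE (nth_map 0) //.
    by rewrite -szC ltn_ord.
  have lI : nth 0 Is i < size (u ++ v).
    have : nth 0 Is i \in Is by apply: mem_nth; rewrite -szC ltn_ord.
    by rewrite (perm_mem Isp) mem_iota.
  move: gi lI; rewrite nth_cat size_cat /p; case: ltnP => [lu gi _|lu -> lI].
    have [_ /(_ nc)[nA _]] := gP (tnth (in_tuple Cs) i).
    by case: nA; rewrite gi; apply: Au; exact: mem_nth.
  by split=> //; lia.
have jlt (i : {i : 'I_(size Cs) | ~ cov (tnth (in_tuple Cs) i)}) :
    nth 0 js (p (sval i)) < size Q.
  case: i => i /= /pP[_ pv _]; have := all_nthP 0 ljs (p i); apply.
  by rewrite szjs.
exists (fun i => Ordinal (jlt i)) => [[i nci] [j ncj] /(congr1 val)/= ij|[i nci]] /=.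
  have [ui pi _] := pP i nci; have [uj pj _] := pP j ncj.
  move/eqP: ij; rewrite nth_uniq ?szjs // => /eqP pij.
  have : nth 0 Is i = nth 0 Is j by move: pij; rewrite /p; lia.
  move=> /eqP; rewrite nth_uniq -?szC ?ltn_ord //.
    by move=> /eqP/val_inj ijE; apply: eq_exist.
  by rewrite (perm_uniq Isp) iota_uniq.
have [_ pv gi] := pP i nci.
have [_ /(_ nci)[_]] := gP (tnth (in_tuple Cs) i); apply.
  rewrite (tnth_nth e0) /=.
  have : nth 0 js (p i) < size Q := jlt (exist _ i nci).
  by elim: (Q) (nth 0 js (p i)) => //= D Q' IH [|k] lk; [left | right; exact: IH].
by rewrite -gi (tnth_nth e0) /=; exact: jsP.
Qed.

Theorem mproduct_le_sub P P' :
  mproduct_le leE P P' <-> mproduct_den den P `<=` mproduct_den den P'.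
Proof.
case: P P' => A Cs [A' Q]; split=> [/mproduct_le_matching[AA /matching_sub]|].
  exact.
exact: sub_mproduct_le.
Qed.

Theorem matching_leP A Cs A' Q :
  mproduct_den den (A, Cs) `<=` mproduct_den den (A', Q) <->
  List.Forall (fun C => List.Exists (leE C) A') A /\
  matching (fun C => List.Exists (leE C) A') Cs Q.
Proof.
split=> [/sub_mproduct_le/mproduct_le_matching //|[AA /matching_sub]]; exact.
Qed.

End MultisetInclusion.

(** * Data types *)

Lemma ideal_upper_bound (T : choiceType) (le : T -> T -> Prop) C (s : seq T) :
  quasi_order le -> ideal le C -> (forall x, x \in s -> C x) ->
  exists2 z, C z & forall x, x \in s -> le x z.
Proof.
move=> [rf tr] [_ [c Cc] dirC]; elim: s => [|a s IHs] sC; first by exists c.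
have [|z Cz zs] := IHs; first by move=> x xs; apply: sC; rewrite inE xs orbT.
have [|t [Ct at_ zt]] := dirC a z _ Cz; first by apply: sC; rewrite inE eqxx.
exists t => // x; rewrite inE => /orP[/eqP-> //|/zs xz]; exact: tr xz zt.
Qed.

Lemma ideal_natP C : ideal leq C <-> exists x, nomega_den x = C.
Proof.
split=> [[dC [c Cc] _]|[[n|] <-]].
- have [[n [Cn maxn_]]|nmax] := pselect (exists n, C n /\ forall m, C m -> m <= n).
    exists (Some n); apply/seteqP; split=> m /= mn; last exact: maxn_.
    exact: dC mn Cn.
  exists None; apply/seteqP; split=> // m _.
  have [k Ck mk] : exists2 k, C k & m <= k.
    elim: m => [|m [k Ck mk]]; first by exists c.
    apply: contrapT => nk; apply: nmax; exists k; split=> // j Cj.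
    by rewrite leqNgt; apply/negP => kj; apply: nk; exists j => //; exact: leq_ltn_trans mk kj.
  exact: dC mk Ck.
- split=> [x y /= xy yn||x y /= xn yn]; first exact: leq_trans xy yn.
    by exists n => /=.
  by exists n; split=> /=.
- split=> [//||x y _ _]; first by exists 0.
  by exists (maxn x y); split=> //; [exact: leq_maxl | exact: leq_maxr].
Qed.

Lemma ideal_finP d (A : finPreorderType d) C :
  ideal (fun a b : A => (a <= b)%O) C <-> exists a, [set b | (b <= a)%O] = C.
Proof.
have qo : quasi_order (fun a b : A => (a <= b)%O).
  by split=> [x|x y z]; [exact: Order.PreorderTheory.lexx | exact: Order.PreorderTheory.le_trans].
split=> [iC|[a <-]]; last exact: ideal_principal.
have [|z Cz zC] := ideal_upper_bound (s := [seq x <- enum A | `[< C x >]]) qo iC.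
  by move=> x; rewrite mem_filter => /andP[/asboolP].
exists z; apply/seteqP; split=> x /=; first by move=> xz; exact: (downset_ideal iC) xz Cz.
by move=> Cx; apply: zC; rewrite mem_filter mem_enum andbT; apply/asboolP.
Qed.

Lemma choice_dep (I : Type) (T : I -> Type) (P : forall i, T i -> Prop) :
  (forall i, exists x, P i x) -> exists f : forall i, T i, forall i, P i (f i).
Proof.
by move=> H; exists (fun i => sval (cid (H i))) => i; exact: svalP (cid (H i)).
Qed.

Section Families.
Variables (k : nat) (T : 'I_k -> choiceType) (le : forall i, T i -> T i -> Prop).
Hypothesis le_qo : forall i, quasi_order (@le i).
Variables (E : 'I_k -> Type) (den : forall i, E i -> set (T i)).
Hypothesis denP : forall i C, ideal (@le i) C <-> exists e, den e = C.

Let den_ideal i e : ideal (@le i) (den e).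
Proof. by apply/denP; exists e. Qed.

Definition dffun_le (x y : {dffun forall i, T i}) : Prop := family_le le x y.

Lemma dffun_le_qo : quasi_order dffun_le.
Proof.
split=> [x i|x y z xy yz i]; first exact: (le_qo i).1.
exact: (le_qo i).2 (xy i) (yz i).
Qed.

(** An ideal is the product of its projections: if each coordinate of [x] is realised by a member,
    an upper bound of these [k] members dominates [x]. *)
Lemma family_denP C : ideal dffun_le C <-> exists e, family_den den e = C.
Proof.
split=> [iC|[e <-]].
  pose P i := [set a | exists2 x : {dffun forall i, T i}, C x & x i = a].
  have /= /choice_dep[e eP] i : exists e, den e = P i.
    apply/denP; have [dC [c Cc] dirC] := iC; split.
    - move=> a b ab [x Cx xb]; exists [ffun j => eqtype.dfwith x a j].
        apply: dC Cx => j; rewrite ffunE.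
        have [<-|ij] := eqVneq i j; first by rewrite dfwith_in xb.
        by rewrite dfwith_out //; exact: (le_qo _).1.
      by rewrite ffunE dfwith_in.
    - by exists (c i), c.
    - move=> _ _ [x Cx <-] [y Cy <-]; have [z [Cz xz yz]] := dirC _ _ Cx Cy.
      by exists (z i); split=> //; exists z.
  exists e; apply/seteqP; split=> x /= xP; last by move=> i; rewrite eP; exists x.
  have {}xP i : exists y : {dffun forall i, T i}, C y /\ y i = x i.
    by have := xP i; rewrite eP => -[y Cy yx]; exists y.
  have [y yP] := choice xP.
  have [|z Cz zy] := ideal_upper_bound (s := map y (enum 'I_k)) dffun_le_qo iC.
    by move=> _ /mapP[i _ ->]; exact: (yP i).1.
  apply: (downset_ideal iC) Cz => i; rewrite -(yP i).2.
  by apply: zy; apply: map_f; rewrite mem_enum.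
split.
- by move=> x y xy ye i; exact: (downset_ideal (den_ideal (e i))) (xy i) (ye i).
- have /choice_dep[c cP] i : exists c, den (e i) c by have [] := den_ideal (e i).
  by exists [ffun i => c i] => i; rewrite ffunE.
- move=> x y xe ye.
  have /choice_dep[z zP] i : exists z, [/\ den (e i) z, le (x i) z & le (y i) z].
    by have [_ _ dir] := den_ideal (e i); exact: dir.
  by exists [ffun i => z i]; split=> i; rewrite ffunE; case: (zP i).
Qed.

(** Since all factors are nonempty, a point of one factor extends to a point of the product. *)
Lemma family_den_sub e e' :
  (forall i, den (e i) `<=` den (e' i)) <-> family_den den e `<=` family_den den e'.
Proof.
split=> [ee x xe i|ee i a ae]; first exact/ee/xe.
have /choice_dep[c cP] j : exists c, den (e j) c by have [] := den_ideal (e j).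
have := ee [ffun j => eqtype.dfwith c a j].
have H : family_den den e [ffun j => eqtype.dfwith c a j].
  move=> j; rewrite ffunE; have [<-|ij] := eqVneq i j; first by rewrite dfwith_in.
  by rewrite dfwith_out.
by move=> /(_ H i); rewrite ffunE dfwith_in.
Qed.

Lemma sum_le_qo : quasi_order (sum_le le).
Proof.
split=> [[i a]|x y z [i [a [b [-> -> ab]]]] yz].
  by apply/(sum_le_Tagged le); exact: (le_qo i).1.
case: z yz => j c /= yz; have ij : i = j := sum_le_tag yz.
subst j; move/(sum_le_Tagged le): yz => bc.
by apply/(sum_le_Tagged le); exact: (le_qo i).2 ab bc.
Qed.

Lemma sum_den_Tagged i (C : E i) a : sum_den den (Tagged E C) (Tagged T a) <-> den C a.
Proof.
split=> [[b Cb /eqP]|Ca]; last by exists a.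
by rewrite eq_Tagged => /eqP/= ->.
Qed.

Lemma sum_den_tag (e : {i & E i}) x : sum_den den e x -> tag x = tag e.
Proof. by move=> [a _ ->]. Qed.

(** Elements with a common upper bound have the same tag, so an ideal lies in a single summand. *)
Lemma sum_denP C : ideal (sum_le le) C <-> exists e, sum_den den e = C.
Proof.
split=> [[dC [[i c] Cc] dirC]|[[i e] <-]].
  have sameC x : C x -> tag x = i.
    by move=> Cx; have [z [Cz /sum_le_tag-> /sum_le_tag]] := dirC _ _ Cx Cc.
  have [e eP] : exists e, den e = [set a | C (Tagged T a)] :> set (T i).
    apply/denP; split.
    - by move=> a b ab Cb; apply: dC Cb; apply/(sum_le_Tagged le).
    - by exists c.
    - move=> a b Ca Cb; have [[j z] [Cz az bz]] := dirC _ _ Ca Cb.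
      have ij : j = i := sameC _ Cz; subst j.
      by exists z; split=> //; apply/(sum_le_Tagged le).
  exists (Tagged E e); apply/seteqP; split=> [_ [a /= + ->]|[j a] Ca].
    by rewrite eP.
  have ij : j = i := sameC _ Ca; subst j.
  by exists a => //=; rewrite eP.
have [de [c ec] dire] := den_ideal e; split.
- move=> [j a] [j' b] ab eb.
  have ij' : j' = i := sum_den_tag eb; have ij : j = j' := sum_le_tag ab; subst j' j.
  exists a => //=; move/(sum_le_Tagged le): ab => /de; apply.
  exact/(sum_den_Tagged e b).
- by exists (Tagged T c); exists c.
- move=> _ _ [a ea ->] [b eb ->]; have [z [ez az bz]] := dire _ _ ea eb.
  by exists (Tagged T z); split; [exists z | apply/(sum_le_Tagged le) ..].
Qed.

Lemma sum_den_sub e e' :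
  sum_le (fun i C C' => den C `<=` den C') e e' <-> sum_den den e `<=` sum_den den e'.
Proof.
split=> [[i [C [C' [-> -> CC]]]] _ [a Ca ->]|]; first by exists a => //; exact: CC.
case: e e' => [i C] [j C'] ee.
have [_ [c Cc] _] := den_ideal C.
have ij : i = j by have [|] := ee (Tagged T c); [exists c | move=> ? _ /(congr1 tag)].
subst j; exists i, C, C'; split=> // a Ca.
by apply/sum_den_Tagged; apply: ee; exists a.
Qed.

End Families.

Lemma data_qo D : quasi_order (@data_le D).
Proof.
elim: D => [|d A|k D IHD|k D IHD|D IHD|D IHD].
- by split=> [n|l m n /leq_trans lm /lm] /=.
- split=> [x|x y z] /=; [exact: Order.PreorderTheory.lexx | exact: Order.PreorderTheory.le_trans].
- exact: (dffun_le_qo IHD).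
- exact: (sum_le_qo IHD).
- exact: word_le_qo.
- exact: multiset_le_qo.
Qed.

Lemma data_wqo D : wqo (@data_le D).
Proof.
elim: D => [|d A|k D IHD|k D IHD|D IHD|D IHD].
- exact: wqo_nat.
- move=> f; have [i [j [ij fij]]] := @wqo_eq A f; exists i, j; split=> //=.
  by rewrite -fij; exact: Order.PreorderTheory.lexx.
- move=> f; have [i [j [ij fij]]] :=
    wqo_family (fun i => data_qo (D i)) IHD (fun n i => f n i).
  by exists i, j.
(* Pigeonhole first: equality on the finite set of tags is a well-quasi-order, so some subsequence
   has a constant tag. *)
- move=> f; have [phi [phi_incr tagP]] := @wqo_monotone_subsequence 'I_k eq
    (conj (@erefl _) (@eq_trans _)) (fun n => tag (f n)) (@wqo_eq _).
  have /choice[g gP] n : exists a : carrier (D (tag (f (phi 0)))),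
      f (phi n) = Tagged (fun i => carrier (D i)) a.
    have : tag (f (phi n)) = tag (f (phi 0)) by case: n => // n; rewrite -(tagP 0).
    case: (f (phi n)) => i a /= iE; subst i; by exists a.
  have [i [j [ij gij]]] := IHD (tag (f (phi 0))) g.
  exists (phi i), (phi j); split; first exact: phi_incr.
  by rewrite !gP; exists (tag (f (phi 0))), (g i), (g j).
- exact: (higman (data_qo D)).
- exact: (wqo_multiset (data_qo D)).
Qed.

Lemma expr_idealP D C : ideal (@data_le D) C <-> exists e : expr D, expr_den e = C.
Proof.
elim: D C => [|d A|k D IHD|k D IHD|D IHD|D IHD] C /=.
- exact: ideal_natP.
- exact: ideal_finP.
- exact: (family_denP (fun i => data_qo (D i)) IHD).
- exact: (@sum_denP k _ _ _ _ IHD).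
- apply: ideal_wordsP => [|e|C' /IHD //|]; [exact: data_qo| |exact: data_wqo].
  by apply/IHD; exists e.
- apply: ideal_multisetsP => [|e|C' /IHD //|]; [exact: data_qo| |exact: data_wqo].
  by apply/IHD; exists e.
Qed.

Lemma expr_ideal D (e : expr D) : ideal (@data_le D) (expr_den e).
Proof. by apply/expr_idealP; exists e. Qed.

(** This lets the points of [sob D] play the role of names in the generic theorems. *)
Lemma sob_idealP D C : ideal (@data_le D) C <-> exists e : sob D, sob_den e = C.
Proof.
split=> [/(irreducible_ideal (data_qo D)) iC|[e <-]].
  by exists (Sobrification iC).
by apply/(irreducible_ideal (data_qo D)); exact: sob_irreducible.
Qed.

Lemma sob_ideal D (e : sob D) : ideal (@data_le D) (sob_den e).
Proof. by apply/sob_idealP; exists e. Qed.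

Lemma represents_ideal D E (den : E -> set (carrier D)) :
  (forall C, ideal (@data_le D) C <-> exists e, den e = C) ->
  @represents E (data_space D) den.
Proof. by move=> denP C; rewrite (irreducible_ideal (data_qo D)). Qed.

(** * Compactness of the open sets of the sobrification *)

Section Noetherian.
Variable D : datatype.
Local Notation le := (@data_le D).

Definition meets (U : set (carrier D)) : set (sob D) :=
  [set C | exists2 x, sob_den C x & U x].

Definition upset (U : set (carrier D)) := forall x y, le x y -> U x -> U y.

(* Irreducibility makes [meets] commute with finite intersections. *)
Lemma open_meets (V : set (sob D)) : open V -> exists2 U, upset U & V = meets U.
Proof.
have meetsI U W : upset U -> upset W -> meets U `&` meets W = meets (U `&` W).
  move=> uU uW; apply/seteqP; split=> C; last first.
    by move=> [x Cx [Ux Wx]]; split; exists x.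
  move=> [[x Cx Ux] [y Cy Wy]]; have [_ _ dir] := sob_ideal C.
  have [z [Cz xz yz]] := dir _ _ Cx Cy.
  by exists z => //; split; [exact: uU xz Ux | exact: uW yz Wy].
have finI (F : {fset set (sob D)}) : (forall B, B \in F -> upper_subbase B) ->
    exists2 U, upset U & \bigcap_(B in [set` F]) B = meets U.
  move: F; apply: finSet_rect => F IH FB.
  have [->|/fset0Pn[B BF]] := eqVneq F fset0.
    exists setT => //; rewrite set_fset0 bigcap_set0; apply/seteqP; split=> // C _.
    by have [_ [x Cx] _] := sob_ideal C; exists x.
  have [|U uU FU] := IH _ (fproperD1 BF).
    by move=> B'; rewrite !inE => /andP[_ /FB].
  have [C BE] : upper_subbase B := FB B BF.
  exists (~` sob_den C `&` U).
    move=> x y xy [nCx Ux]; split; last exact: uU xy Ux.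
    by move=> Cy; apply: nCx; exact: downset_ideal (sob_ideal C) _ _ xy Cy.
  rewrite -meetsI //; last first.
    by move=> x y xy nCx Cy; apply: nCx; exact: downset_ideal (sob_ideal C) _ _ xy Cy.
  rewrite -FU -(fsetD1K BF) set_fsetU1 bigcap_setU1 fsetD1K //; congr (_ `&` _).
  rewrite BE; apply/seteqP; split=> C' /=.
    move=> nCC; apply: contrapT => nx; apply: nCC => x C'x; apply: contrapT => nCx.
    by apply: nx; exists x.
  by move=> [x C'x nCx] CC; apply: nCx; exact: CC.
move=> [DD DDP <-].
have [f fP] : exists f : set (sob D) -> set (carrier D),
    forall B, DD B -> upset (f B) /\ B = meets (f B).
  have /choice[f fP] B : exists U, DD B -> upset U /\ B = meets U.
    have [DB|nDB] := pselect (DD B); last by exists set0.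
    have [F FB <-] := DDP B DB; have [|U uU UE] := finI F.
      by move=> B' /FB; rewrite inE.
    by exists U.
  by exists f.
exists (\bigcup_(B in DD) f B).
  by move=> x y xy [B DB fx]; exists B => //; exact: (fP B DB).1 xy fx.
apply/seteqP; split=> [C [B DB BC]|C [x Cx [B DB fx]]].
  have [_ BE] := fP B DB; move: BC; rewrite /= BE => -[x Cx fx].
  by exists x => //; exists B.
by exists B => //; have [_ ->] := fP B DB; exists x.
Qed.

(** Each point of [meets U] meets the upset of some [x] in a finite basis of [U]. A filter that
    clusters at no principal ideal [eta x] contains the complements of all the [meets (le x)]; being
    also concentrated on [meets U], it contains the empty set. *)
Lemma sob_noetherian : noetherian (sob D).
Proof.
move=> V /open_meets[U uU ->] F PF FU.
have [s [sU sP]] := upset_finite_basis (@data_wqo D) uU.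
have pt x : {C : sob D | sob_den C = [set y | le y x]}.
  apply: cid; apply/sob_idealP; apply: ideal_principal; exact: data_qo.
pose eta x := sval (pt x); have etaE x : sob_den (eta x) = [set y | le y x] := svalP (pt x).
apply: contrapT => nclus.
suff : F set0 by exact: filter_not_empty.
(* Every open set containing [eta x] contains all of [meets (le x)]. *)
have far x : x \in s -> F (~` meets (le x)).
  move=> xs; apply: contrapT => nF; apply: nclus; exists (eta x); split.
    by exists x; [rewrite etaE; exact: (data_qo D).1 | exact: sU].
  move=> A B FA; rewrite nbhsE => -[O [/open_meets[W uW ->]]].
  move=> [y + Wy]; rewrite etaE => /= yx OB.
  apply: contrapT => nAB; apply: nF; apply: filterS FA => C AC [z Cz xz].
  by apply: nAB; exists C; split=> //; apply: OB; exists z => //; exact: uW xz (uW _ _ yx Wy).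
have : F [set C | forall x, x \in s -> ~ meets (le x) C].
  elim: (s) far => [|x t IHt] far; first by apply: filterS FU => C _ x.
  have Fx : F (~` meets (le x)) by apply: far; rewrite inE eqxx.
  have Ft : F [set C | forall y, y \in t -> ~ meets (le y) C].
    by apply: IHt => y yt; apply: far; rewrite inE yt orbT.
  by apply: filterS (filterI Fx Ft) => C [nx nt] y; rewrite inE => /orP[/eqP->|/nt].
move=> Fs; apply: filterS (filterI FU Fs) => C [[y Cy Uy] nC].
by have [x xs xy] := sP y Uy; apply: (nC x xs); exists y.
Qed.
End Noetherian.

(** * Descriptions of the sobrifications *)

Lemma presents_nat : @presents (option nat) nomega_le (data_space DNat) nomega_den.
Proof.
split; first exact: (@represents_ideal DNat _ _ ideal_natP).
move=> [m|] [n|]; split=> //=.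
- by move=> mn k /= km; exact: leq_trans km mn.
- by move=> /(_ m); apply => /=.
- by move=> /(_ n.+1 I) /=; rewrite ltnn.
Qed.

Lemma presents_fin d (A : finPreorderType d) :
  @presents A (fun a b => (a <= b)%O) (data_space (DFin A))
    (fun a => [set b : A | (b <= a)%O]).
Proof.
split; first exact: (@represents_ideal (DFin A) _ _ (@ideal_finP d A)).
move=> a b; split=> [ab c ca|]; first exact: Order.PreorderTheory.le_trans ca ab.
by apply; exact: Order.PreorderTheory.lexx.
Qed.

Section Presentations.
Variables (k : nat) (D : 'I_k -> datatype).

Lemma presents_prod : @presents (forall i, sob (D i))
  (family_le (fun i => @sob_le (data_space (D i))))
  (data_space (DProd D)) (family_den (fun i => @sob_den (D i))).
Proof.
have denP i := @sob_idealP (D i).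
split; last exact: (family_den_sub denP).
exact: (@represents_ideal (DProd D) _ _ (family_denP (fun i => data_qo (D i)) denP)).
Qed.

Lemma presents_sum : @presents {i : 'I_k & sob (D i)}
  (sum_le (fun i => @sob_le (data_space (D i))))
  (data_space (DSum D)) (sum_den (fun i => @sob_den (D i))).
Proof.
have denP i := @sob_idealP (D i).
split; last exact: (sum_den_sub denP).
exact: (@represents_ideal (DSum D) _ _ (sum_denP denP)).
Qed.
End Presentations.

Lemma presents_words D : @presents (seq (atom (sob D)))
  (product_le (@sob_le (data_space D)))
  (data_space (DWords D)) (product_den (@sob_den D)).
Proof.
split; last exact: (product_leP (data_qo D) (@sob_ideal D)).
apply: (@represents_ideal (DWords D)); apply: ideal_wordsP.
- exact: data_qo.
- exact: sob_ideal.
- by move=> C /sob_idealP.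
- exact: data_wqo.
Qed.

Lemma presents_multisets D : @presents (seq (sob D) * seq (sob D))%type
  (mproduct_le (@sob_le (data_space D)))
  (data_space (DMultisets D)) (mproduct_den (@sob_den D)).
Proof.
split; last exact: (mproduct_le_sub (data_qo D) (@sob_ideal D)).
apply: (@represents_ideal (DMultisets D)); apply: ideal_multisetsP.
- exact: data_qo.
- exact: sob_ideal.
- by move=> C /sob_idealP.
- exact: data_wqo.
Qed.

(** * Multi-head automata and the polynomial hierarchy *)

Lemma leq_horner (p : {poly nat}) (m n : nat) : m <= n -> (p.[m])%R <= (p.[n])%R.
Proof.
move=> mn; elim/poly_ind: p => [|p c IHp]; first by rewrite !horner0.
by rewrite !hornerMXaddC; apply: leq_add => //; exact: leq_mul.
Qed.

Lemma input_size_cons n u (x : n.-tuple word) :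
  input_size [tuple of u :: x] = size u + input_size x.
Proof.
rewrite /input_size big_ord_recl tnth0; congr (_ + _).
by apply: eq_bigr => i _; rewrite tnthS.
Qed.

(* A deterministic automaton with one head on each of its [n] input words; a
   head moves only to the right, at its own pace. *)
Record automaton (n : nat) := Automaton {
  au_state : finType;
  au_start : au_state;
  au_verdict : au_state -> option bool;
  au_step : au_state -> {ffun 'I_n -> option bool} -> au_state * ('I_n -> bool) }.

Section Automata.
Variables (n : nat) (A : automaton n).

Definition au_config : Type := au_state A * ('I_n -> word).

Definition au_move (d : au_config) : au_config :=
  let r := au_step d.1 [ffun i => ohead (d.2 i)] in
  (r.1, fun i => if r.2 i then behead (d.2 i) else d.2 i).

Definition au_next (d : au_config) : au_config :=
  if au_verdict d.1 is Some _ then d else au_move d.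

Definition au_result (t : nat) (d : au_config) : option bool :=
  au_verdict (iter t au_next d).1.

Definition au_init (x : n.-tuple word) : au_config := (au_start A, tnth x).

Lemma au_result_stable t t' d b :
  au_result t d = Some b -> t <= t' -> au_result t' d = Some b.
Proof.
move=> tb /subnK <-; elim: (t' - t) => // k IHk.
by rewrite addSn /au_result iterS /au_next; move: (IHk); rewrite /au_result => ->.
Qed.

Lemma au_resultS t d : au_verdict d.1 = None ->
  au_result t.+1 d = au_result t (au_move d).
Proof. by move=> dN; rewrite /au_result iterSr /au_next dN. Qed.

Lemma au_result0 d b t : au_verdict d.1 = Some b -> au_result t d = Some b.
Proof. by move=> db; apply: (@au_result_stable 0). Qed.
End Automata.

Arguments au_result : simpl never.

Definition automatic (n : nat) (L : n.-tuple word -> Prop) : Prop :=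
  exists (A : automaton n) (p : {poly nat}), forall x : n.-tuple word,
    exists2 b : bool, au_result (p.[input_size x])%R (au_init A x) = Some b &
      (b <-> L x).

(** * Automata as Turing machines *)

Section AutomatonMachine.
Variables (n : nat) (A : automaton n).

Let bit_of (s : option (bool + void)) : option bool :=
  if s is Some (inl b) then Some b else None.

Definition automaton_machine : machine n :=
  @Machine n (au_state A) void 0 (au_start A) (@au_verdict n A)
    (fun q s =>
       let r := au_step q [ffun i : 'I_n => bit_of (s (lshift 0 i))] in
       (r.1, [ffun j => (s j, match fintype.split j with
                              | inl i => if r.2 i then GoRight else Stay
                              | inr _ => Stay
                              end)])).

(** The machine writes back what it scans, so blanks appear explicitly on its tape once a head is
    past the input; [nseq k None] accounts for them. *)
Let track (c : config automaton_machine) (d : au_config A) : Prop :=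
  c.1 = d.1 /\ forall i : 'I_n, exists k,
    (c.2 (lshift 0 i)).2 = [seq Some (inl b) | b <- d.2 i] ++ nseq k None.

Let track_step c d : track c d -> track (tm_step c) (au_next d).
Proof.
case: c d => [q h] [q' w] [/= <- hw]; rewrite /tm_step /au_next /=.
case: (au_verdict q) => //; rewrite /au_move /=.
set s := (X in au_step q X).
have -> : s = [ffun i => ohead (w i)].
  apply/ffunP => i; rewrite !ffunE /tape_read; have [k ->] := hw i.
  by case: (w i) => //; case: k.
set r := au_step q _.
split=> // i /=; rewrite ffunE.
have -> : fintype.split (lshift 0 i) = inl i.
  have := unsplitK (inl i : 'I_n + 'I_0); exact.
rewrite ffunE /tape_act /tape_read; have [k hE] := hw i; rewrite hE.
case: (r.2 i) => /=; case: (w i) => [|b v] /=.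
- by exists k.-1; case: k {hE}.
- by exists k.
- by exists k.-1.+1; case: k {hE}.
- by exists k.
Qed.

Lemma automaton_machineP t x :
  tm_result automaton_machine t x = au_result t (au_init A x).
Proof.
suff [E _] : track (iter t (@tm_step n automaton_machine) (tm_init automaton_machine x))
    (iter t (@au_next n A) (au_init A x)).
  exact: (congr1 (@au_verdict n A) E).
elim: t => [|t IHt]; last exact: track_step.
split=> // i; exists 0; rewrite cats0 /=.
have -> : fintype.split (lshift 0 i) = inl i.
  have := unsplitK (inl i : 'I_n + 'I_0); exact.
by [].
Qed.
End AutomatonMachine.

Lemma automatic_polytime n (L : n.-tuple word -> Prop) : automatic L -> polytime L.
Proof.
move=> [A [p AP]]; exists (automaton_machine A), p => x.
by have [b bA bL] := AP x; exists b => //; rewrite automaton_machineP.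
Qed.

Lemma automaticN n (L : n.-tuple word -> Prop) :
  automatic L -> automatic (fun x => ~ L x).
Proof.
move=> [A [p AP]].
pose B := @Automaton n (au_state A) (au_start A)
  (fun q => omap negb (au_verdict q)) (@au_step n A).
have BA t d : @au_result n B t d = omap negb (@au_result n A t d).
  have iterE : iter t (@au_next n B) d = iter t (@au_next n A) d :> au_config A.
    elim: t => // t IHt; rewrite !iterS [in LHS]IHt {IHt}.
    by rewrite /au_next /=; case: (au_verdict _).
  by rewrite /au_result [in LHS]iterE.
exists B, p => x; have [b Ab bL] := AP x; exists (~~ b); first by rewrite BA Ab.
by rewrite -bL; split=> [/negP|/negP].
Qed.

Definition reindex_words m n (f : 'I_n -> 'I_m) (x : m.-tuple word) : n.-tuple word :=
  [tuple tnth x (f i) | i < n].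

Lemma input_size_reindex m n (f : 'I_n -> 'I_m) x :
  injective f -> input_size (reindex_words f x) <= input_size x.
Proof.
move=> f_inj; rewrite /input_size.
under eq_bigr do rewrite tnth_mktuple.
rewrite -(big_imset (fun j => size (tnth x j)) (h := f) (A := 'I_n)) /=; last first.
  by move=> i j _ _; exact: f_inj.
by rewrite [leqRHS](bigID (mem (f @: 'I_n))) /=; exact: leq_addr.
Qed.

(** Injectivity gives each head of [B] at most one head of [A] to follow; a repeated word would
    demand two heads on it. *)
Lemma automatic_reindex m n (f : 'I_n -> 'I_m) (L : n.-tuple word -> Prop) :
  injective f -> automatic L -> automatic (fun x => L (reindex_words f x)).
Proof.
move=> f_inj [A [p AP]].
pose B := @Automaton m (au_state A) (au_start A) (@au_verdict n A)
  (fun q s => let r := au_step q [ffun i => s (f i)] in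
     (r.1, fun j => if [pick i | f i == j] is Some i then r.2 i else false)).
have track t (x : m.-tuple word) :
    let d := iter t (@au_next m B) (au_init B x) in
    let e := iter t (@au_next n A) (au_init A (reindex_words f x)) in
    d.1 = e.1 /\ forall i, d.2 (f i) = e.2 i.
  elim: t => [|t [qE wE]] /=; first by split=> // i; rewrite tnth_mktuple.
  rewrite /au_next qE /=; case: (au_verdict _) => //.
  rewrite /au_move /= qE.
  have -> : [ffun i => [ffun i0 => ohead ((iter t (au_next (A:=B)) (au_init B x)).2 i0)] (f i)]
      = [ffun i => ohead ((iter t (au_next (A:=A)) (au_init A (reindex_words f x))).2 i)].
    by apply/ffunP => i; rewrite !ffunE wE.
  split=> // i; rewrite wE; case: pickP => [j /eqP/f_inj -> //|/(_ i)].
  by rewrite eqxx.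
exists B, p => x; have [b Ab bL] := AP (reindex_words f x); exists b => //.
apply: (@au_result_stable _ _ (p.[input_size (reindex_words f x)])%R).
  by rewrite -Ab /au_result; have [-> _] := track (p.[input_size (reindex_words f x)])%R x.
by apply: leq_horner; exact: input_size_reindex.
Qed.

(** The first bit of an additional word selects which automaton is run. Quantifying this word
    universally expresses a conjunction. *)
Lemma automatic_ite n (L1 L2 : n.-tuple word -> Prop) : automatic L1 -> automatic L2 ->
  automatic (fun x : n.+1.-tuple word =>
    if ohead (thead x) == Some true then L1 [tuple of behead x] else L2 [tuple of behead x]).
Proof.
move=> [A1 [p1 AP1]] [A2 [p2 AP2]].
pose Q : finType := option (au_state A1 + au_state A2).
pose next q (s : {ffun 'I_n.+1 -> option bool}) : Q * ('I_n.+1 -> bool) :=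
  let s' := [ffun i => s (lift ord0 i)] in
  let lift_moves (mv : 'I_n -> bool) j := if unlift ord0 j is Some i then mv i else false in
  match q : Q with
  | None => (if s ord0 == Some true then Some (inl (au_start A1))
             else Some (inr (au_start A2)), fun=> false)
  | Some (inl q) => let r := au_step q s' in (Some (inl r.1), lift_moves r.2)
  | Some (inr q) => let r := au_step q s' in (Some (inr r.1), lift_moves r.2)
  end.
pose verdict (q : Q) := match q with
  | None => None | Some (inl q) => au_verdict q | Some (inr q) => au_verdict q end.
pose B := @Automaton n.+1 Q None verdict next.
have run1 t q (w : 'I_n.+1 -> word) :
    @au_result _ B t (Some (inl q), w) = @au_result _ A1 t (q, fun i => w (lift ord0 i)).
  elim: t q w => [//|t IHt] q w; case qv : (au_verdict q) => [b|].
    by rewrite !(@au_result0 _ _ _ b).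
  rewrite !au_resultS //= /au_move /=.
  have -> : [ffun i => [ffun i0 => ohead (w i0)] (lift ord0 i)] =
      [ffun i => ohead (w (lift ord0 i))] by apply/ffunP => i; rewrite !ffunE.
  apply: (etrans (IHt _ _)); congr (au_result t (_, _)); apply/funext => i.
  by rewrite liftK.
have run2 t q (w : 'I_n.+1 -> word) :
    @au_result _ B t (Some (inr q), w) = @au_result _ A2 t (q, fun i => w (lift ord0 i)).
  elim: t q w => [//|t IHt] q w; case qv : (au_verdict q) => [b|].
    by rewrite !(@au_result0 _ _ _ b).
  rewrite !au_resultS //= /au_move /=.
  have -> : [ffun i => [ffun i0 => ohead (w i0)] (lift ord0 i)] =
      [ffun i => ohead (w (lift ord0 i))] by apply/ffunP => i; rewrite !ffunE.
  apply: (etrans (IHt _ _)); congr (au_result t (_, _)); apply/funext => i.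
  by rewrite liftK.
exists B, (1 + p1 + p2)%R => x.
have tailE : (fun i => tnth x (lift ord0 i)) = tnth [tuple of behead x].
  by apply/funext => i; rewrite tnth_behead; congr tnth; apply: val_inj; rewrite /= inordK // ltnS.
have leS : input_size [tuple of behead x] <= input_size x.
  by rewrite [in leqRHS](tuple_eta x) input_size_cons leq_addl.
have sizeE : ((1 + p1 + p2).[input_size x])%R =
    ((p1.[input_size x])%R + (p2.[input_size x])%R).+1 by rewrite !hornerD hornerC.
rewrite sizeE; case hd : (ohead (thead x) == Some true).
  have [b Ab bL] := AP1 [tuple of behead x]; exists b => //.
  rewrite au_resultS //= /au_move /= ffunE hd.
  apply: (etrans (run1 _ _ _)); rewrite /= tailE.
  apply: au_result_stable Ab _; apply: leq_trans (leq_addr _ _).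
  exact: leq_horner.
have [b Ab bL] := AP2 [tuple of behead x]; exists b => //.
rewrite au_resultS //= /au_move /= ffunE hd.
  apply: (etrans (run2 _ _ _)); rewrite /= tailE.
apply: au_result_stable Ab _; apply: leq_trans (leq_addl _ _).
exact: leq_horner.
Qed.

(* Like [sigma_p], but with quantifiers ranging over all words: the polynomial
   only bounds the least witness. Prenexing then needs no bookkeeping of the
   bounds, which would change with the size of the context. *)
Fixpoint prenex (k n : nat) (L : n.-tuple word -> Prop) : Prop :=
  match k with
  | 0 => automatic L
  | k'.+1 => exists (p : {poly nat}) (L' : n.+1.-tuple word -> Prop),
      [/\ prenex k' L',
          forall x, L x -> exists2 u : word, size u <= (p.[input_size x])%R &
            ~ L' [tuple of u :: x] &
          forall (x : n.-tuple word) (u : word), ~ L' [tuple of u :: x] -> L x]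
  end.

Definition in_PH (n : nat) (L : n.-tuple word -> Prop) := exists k, prenex k L.

Lemma prenex_sigma k n (L : n.-tuple word -> Prop) : prenex k L -> sigma_p k L.
Proof.
elim: k n L => [|k IHk] n L; first exact: automatic_polytime.
move=> [p [L' [/IHk L'k short sound]]]; exists p, L'; split=> // x.
by split=> [/short //|[u _ /sound]].
Qed.

Lemma in_PH_hierarchy n (L : n.-tuple word -> Prop) : in_PH L -> polynomial_hierarchy L.
Proof. by move=> [k /prenex_sigma Lk]; exists k. Qed.

Lemma in_PH_ext n (L L' : n.-tuple word -> Prop) :
  (forall x, L x <-> L' x) -> in_PH L -> in_PH L'.
Proof. by move=> LL; rewrite (_ : L = L') //; apply/predeqP. Qed.

Lemma behead_cons n u (x : n.-tuple word) : [tuple of behead [tuple of u :: x]] = x.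
Proof. exact: val_inj. Qed.

Definition lift_inj_ord m n (f : 'I_n -> 'I_m) (i : 'I_n.+1) : 'I_m.+1 :=
  if unlift ord0 i is Some j then lift ord0 (f j) else ord0.

Lemma lift_inj_ordP m n (f : 'I_n -> 'I_m) : injective f -> injective (lift_inj_ord f).
Proof.
move=> f_inj i j; rewrite /lift_inj_ord.
case: (unliftP ord0 i) => [i'|] ->; case: (unliftP ord0 j) => [j'|] -> //.
by move=> /lift_inj/f_inj ->.
Qed.

Lemma reindex_words_cons m n (f : 'I_n -> 'I_m) u (x : m.-tuple word) :
  reindex_words (lift_inj_ord f) [tuple of u :: x] =
  [tuple of u :: reindex_words f x].
Proof.
apply: eq_from_tnth => i; rewrite tnth_mktuple /lift_inj_ord.
case: (unliftP ord0 i) => [j|] ->; first by rewrite !tnthS tnth_mktuple.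
by rewrite !tnth0.
Qed.

Lemma prenex_reindex k m n (f : 'I_n -> 'I_m) (L : n.-tuple word -> Prop) :
  injective f -> prenex k L -> prenex k (fun x => L (reindex_words f x)).
Proof.
elim: k m n f L => [|k IHk] m n f L f_inj; first exact: automatic_reindex.
move=> [p [L' [L'k short sound]]].
exists p, (fun x => L' (reindex_words (lift_inj_ord f) x)); split.
- by apply: IHk => //; exact: lift_inj_ordP.
- move=> x /short[u su nL']; exists u; last by rewrite reindex_words_cons.
  by apply: leq_trans su _; apply: leq_horner; exact: input_size_reindex.
- by move=> x u; rewrite reindex_words_cons; exact: sound.
Qed.

Lemma in_PH_reindex m n (f : 'I_n -> 'I_m) (L : n.-tuple word -> Prop) :
  injective f -> in_PH L -> in_PH (fun x => L (reindex_words f x)).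
Proof. by move=> f_inj [k Lk]; exists k; exact: prenex_reindex. Qed.

Lemma reindex_lift0 n (x : n.+1.-tuple word) :
  reindex_words (lift ord0) x = [tuple of behead x].
Proof.
apply: eq_from_tnth => i; rewrite tnth_mktuple tnth_behead; congr tnth.
by apply: val_inj; rewrite /= inordK // ltnS.
Qed.

Lemma in_PH_weaken n (L : n.-tuple word -> Prop) :
  in_PH L -> in_PH (fun x : n.+1.-tuple word => L [tuple of behead x]).
Proof.
move=> /(in_PH_reindex (f := lift ord0) (@lift_inj _ _)); apply: in_PH_ext => x.
by rewrite reindex_lift0.
Qed.

Lemma in_PH_exists n (L : n.-tuple word -> Prop) (B : n.+1.-tuple word -> Prop)
    (p : {poly nat}) :
  in_PH (fun x => ~ B x) ->
  (forall x, L x -> exists2 u : word, size u <= (p.[input_size x])%R &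
     B [tuple of u :: x]) ->
  (forall (x : n.-tuple word) (u : word), B [tuple of u :: x] -> L x) -> in_PH L.
Proof.
move=> [k Bk] short sound; exists k.+1, p, (fun x => ~ B x); split=> //.
  by move=> x /short[u su Bu]; exists u => //; exact.
by move=> x u /contrapT; exact: sound.
Qed.

(** Each level complements its matrix, so negation costs one dummy quantifier, witnessed by the
    empty word. *)
Lemma in_PHN n (L : n.-tuple word -> Prop) : in_PH L -> in_PH (fun x => ~ L x).
Proof.
move=> PL.
apply: (@in_PH_exists _ _ (fun x => ~ L [tuple of behead x]) 0%R).
- by apply: in_PH_ext (in_PH_weaken PL) => x; split=> [? /(_ _)//|/contrapT].
- by move=> x nL; exists [::]; rewrite ?behead_cons.
- by move=> x u; rewrite behead_cons.
Qed.

Lemma in_PHNN n (L : n.-tuple word -> Prop) : in_PH (fun x => ~ L x) -> in_PH L.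
Proof. by move=> /in_PHN; apply: in_PH_ext => x; split=> [/contrapT|? /(_ _)]. Qed.

Section Conjunction.
Variables (n : nat) (L1 L2 : n.-tuple word -> Prop).

(** Polarity changes with each quantifier, so the induction carries the conjunctions of [L2] with
    both [L1] and its complement. Under the quantifier, [L2] is merely weakened to [W]. *)
Lemma prenex_and_step (p : {poly nat}) (L1' : n.+1.-tuple word -> Prop)
    (W := fun x : n.+1.-tuple word => L2 [tuple of behead x]) :
  (forall x, L1 x -> exists2 u : word, size u <= (p.[input_size x])%R &
     ~ L1' [tuple of u :: x]) ->
  (forall (x : n.-tuple word) (u : word), ~ L1' [tuple of u :: x] -> L1 x) ->
  in_PH (fun x => L1' x /\ W x) -> in_PH (fun x => ~ L1' x /\ W x) ->
  in_PH (fun x => L1 x /\ L2 x) /\ in_PH (fun x => ~ L1 x /\ L2 x).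
Proof.
move=> short sound P1 P2; split.
  apply: (@in_PH_exists _ _ (fun x => ~ L1' x /\ W x) p); first exact: in_PHN.
    by move=> x [/short[u su nL'] L2x]; exists u => //; rewrite /W behead_cons.
  by move=> x u [/sound L1x]; rewrite /W behead_cons.
apply: in_PHNN; apply: (@in_PH_exists _ _ (fun x => ~ (L1' x /\ W x)) p).
- exact/in_PHN/in_PHN.
- move=> x /not_andP[/contrapT/short[u su nL']|nL2].
    by exists u => // -[].
  by exists [::] => // -[_]; rewrite /W behead_cons.
- move=> x u + [nL1 L2x]; apply; split; last by rewrite /W behead_cons.
  by apply: contrapT => /sound.
Qed.
End Conjunction.

(** The two automata cannot be run one after the other, as heads do not come back, nor together, as
    they move at different paces. A universally quantified selector runs only one of them. *)
Lemma in_PH_and_automatic n (L1 L2 : n.-tuple word -> Prop) :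
  automatic L1 -> automatic L2 -> in_PH (fun x => L1 x /\ L2 x).
Proof.
move=> A1 A2; apply: in_PHNN.
pose I (x : n.+1.-tuple word) :=
  if ohead (thead x) == Some true then L1 [tuple of behead x] else L2 [tuple of behead x].
apply: (@in_PH_exists _ _ (fun x => ~ I x) 1%R).
- by apply/in_PHN/in_PHN; exists 0; exact: automatic_ite.
- move=> x /not_andP[nL|nL]; rewrite hornerC.
    by exists [:: true]; rewrite // /I theadE behead_cons.
  by exists [::]; rewrite // /I theadE behead_cons.
- move=> x u nI [L1x L2x]; apply: nI; rewrite /I behead_cons.
  by case: ifP.
Qed.

(** The quantifiers of [L2] are extracted while [L1] stays automatic; [in_PH_and] then extracts
    those of [L1]. *)
Lemma in_PH_and_left n (L1 L2 : n.-tuple word -> Prop) :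
  automatic L1 -> in_PH L2 -> in_PH (fun x => L1 x /\ L2 x).
Proof.
suff H k : forall n (L1 L2 : n.-tuple word -> Prop), automatic L1 -> prenex k L2 ->
    in_PH (fun x => L2 x /\ L1 x) /\ in_PH (fun x => ~ L2 x /\ L1 x).
  by move=> A1 [k /(H k _ _ _ A1)[+ _]]; apply: in_PH_ext => x; rewrite andC.
elim: k => [|k IHk] {}n {}L1 {}L2 A1.
  by move=> A2; split; apply: in_PH_and_automatic => //; exact: automaticN.
move=> [p [L2' [L2'k short sound]]].
have A1W : automatic (fun x : n.+1.-tuple word => L1 [tuple of behead x]).
  have := automatic_reindex (f := lift ord0) (@lift_inj n.+1 ord0) A1.
  by congr automatic; apply/funext => x; rewrite reindex_lift0.
have [P1 P2] := IHk _ _ _ A1W L2'k.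
exact: prenex_and_step short sound P1 P2.
Qed.

Lemma in_PH_and n (L1 L2 : n.-tuple word -> Prop) :
  in_PH L1 -> in_PH L2 -> in_PH (fun x => L1 x /\ L2 x).
Proof.
suff H k : forall n (L1 L2 : n.-tuple word -> Prop), prenex k L1 -> in_PH L2 ->
    in_PH (fun x => L1 x /\ L2 x) /\ in_PH (fun x => ~ L1 x /\ L2 x).
  by move=> [k /(H k) H1] /H1[].
elim: k => [|k IHk] {}n {}L1 {}L2.
  by move=> A1 P2; split; apply: in_PH_and_left => //; exact: automaticN.
move=> [p [L1' [L1'k short sound]]] /in_PH_weaken P2W.
have [P1 P2] := IHk _ _ _ L1'k P2W.
exact: prenex_and_step short sound P1 P2.
Qed.

(** * Definable predicates *)

(* A context of [n] words, the most recently bound one in the last component. *)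
Fixpoint ctx (n : nat) : Type := if n is m.+1 then (ctx m * word)%type else unit.

Fixpoint ctx_of (n : nat) : n.-tuple word -> ctx n :=
  match n with
  | 0 => fun=> tt
  | m.+1 => fun x => (ctx_of [tuple of behead x], thead x)
  end.

Fixpoint ctx_size (n : nat) : ctx n -> nat :=
  match n with
  | 0 => fun=> 0
  | m.+1 => fun g => size g.2 + ctx_size g.1
  end.

Lemma ctx_sizeE n (x : n.-tuple word) : ctx_size (ctx_of x) = input_size x.
Proof.
elim: n x => [|n IHn] x /=; first by rewrite /input_size big_ord0.
by rewrite IHn [in RHS](tuple_eta x) input_size_cons.
Qed.

Lemma ctx_of_cons n u (x : n.-tuple word) : ctx_of [tuple of u :: x] = (ctx_of x, u).
Proof. by rewrite /= behead_cons theadE. Qed.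

Definition definable n (P : ctx n -> Prop) := in_PH (fun x => P (ctx_of x)).

Lemma definable_ext n (P Q : ctx n -> Prop) :
  (forall g, P g <-> Q g) -> definable P -> definable Q.
Proof. by move=> PQ; apply: in_PH_ext. Qed.

Section Connectives.
Variable n : nat.
Implicit Types P Q : ctx n -> Prop.

Lemma definable_not P : definable P -> definable (fun g => ~ P g).
Proof. exact: in_PHN. Qed.

Lemma definable_and P Q :
  definable P -> definable Q -> definable (fun g => P g /\ Q g).
Proof. exact: in_PH_and. Qed.

Lemma definable_or P Q :
  definable P -> definable Q -> definable (fun g => P g \/ Q g).
Proof.
move=> dP dQ.
have := definable_not (definable_and (definable_not dP) (definable_not dQ)).
apply: definable_ext => g; split=> [/not_andP[/contrapT ?|/contrapT ?]|]; [by left|by right|].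
by move=> [?|?] [].
Qed.

Lemma definable_imp P Q :
  definable P -> definable Q -> definable (fun g => P g -> Q g).
Proof.
move=> dP dQ; apply: (definable_ext _ (definable_or (definable_not dP) dQ)) => g.
split=> [[nP Pg|//]|PQ]; first by case: (nP Pg).
by have [Pg|nPg] := pselect (P g); [right; exact: PQ|left].
Qed.

Lemma definable_exists (B : ctx n -> word -> Prop) (p : {poly nat}) :
  definable (fun g : ctx n.+1 => B g.1 g.2) ->
  (forall g u, B g u -> exists2 v : word, size v <= (p.[ctx_size g])%R & B g v) ->
  definable (fun g => exists u, B g u).
Proof.
move=> dB short.
apply: (@in_PH_exists _ _ (fun x => let g := ctx_of x in B g.1 g.2) p).
- exact: in_PHN.
- move=> x [u /short[v sv Bv]]; exists v; first by rewrite -ctx_sizeE.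
  by rewrite ctx_of_cons.
- by move=> x u; rewrite ctx_of_cons; exists u.
Qed.

Lemma definable_exists_le (B : ctx n -> word -> Prop) :
  definable (fun g : ctx n.+1 => B g.1 g.2) ->
  (forall g u, B g u -> size u <= ctx_size g) ->
  definable (fun g => exists u, B g u).
Proof.
move=> dB short; apply: (@definable_exists B 'X%R) => // g u Bu; exists u => //.
by rewrite hornerX; exact: short.
Qed.

Lemma definable_forall_le (B : ctx n -> word -> Prop) :
  definable (fun g : ctx n.+1 => B g.1 g.2) ->
  (forall g u, ctx_size g < size u -> B g u) ->
  definable (fun g => forall u, B g u).
Proof.
move=> dB long.
suff : definable (fun g => exists u, ~ B g u).
  move=> /definable_not; apply: definable_ext => g.
  split=> [nB u|Bg [u nB]]; last exact: nB (Bg u).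
  by apply: contrapT => nBu; apply: nB; exists u.
apply: definable_exists_le => [|g u nB].
  exact: (@in_PHN n.+1 (fun x => let g := ctx_of x in B g.1 g.2)).
by rewrite leqNgt; apply/negP => /long.
Qed.

Lemma definable_const (P : Prop) : @definable n (fun=> P).
Proof.
exists 0; exists (@Automaton n unit tt (fun=> Some `[< P >]) (fun q _ => (q, fun=> false))).
by exists 0%R => x; exists `[< P >]; [exact: au_result0 | split=> [/asboolP|/asboolP]].
Qed.

Lemma definable_exists_fin (I : finType) (B : I -> ctx n -> Prop) :
  (forall i, definable (B i)) -> definable (fun g => exists i, B i g).
Proof.
move=> dB; suff : definable (fun g => exists2 i, i \in enum I & B i g).
  by apply: definable_ext => g; split=> [[i _]|[i]]; exists i; rewrite ?mem_enum.
elim: (enum I) => [|i s IHs].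
  by apply: (definable_ext _ (definable_const False)) => g; split=> // -[].
apply: (definable_ext _ (definable_or (dB i) IHs)) => g; split.
  by move=> [Bi|[j js Bj]]; [exists i; rewrite ?inE ?eqxx | exists j; rewrite // inE js orbT].
by move=> [j]; rewrite inE => /orP[/eqP->|js Bj]; [left | right; exists j].
Qed.
End Connectives.

(** Weakening at de Bruijn index [k]: the [k] most recent variables are kept and the next one is
    forgotten. *)
Fixpoint drop_at (k n : nat) : ctx (k + n.+1) -> ctx (k + n) :=
  match k return ctx (k + n.+1) -> ctx (k + n) with
  | 0 => fun g => g.1
  | k'.+1 => fun g => (@drop_at k' n g.1, g.2)
  end.

Lemma definable_weaken_at k n (P : ctx (k + n) -> Prop) :
  definable P -> definable (fun g : ctx (k + n.+1) => P (drop_at g)).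
Proof.
suff [f f_inj fE] : exists2 f : 'I_(k + n) -> 'I_(k + n.+1), injective f &
    forall x, ctx_of (reindex_words f x) = drop_at (ctx_of x).
  by move=> /(in_PH_reindex f_inj); apply: in_PH_ext => x; rewrite fE.
elim: k {P} => [|k [f f_inj fE]].
  by exists (lift ord0) => [|x]; [exact: lift_inj | rewrite reindex_lift0].
exists (lift_inj_ord f); first exact: lift_inj_ordP.
move=> x; rewrite [in LHS](tuple_eta x) reindex_words_cons.
by rewrite [LHS]ctx_of_cons fE.
Qed.

Definition rel1 (R : word -> Prop) := @definable 1 (fun g => R g.2).
Definition rel2 (R : word -> word -> Prop) := @definable 2 (fun g => R g.1.2 g.2).
Definition rel3 (R : word -> word -> word -> Prop) :=
  @definable 3 (fun g => R g.1.1.2 g.1.2 g.2).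

Definition definable2 n (S : ctx n -> word -> word -> Prop) :=
  @definable n.+2 (fun g => S g.1.1 g.1.2 g.2).

(** The bound on the values is what permits naming a term by a quantified variable. *)
Definition term n (t : ctx n -> word) :=
  @definable n.+1 (fun g => g.2 = t g.1) /\
  exists p : {poly nat}, forall g, size (t g) <= (p.[ctx_size g])%R.

Lemma definable2_weaken n (S : ctx n -> word -> word -> Prop) :
  definable2 S -> definable2 (fun g : ctx n.+1 => S g.1).
Proof. exact: (@definable_weaken_at 2 n). Qed.

Lemma rel1_definable n R : rel1 R -> @definable n.+1 (fun g => R g.2).
Proof. by move=> dR; elim: n => // n; exact: (@definable_weaken_at 1 n). Qed.

Lemma rel2_definable2 n R : rel2 R -> @definable2 n (fun=> R).
Proof. by move=> dR; elim: n => // n; exact: (@definable_weaken_at 2 n). Qed.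

Lemma rel3_definable n R : rel3 R -> @definable n.+3 (fun g => R g.1.1.2 g.1.2 g.2).
Proof. by move=> dR; elim: n => // n; exact: (@definable_weaken_at 3 n). Qed.

Lemma term_weaken n (t : ctx n -> word) : term t -> term (fun g : ctx n.+1 => t g.1).
Proof.
move=> [dt [p pP]]; split; first exact: (definable_weaken_at (k := 1) dt).
by exists p => g; apply: leq_trans (pP _) _; apply: leq_horner; exact: leq_addl.
Qed.

(* Substitution introduces fresh variables for the values of the terms, so that
   the substituted predicate is only ever used on distinct variables. *)
Lemma definable_let n (t : ctx n -> word) (B : ctx n -> word -> Prop) :
  term t -> @definable n.+1 (fun g => B g.1 g.2) -> definable (fun g => B g (t g)).
Proof.
move=> [dt [p pP]] dB.
suff : definable (fun g => exists u, u = t g /\ B g u).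
  by apply: definable_ext => g; split=> [[u [->]]|Bt] //; exists (t g).
apply: (@definable_exists _ _ p); first exact: definable_and dt dB.
by move=> g u [-> Bt]; exists (t g).
Qed.

Lemma definable2_app n (S : ctx n -> word -> word -> Prop) (s t : ctx n -> word) :
  definable2 S -> term s -> term t -> definable (fun g => S g (s g) (t g)).
Proof.
move=> dS ts tt; apply: (@definable_let _ s (fun g u => S g u (t g))) => //.
by apply: (@definable_let _ (fun g : ctx n.+1 => t g.1) (fun g u => S g.1 g.2 u)) => //;
  exact: term_weaken.
Qed.

Section Application.
Variables (n : nat) (r s t : ctx n -> word).
Hypotheses (tr : term r) (ts : term s) (tt : term t).

Lemma rel1_app R : rel1 R -> definable (fun g => R (t g)).
Proof. by move=> dR; apply: (@definable_let _ t (fun=> R)) => //; exact: rel1_definable. Qed.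

Lemma rel2_app R : rel2 R -> definable (fun g => R (s g) (t g)).
Proof. by move=> dR; apply: (@definable2_app _ (fun=> R)) => //; exact: rel2_definable2. Qed.

Lemma rel3_app R : rel3 R -> definable (fun g => R (r g) (s g) (t g)).
Proof.
move=> dR; apply: (@definable_let _ r (fun g u => R u (s g) (t g))) => //.
apply: (@definable_let _ (fun g : ctx n.+1 => s g.1) (fun g v => R g.2 v (t g.1))).
  exact: term_weaken.
apply: (@definable_let _ (fun g : ctx n.+2 => t g.1.1) (fun g w => R g.1.2 g.2 w)).
  exact: (@term_weaken _ (fun g : ctx n.+1 => t g.1) (term_weaken tt)).
exact: rel3_definable.
Qed.
End Application.

(** * Basic relations *)

Section Synchronous.
Variables (Q : finType) (q0 : Q) (step : Q -> option bool -> option bool -> Q) (acc : pred Q).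

(** Both words are read in lockstep; an exhausted one yields [None] while the other lasts. *)
Fixpoint sync_run (q : Q) (x y : word) : Q :=
  if x is a :: x' then sync_run (step q (Some a) (ohead y)) x' (behead y)
  else foldl (fun q b => step q None (Some b)) q y.

Lemma rel2_sync : rel2 (fun x y => acc (sync_run q0 x y)).
Proof.
exists 0.
(* The most recent variable is the head of the tuple, so the left argument has index 1 and the right
   one index 0. *)
pose next (q : Q + bool) (s : {ffun 'I_2 -> option bool}) : (Q + bool) * ('I_2 -> bool) :=
  if q is inl q then
    if (s (lift ord0 ord0) == None) && (s ord0 == None) then (inr (acc q), fun=> false)
    else (inl (step q (s (lift ord0 ord0)) (s ord0)), fun=> true)
  else (q, fun=> false).
pose A := @Automaton 2 (Q + bool)%type (inl q0) (fun q => if q is inr b then Some b else None) next.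
have run t q (w : 'I_2 -> word) : size (w (lift ord0 ord0)) + size (w ord0) < t ->
    @au_result _ A t (inl q, w) = Some (acc (sync_run q (w (lift ord0 ord0)) (w ord0))).
  elim: t q w => // t IHt q w lt_t; rewrite au_resultS // /au_move /= !ffunE.
  case xE : (w (lift ord0 ord0)) lt_t => [|a x]; case yE : (w ord0) => [|b y] /= lt_t.
  - exact: au_result0.
  - by apply: (etrans (IHt _ _ _)); rewrite /= ?xE ?yE /= //; lia.
  - by apply: (etrans (IHt _ _ _)); rewrite /= ?xE ?yE /= //; lia.
  - by apply: (etrans (IHt _ _ _)); rewrite /= ?xE ?yE /= //; lia.
exists A, ('X + 1)%R => x; exists (acc (sync_run q0 (tnth x (lift ord0 ord0)) (tnth x ord0))).
  apply: run; rewrite hornerD hornerX hornerC.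
  have -> : input_size x = size (tnth x ord0) + size (tnth x (lift ord0 ord0)).
    by rewrite /input_size !big_ord_recl big_ord0 addn0.
  by rewrite addnC -addn1.
by case/tupleP: x => u x; case/tupleP: x => v x; rewrite !tnthS !tnth0.
Qed.
End Synchronous.

(** A finite automaton on one word is a synchronous one that ignores a second word, which is then
    quantified away. *)
Lemma rel1_dfa (Q : finType) (q0 : Q) (step : Q -> bool -> Q) (acc : pred Q) :
  rel1 (fun x => acc (foldl step q0 x)).
Proof.
pose step' q (_ b : option bool) := if b is Some b then step q b else q.
have runE q y x : sync_run step' q y x = foldl step q x.
  by elim: y q x => [|a y IHy] q x //=; case: x => [|b x] /=; rewrite IHy.
have := @definable_exists 1 (fun g y => acc (sync_run step' q0 y g.2)) 0%R.
move=> H; apply: (definable_ext _ (H _ _)) => [g||g u Bu].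
- by split=> [[y]|Bg]; [|exists [::]]; rewrite runE.
- have := rel2_sync q0 (fun q a b => step' q b a) acc.
  apply: definable_ext => g; rewrite runE.
  suff -> : forall q x y, sync_run (fun q a b => step' q b a) q x y = foldl step q x by [].
  move=> q x; elim: x q => [|a x IHx] q y //=.
  by elim: y q => //=.
- by exists [::] => //; move: Bu; rewrite !runE.
Qed.

Definition enc_bits : word -> word := enc_list (fun b : bool => [:: b]).

Lemma rel2_enc_bits : rel2 (fun x y => x = enc_bits y).
Proof.
exists 0.
pose i1 : 'I_2 := lift ord0 ord0.
(* [Some false] expects a tag, [Some true] a data bit, and [None] the end of the code; the head on
   the plain word moves only with data bits. *)
pose next (q : option bool + bool) (s : {ffun 'I_2 -> option bool}) :
    (option bool + bool) * ('I_2 -> bool) :=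
  match q with
  | inl (Some false) =>
      if s i1 == Some true then (inl (Some true), fun i => i == i1)
      else if (s i1 == Some false) && (s ord0 == None) then (inl None, fun i => i == i1)
      else (inr false, fun=> false)
  | inl (Some true) =>
      if (s i1 == s ord0) && (s ord0 != None) then (inl (Some false), fun=> true)
      else (inr false, fun=> false)
  | inl None => (inr (s i1 == None), fun=> false)
  | inr b => (q, fun=> false)
  end.
pose A := @Automaton 2 (option bool + bool)%type (inl (Some false))
  (fun q => if q is inr b then Some b else None) next.
have run t (w : 'I_2 -> word) : (2 * size (w ord0)).+3 <= t ->
    @au_result _ A t (inl (Some false), w) = Some (w i1 == enc_bits (w ord0)).
  elim/ltn_ind: t w => [[|[|t]]] // IHt w lt_t.
  have stop b k (v : 'I_2 -> word) : @au_result _ A k (inr b, v) = Some b.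
    exact: au_result0.
  rewrite au_resultS // /au_move /= !ffunE.
  case xE : (w i1) => [|a x] /=; first by rewrite stop; case: (w ord0).
  case: a xE => xE /=; last first.
    case yE : (w ord0) lt_t => [|b y] lt_t /=; last by rewrite stop.
    rewrite au_resultS // /au_move /= !ffunE xE /= stop.
    by case: x {xE}.
  rewrite au_resultS // /au_move /= !ffunE /= xE /=.
  case yE : (w ord0) lt_t => [|b y] lt_t /=; first by case: x {xE} => [|c x]; rewrite /= stop.
  rewrite andbT; case: x xE => [|c x] xE; first by case: eqP => // _; rewrite stop.
  case: c b yE xE lt_t => [] [] yE xE lt_t /=; rewrite ?stop //.
    apply: (etrans (IHt _ _ _ _)) => //=; rewrite ?xE ?yE //=.
    by move: lt_t => /=; lia.
  apply: (etrans (IHt _ _ _ _)) => //=; rewrite ?xE ?yE //=.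
  by move: lt_t => /=; lia.
exists A, (2%:P * 'X + 3%:P)%R => x.
exists (tnth x i1 == enc_bits (tnth x ord0)).
  apply: run; rewrite hornerD hornerM hornerX !hornerC.
  have -> : input_size x = size (tnth x ord0) + size (tnth x i1).
    by rewrite /input_size !big_ord_recl big_ord0 addn0.
  have -> a b c : (a * b + c)%R = a * b + c by [].
  by lia.
case/tupleP: x => u x; case/tupleP: x => v x; rewrite !tnthS !tnth0.
by split=> [/eqP //|E]; apply/eqP; exact: E.
Qed.

Lemma rel3_cat : rel3 (fun x y z => x = y ++ z).
Proof.
exists 0.
pose i1 : 'I_3 := lift ord0 ord0.
pose i2 : 'I_3 := lift ord0 (lift ord0 ord0).
(* The state [inl false] compares the long word with the first factor, [inl true] compares what
   remains with the second. *)
pose next (q : bool + bool) (s : {ffun 'I_3 -> option bool}) : (bool + bool) * ('I_3 -> bool) :=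
  match q with
  | inl false =>
      if s i1 == None then (inl true, fun=> false)
      else if s i2 == s i1 then (inl false, fun i => i != ord0)
      else (inr false, fun=> false)
  | inl true =>
      if s ord0 == None then (inr (s i2 == None), fun=> false)
      else if s i2 == s ord0 then (inl true, fun i => i != i1)
      else (inr false, fun=> false)
  | inr b => (q, fun=> false)
  end.
pose A := @Automaton 3 (bool + bool)%type (inl false)
  (fun q => if q is inr b then Some b else None) next.
have stop b k (v : 'I_3 -> word) : @au_result _ A k (inr b, v) = Some b.
  exact: au_result0.
have run1 t (w : 'I_3 -> word) : size (w ord0) < t ->
    @au_result _ A t (inl true, w) = Some (w i2 == w ord0).
  elim: t w => // t IHt w lt_t; rewrite au_resultS // /au_move /= !ffunE.
  case zE : (w ord0) lt_t => [|b z] lt_t /=; first by rewrite stop; case: (w i2).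
  case xE : (w i2) => [|a x] /=; first by rewrite stop.
  by case: a b zE xE lt_t => [] [] zE xE lt_t /=; rewrite ?stop //;
    apply: (etrans (IHt _ _)); rewrite /= ?zE ?xE.
have run t (w : 'I_3 -> word) : size (w i1) + size (w ord0) < t.+1 ->
    @au_result _ A t.+2 (inl false, w) = Some (w i2 == w i1 ++ w ord0).
  elim: t w => [|t IHt] w lt_t; rewrite au_resultS // /au_move /= !ffunE.
    case yE : (w i1) lt_t => [|b y] lt_t //=.
    by apply: (etrans (run1 _ _ _)).
  case yE : (w i1) lt_t => [|b y] lt_t /=.
    by apply: (etrans (run1 _ _ _)).
  case xE : (w i2) => [|a x] /=; first by rewrite stop.
  by case: a b yE xE lt_t => [] [] yE xE lt_t /=; rewrite ?stop //;
    apply: (etrans (IHt _ _)); rewrite /= ?yE ?xE.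
exists A, ('X + 2%:P)%R => x.
exists (tnth x i2 == tnth x i1 ++ tnth x ord0).
  rewrite hornerD hornerX !hornerC.
  have -> a b : (a + b)%R = a + b by [].
  rewrite addn2; apply: run.
  have -> : input_size x = size (tnth x ord0) + (size (tnth x i1) + size (tnth x i2)).
    by rewrite /input_size !big_ord_recl big_ord0 addn0.
  by lia.
case/tupleP: x => u x; case/tupleP: x => v x; case/tupleP: x => w x.
by rewrite /i2 !tnthS !tnth0; split=> [/eqP //|E]; apply/eqP; exact: E.
Qed.

Lemma term_var0 n : term (fun g : ctx n.+1 => g.2).
Proof.
split; last by exists 'X%R => g; rewrite hornerX leq_addr.
apply: (definable_ext _ (@rel2_definable2 n (fun x y => y = x) _)) => //.
have := rel2_sync true (fun q a b => q && (a == b)) id; apply: definable_ext => g.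
move: g.1.2 g.2 => x y; rewrite /=.
have runF x' y' : sync_run (fun q a b => q && (a == b)) false x' y' = false.
  elim: x' y' => [|a x' IHx] y' //=; by elim: y'.
elim: x y => [|a x IHx] [|b y] //=.
- by have := runF [::] y => /= ->.
- by rewrite runF.
have [ab|nab] := eqVneq (Some a) (Some b).
  by rewrite /= IHx; case: ab => ->; split=> [->|[]].
by rewrite /= runF; split=> // -[ba _]; rewrite ba eqxx in nab.
Qed.

Section Terms.
Variable n : nat.

Lemma term_const w : term (fun _ : ctx n => w).
Proof.
split; last by exists (size w)%:P%R => g; rewrite hornerC.
suff dw : rel1 (fun x => x = w) by exact: (@rel1_app n.+1 _ (@term_var0 n) _ dw).
elim: w => [|b w IHw].
  have := rel1_dfa true (fun _ _ => false) id; apply: definable_ext => g.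
  have F (x : word) : foldl (fun _ _ => false) false x = false by elim: x.
  by case: g.2 => [|a x] //=; rewrite F.
have db : rel1 (fun x => x = [:: b]).
  pose step (q : option bool) a :=
    if q is Some false then if a == b then Some true else None else None.
  have := rel1_dfa (Some false) step (fun q => q == Some true).
  have F (x : word) : foldl step None x = None by elim: x.
  apply: definable_ext => g; case: g.2 => [|a [|c x]] //=.
    by case: a b @step F => [] [] step F /=; split.
  suff -> : step (if a == b then Some true else None) c = None by rewrite F.
  by case: ifP.
suff : @definable 1 (fun g => exists u, u = [:: b] /\ exists v, v = w /\ g.2 = u ++ v).
  apply: definable_ext => g; split=> [[u [-> [v [-> ->]]]]|->] //.
  by exists [:: b]; split=> //; exists w.
apply: (@definable_exists _ _ 1%:P%R) => [|g u [-> H]]; last by exists [:: b]; rewrite ?hornerC.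
apply: definable_and; first exact: (@rel1_definable 1 (fun x => x = [:: b]) db).
apply: (@definable_exists _ _ (size w)%:P%R) => [|g v [-> H]]; last by exists w; rewrite ?hornerC.
apply: definable_and; first exact: (@rel1_definable 2 (fun x => x = w) IHw).
have t2 : term (fun g : ctx 3 => g.1.1.2).
  exact: (@term_weaken _ (fun g : ctx 2 => g.1.2) (term_weaken (@term_var0 0))).
exact: (rel3_app t2 (term_weaken (@term_var0 1)) (@term_var0 2) rel3_cat).
Qed.

Lemma term_cat (s t : ctx n -> word) :
  term s -> term t -> term (fun g => s g ++ t g).
Proof.
move=> ts tt; split.
  exact: (rel3_app (@term_var0 n) (term_weaken ts) (term_weaken tt) rel3_cat).
have [[_ [p pP]] [_ [q qP]]] := (ts, tt); exists (p + q)%R => g.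
by rewrite size_cat hornerD; exact: leq_add.
Qed.

Lemma size_enc_bits w : size (enc_bits w) = (2 * size w).+1.
Proof. by elim: w => //= b w IHw; rewrite IHw; lia. Qed.

Lemma term_enc_bits (t : ctx n -> word) : term t -> term (fun g => enc_bits (t g)).
Proof.
move=> tt; split; first exact: (rel2_app (@term_var0 n) (term_weaken tt) rel2_enc_bits).
have [_ [p pP]] := tt; exists (p + p + 1)%R => g.
have := pP g; rewrite size_enc_bits !hornerD hornerC.
have -> a b : (a + b)%R = a + b by [].
by lia.
Qed.

End Terms.

Lemma term_cons n b (t : ctx n -> word) : term t -> term (fun g => b :: t g).
Proof. exact: (term_cat (@term_const n [:: b])). Qed.

Definition eq_word (x y : word) := x = y.

Lemma definable_eq n (s t : ctx n -> word) :
  term s -> term t -> definable (fun g => s g = t g).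
Proof.
move=> ts tt; apply: (rel2_app ts tt (R := eq_word)).
by apply: (definable_ext _ (@term_var0 0).1) => g; split=> ->.
Qed.

Fixpoint var (i n : nat) : ctx (i + n.+1) -> word :=
  match i return ctx (i + n.+1) -> word with
  | 0 => fun g => g.2
  | i'.+1 => fun g => @var i' n g.1
  end.

Lemma term_var i n : term (@var i n).
Proof. by elim: i => [|i IHi]; [exact: term_var0 | exact: term_weaken IHi]. Qed.

Ltac solve_var := first
  [ exact (@term_var 0 _) | exact (@term_var 1 _) | exact (@term_var 2 _)
  | exact (@term_var 3 _) | exact (@term_var 4 _) | exact (@term_var 5 _)
  | exact (@term_var 6 _) | exact (@term_var 7 _) | exact (@term_var 8 _)
  | exact (@term_var 9 _) | exact (@term_var 10 _) ].

Ltac solve_term := lazymatch goal with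
  | |- term (fun _ => _ ++ _) => apply: term_cat; solve_term
  | |- term (fun _ => enc_bits _) => apply: term_enc_bits; solve_term
  | |- term (fun _ => _ :: _) => apply: term_cons; solve_term
  | |- term _ => first [solve_var | exact: term_const]
  end.

(** * Iteration *)

Definition prefix_free (I : Type) (enc : I -> word) : Prop :=
  forall x y u v, enc x ++ u = enc y ++ v -> x = y /\ u = v.

Lemma prefix_free_inj I (enc : I -> word) x y : prefix_free enc -> enc x = enc y -> x = y.
Proof. by move=> pf xy; have [] := pf x y [::] [::]; rewrite ?cats0. Qed.

Lemma enc_list_prefix_free I (enc : I -> word) : prefix_free enc -> prefix_free (enc_list enc).
Proof.
move=> pf s t u v; elim: s t => [|x s IHs] [|y t] //=; first by case.
by case; rewrite -!catA => /pf[-> /IHs[-> ->]].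
Qed.

Lemma enc_bits_prefix_free : prefix_free enc_bits.
Proof. by apply: enc_list_prefix_free => x y u v [-> ->]. Qed.

(** No closing bit is written, so factoring a list of configurations amounts to factoring its
    code. *)
Definition enc_configs (s : seq word) : word := flatten (map enc_bits s).

Lemma enc_configs_cat s t : enc_configs (s ++ t) = enc_configs s ++ enc_configs t.
Proof. by rewrite /enc_configs map_cat flatten_cat. Qed.

Lemma enc_configs_inj : injective enc_configs.
Proof.
elim=> [|x s IHs] [|y t] //=; first by case: y.
  by case: x.
by rewrite /enc_configs /= => /enc_bits_prefix_free[-> /IHs->].
Qed.

Definition is_configs (x : word) : Prop := exists s, x = enc_configs s.

Lemma rel1_is_configs : rel1 is_configs.
Proof.
(* [Some true]: between two configurations; [Some false]: inside one, before a
   tag; [None]: before a data bit. *)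
pose step (q : option bool) (a : bool) : option bool :=
  if q is None then Some false else if a then None else Some true.
have := rel1_dfa (Some true) step (fun q => q == Some true).
apply: definable_ext => g; move: g.2 => x.
suff [H _] : [/\ foldl step (Some true) x == Some true <-> is_configs x,
    foldl step (Some false) x == Some true <-> exists y s, x = enc_bits y ++ enc_configs s &
    foldl step None x == Some true <->
      exists b y s, x = b :: enc_bits y ++ enc_configs s] by [].
elim: x => [|a x [IH1 IH2 IH3]] /=.
  split; split=> //; first by exists [::].
  - by move=> [[|b y] [s]].
  - by move=> [b [y [s]]].
split; last first.
- rewrite IH2; split=> [[y [s ->]]|[b [y [s [_ ->]]]]]; first by exists a, y, s.
  by exists y, s.
- case: a => /=.
    rewrite IH3; split=> [[b [y [s ->]]]|[[|b y] [s] //= [->]]]; first by exists (b :: y), s.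
    by exists b, y, s.
  rewrite IH1; split=> [[s ->]|[[|b y] [s] //= [->]]]; first by exists [::], s.
  by exists s.
- case: a => /=.
    rewrite IH3; split=> [[b [y [s ->]]]|[[|[|b y] s] //= [->]]].
      by exists ((b :: y) :: s).
    by exists b, y, s.
  rewrite IH1; split=> [[s ->]|[[|[|b y] s] //= [->]]]; first by exists ([::] :: s).
  by exists s.
Qed.

Inductive steps (S : word -> word -> Prop) : word -> word -> Prop :=
| StepsRefl x : steps S x x
| StepsStep x y z : S x y -> steps S y z -> steps S x z.

(** Stated by factorisation instead of recursion, as this is what a formula over codes can
    express. *)
Definition consecutive (S : word -> word -> Prop) (s : seq word) : Prop :=
  forall s1 x y s2, s = s1 ++ x :: y :: s2 -> S x y.

Lemma consecutive_cons S x y s :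
  consecutive S (x :: y :: s) <-> S x y /\ consecutive S (y :: s).
Proof.
split=> [c|[Sxy c] [|z s1] a b s2].
- split; first exact: (c [::] x y s).
  by move=> s1 a b s2 E'; apply: (c (x :: s1) a b s2); rewrite E'.
- by case=> <- <-.
- by case=> _; exact: c.
Qed.

(** Sizes decrease strictly from [size x]: there are at most [(size x).+1] configurations, each with
    a code of at most [2 * size x + 1] bits. *)
Lemma steps_consecutive S x z : (forall x y, S x y -> size y < size x) ->
  steps S x z -> exists s, [/\ consecutive S (x :: s), last x s = z &
    size (enc_configs (x :: s)) <= (size x).+1 * (2 * size x).+1].
Proof.
move=> dec; elim=> {x z} [x|x y z Sxy _ [s [cs ls ss]]].
  exists [::]; split=> //; first by move=> [|a [|b s1]].
  by rewrite /enc_configs /= cats0 size_enc_bits; nia.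
exists (y :: s); split=> //; first exact/consecutive_cons.
have := dec _ _ Sxy; move: ss; rewrite /enc_configs /= !size_cat !size_enc_bits; nia.
Qed.

Lemma consecutive_steps S x s : consecutive S (x :: s) -> steps S x (last x s).
Proof.
elim: s x => [|y s IHs] x; first by move=> _; exact: StepsRefl.
by move=> /consecutive_cons[Sxy /IHs]; exact: StepsStep.
Qed.

(** The certificate is the code of a whole run. That all its steps are correct is a universal
    statement about its factors, hence within the logic. *)
Lemma definable_steps n (S : ctx n -> word -> word -> Prop) :
  (forall g x y, S g x y -> size y < size x) -> definable2 S ->
  definable2 (fun g => steps (S g)).
Proof.
move=> dec dS; rewrite /definable2.
(* Requiring [a] and [d] to be codes of lists aligns the factorisation with the boundaries of
   configurations. *)
pose valid (g : ctx n) c := forall a u v d, is_configs a -> is_configs d ->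
  c = a ++ enc_bits u ++ enc_bits v ++ d -> S g u v.
pose cert (g : ctx n.+2) c := is_configs c /\ (exists r, c = enc_bits g.1.2 ++ r) /\
  (exists r, is_configs r /\ c = r ++ enc_bits g.2) /\ valid g.1.1 c.
have complete g : steps (S g.1.1) g.1.2 g.2 -> exists2 c : word,
    size c <= (size g.1.2).+1 * (2 * size g.1.2).+1 & cert g c.
  move=> /(steps_consecutive (dec g.1.1))[s [cs ls ss]].
  exists (enc_configs (g.1.2 :: s)) => //; split; first by exists (g.1.2 :: s).
  split; first by exists (enc_configs s).
  split.
    exists (enc_configs (belast g.1.2 s)); split; first by exists (belast g.1.2 s).
    by rewrite lastI -cats1 enc_configs_cat ls /enc_configs /= cats0.
  move=> _ u v _ [s1 ->] [s2 ->].
  have -> : enc_configs s1 ++ enc_bits u ++ enc_bits v ++ enc_configs s2 =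
    enc_configs (s1 ++ u :: v :: s2) by rewrite enc_configs_cat.
  by move=> /enc_configs_inj/cs.
have sound g c : cert g c -> steps (S g.1.1) g.1.2 g.2.
  move=> [[s ->] [[r sE] [[_ [[s1 ->] sE']] val]]].
  case: s sE sE' val => [|x s]; first by case: g.1.2.
  move=> /enc_bits_prefix_free[-> _] sE' val.
  have {}sE' : g.1.2 :: s = rcons s1 g.2.
    apply: enc_configs_inj; rewrite -cats1 enc_configs_cat.
    by rewrite [X in _ = _ ++ X]cats0.
  have -> : g.2 = last g.1.2 s.
    by rewrite -[RHS]/(last g.1.2 (g.1.2 :: s)) sE' last_rcons.
  apply: consecutive_steps => s2 u v s3 E'.
  apply: (val (enc_configs s2) u v (enc_configs s3)); [by exists s2 | by exists s3 |].
  by rewrite E' enc_configs_cat.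
apply: (@definable_ext _ (fun g => exists c, cert g c)) => [g|].
  by split=> [[c /sound]|/complete[c _ ?]] //; exists c.
(* The polynomial is the bound of [complete], with the size of the context in place of that of the
   starting configuration. *)
apply: (@definable_exists _ cert (('X + 1) * (2%:P * 'X + 1))%R); last first.
  move=> g c /sound/complete[c' sc' Cc']; exists c' => //; apply: leq_trans sc' _.
  rewrite hornerM !hornerD hornerM !hornerX !hornerC.
  have addE (a b : nat) : (a + b)%R = a + b by [].
  have mulE (a b : nat) : (a * b)%R = a * b by [].
  have -> : (1%R : nat) = 1 by [].
  have : size g.1.2 <= ctx_size g by rewrite /=; lia.
  move: (size g.1.2) (ctx_size g) => k N kN; rewrite !addE !mulE.
  by apply: leq_mul; lia.
rewrite /cert /=.
apply: definable_and; first by apply: (rel1_app _ rel1_is_configs); solve_term.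
apply: definable_and.
  apply: definable_exists_le => [|g u E']; last by have := congr1 size E'; rewrite size_cat /=; lia.
  by apply: definable_eq; solve_term.
apply: definable_and.
  apply: definable_exists_le => [|g u [_ E']]; last by have := congr1 size E'; rewrite size_cat /=; lia.
  apply: definable_and; first by apply: (rel1_app _ rel1_is_configs); solve_term.
  by apply: definable_eq; solve_term.
rewrite /valid.
have long (g : nat) (c a u v d : word) : size c <= g ->
    c = a ++ enc_bits u ++ enc_bits v ++ d ->
    [/\ size a <= g, size u <= g, size v <= g & size d <= g].
  by move=> cg E'; move: cg; rewrite E' !size_cat !size_enc_bits; split; lia.
apply: definable_forall_le => [|g a lt_a u v d _ _ E']; last first.
  by have [] := long (ctx_size g) _ _ _ _ _ _ E'; [rewrite /=; lia | lia].
apply: definable_forall_le => [|g u lt_u v d _ _ E']; last first.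
  by have [] := long (ctx_size g) _ _ _ _ _ _ E'; [rewrite /=; lia | lia].
apply: definable_forall_le => [|g v lt_v d _ _ E']; last first.
  by have [] := long (ctx_size g) _ _ _ _ _ _ E'; [rewrite /=; lia | lia].
apply: definable_forall_le => [|g d lt_d _ _ E']; last first.
  by have [] := long (ctx_size g) _ _ _ _ _ _ E'; [rewrite /=; lia | lia].
rewrite /=.
apply: definable_imp; first by apply: (rel1_app _ rel1_is_configs); solve_term.
apply: definable_imp; first by apply: (rel1_app _ rel1_is_configs); solve_term.
apply: definable_imp; first by apply: definable_eq; solve_term.
(* Seven variables are now bound beyond [g]: the two ends, the certificate, and [a], [u], [v],
   [d]. *)
have dS7 := definable2_weaken (definable2_weaken (definable2_weaken (definable2_weaken
  (definable2_weaken (definable2_weaken (definable2_weaken dS)))))).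
by apply: (definable2_app dS7); solve_term.
Qed.

(** Bounds a witness by the context: it occurs as a factor in some equation, and all equations are
    replaced by those between sizes. *)
Ltac by_size :=
  let g := fresh "g" in let u := fresh "u" in let H := fresh "H" in
  move=> g u H;
  repeat match goal with
  | H : ex _ |- _ => destruct H
  | H : _ /\ _ |- _ => destruct H
  | H : _ \/ _ |- _ => destruct H
  end;
  repeat match goal with
  | H : @eq _ ?x ?y |- _ => apply (congr1 (@size bool)) in H;
      rewrite /= ?(size_cat, size_enc_bits) /= ?(size_cat, size_enc_bits) /= in H
  end;
  rewrite /=; lia.

Ltac define := lazymatch goal with
  | |- definable (fun _ => _ /\ _) => apply: definable_and; define
  | |- definable (fun _ => _ \/ _) => apply: definable_or; define
  | |- definable (fun _ => ~ _) => apply: definable_not; define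
  | |- definable (fun _ => exists _, _) =>
      apply: definable_exists_le; [cbv beta; define | by_size]
  | |- definable (fun _ => _ = _) => apply: definable_eq; solve_term
  | H : rel1 ?R |- definable (fun _ => ?R _) => apply: (rel1_app _ H); solve_term
  | H : rel2 ?R |- definable (fun _ => ?R _ _) => apply: (rel2_app _ _ H); solve_term
  end.

(** * Encodings of lists *)

Definition is_enc I (enc : I -> word) (x : word) : Prop := exists i, x = enc i.

Definition rel_enc I (enc : I -> word) (r : I -> I -> Prop) (x y : word) : Prop :=
  exists i j, [/\ x = enc i, y = enc j & r i j].

Section Lists.
Variables (I : Type) (enc : I -> word).
Hypotheses (pf : prefix_free enc) (dV : rel1 (is_enc enc)).

Local Notation is_list := (is_enc (enc_list enc)).
Let lpf : prefix_free (enc_list enc) := enc_list_prefix_free pf.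

(** [a] is the code of [s] without its closing bit, which turns concatenation of lists into
    concatenation of words. *)
Lemma enc_list_app s : exists a : word, enc_list enc s = a ++ [:: false] /\
  forall t, enc_list enc (s ++ t) = a ++ enc_list enc t.
Proof.
elim: s => [|i s [a [aE IHs]]]; first by exists [::].
by exists (true :: enc i ++ a); split=> [|u]; rewrite /= ?aE ?IHs -catA.
Qed.

(** Items are peeled off one at a time until only the closing bit remains. Iteration is needed
    because codes of items form an arbitrary definable language. *)
Lemma rel1_is_list : rel1 is_list.
Proof.
pose S (_ : ctx 0) x y := exists c, is_enc enc c /\ x = true :: c ++ y.
have dS : definable2 (fun g => steps (S g)).
  apply: definable_steps => [g x y [c [_ ->]]|]; first by rewrite /= size_cat; lia.
  by rewrite /definable2 /S; define.
suff : @definable 1 (fun g => steps (S tt) g.2 [:: false]).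
  apply: definable_ext => g; move: g.2 => x; split.
    suff H z : steps (S tt) x z -> z = [:: false] -> is_list x by move=> /H; apply.
    elim=> {x z} [x ->|x y z [c [[i ->] ->]] _ IH zE]; first by exists [::].
    by have [s ->] := IH zE; exists (i :: s).
  move=> [s ->]; elim: s => [|i s IHs]; first exact: StepsRefl.
  by apply: StepsStep IHs; exists (enc i); split=> //; exists i.
have dS' : definable2 (fun g : ctx 1 => steps (S tt)) := definable2_weaken dS.
by apply: (definable2_app dS'); solve_term.
Qed.

Definition item (c l : word) : Prop :=
  exists i s, [/\ c = enc i, l = enc_list enc s & List.In i s].

(** The right side is a formula: that [a ++ [:: false]] is a list says that [a] is a list not yet
    closed. *)
Lemma itemP c l : item c l <-> is_enc enc c /\
  exists a, is_list (a ++ [:: false]) /\ exists r, is_list r /\ l = a ++ true :: c ++ r.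
Proof.
split=> [[i [s [-> -> is_]]]|].
  have [s1 [s2 ->]] := List.in_split i s is_; split; first by exists i.
  have [a [aE sE]] := enc_list_app s1; exists a; split; first by exists s1.
  by exists (enc_list enc s2); split; [exists s2 | rewrite sE].
move=> [[i ->] [a [[s1 aE] [_ [[s2 ->] ->]]]]]; exists i, (s1 ++ i :: s2); split=> //.
  have [b [bE sE]] := enc_list_app s1; rewrite sE /=; congr (_ ++ _).
  by move: aE; rewrite bE !cats1 => /rcons_inj[].
by apply: List.in_or_app; right; left.
Qed.

Lemma rel2_item : rel2 item.
Proof.
have dL := rel1_is_list.
suff : rel2 (fun c l => is_enc enc c /\ exists a, is_list (a ++ [:: false]) /\
    exists r, is_list r /\ l = a ++ true :: c ++ r).
  by apply: definable_ext => g; exact: iff_sym (itemP _ _).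
by rewrite /rel2; define.
Qed.

Variable r : I -> I -> Prop.
Hypothesis dR : rel2 (rel_enc enc r).

Definition exists_item (c l : word) : Prop :=
  exists i s, [/\ c = enc i, l = enc_list enc s & List.Exists (r i) s].

Lemma rel2_exists_item : rel2 exists_item.
Proof.
have dI := rel2_item.
suff : rel2 (fun c l => exists d, item d l /\ rel_enc enc r c d).
  apply: definable_ext => g; split.
    move=> [_ [[j [s [-> -> js]]] [i [j' [-> /(prefix_free_inj pf)<- rij]]]]].
    by exists i, s; split=> //; apply/List.Exists_exists; exists j.
  move=> [i [s [-> -> /List.Exists_exists[j [js rij]]]]].
  by exists (enc j); split; [exists j, s | exists i, j].
rewrite /rel2; apply: definable_exists_le; first by define.
by move=> g u [/itemP[_ [a [_ [b [_ E']]]]] _]; have := congr1 size E';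
  rewrite /= !size_cat /= size_cat; lia.
Qed.

Lemma rel2_forall_exists :
  rel2 (rel_enc (enc_list enc) (fun s t => List.Forall (fun i => List.Exists (r i) t) s)).
Proof.
have dI := rel2_item; have dL := rel1_is_list; have dE := rel2_exists_item.
suff : rel2 (fun x y => is_list x /\ is_list y /\
    forall c, item c x -> exists_item c y).
  apply: definable_ext => g; split; last first.
    move=> [s [t [-> -> /List.Forall_forall st]]]; split; first by exists s.
    split; first by exists t.
    move=> _ [i [s' [-> /(prefix_free_inj lpf)<- /st it]]]; by exists i, t.
  move=> [[s sE] [[t tE] st]]; exists s, t; split=> //.
  apply/List.Forall_forall => i is_.
  have /st : item (enc i) g.1.2 by exists i, s.
  move=> [j [t' [/(prefix_free_inj pf)<- + it]]]; rewrite tE.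
  by move=> /(prefix_free_inj lpf) ->.
rewrite /rel2; do 2 (apply: definable_and; first by define).
apply: definable_forall_le => [|g c lt_c /itemP[_ [a [_ [b [_ E']]]]]]; last first.
  by exfalso; have := congr1 size E'; move: lt_c; rewrite /= !size_cat /= size_cat; lia.
by apply: definable_imp; define.
Qed.

End Lists.

(** * Encodings of products *)

Lemma definable2_steps0 (S : word -> word -> Prop) n :
  (forall x y, S x y -> size y < size x) -> @definable2 0 (fun=> S) ->
  @definable2 n (fun=> steps S).
Proof.
move=> dec dS; elim: n => [|n]; last exact: definable2_weaken.
exact: (@definable_steps 0 (fun=> S)).
Qed.

Section Products.
Variables (E : Type) (enc : E -> word) (leE : E -> E -> Prop).
Hypotheses (pf : prefix_free enc) (dV : rel1 (is_enc enc)) (dR : rel2 (rel_enc enc leE)).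

Local Notation enc_as := (enc_list (enc_atom enc)).
Local Notation is_list := (is_enc (enc_list enc)).
Let lpf : prefix_free (enc_list enc) := enc_list_prefix_free pf.

Lemma enc_atom_prefix_free : prefix_free (enc_atom enc).
Proof.
move=> [C|C A] [C'|C' A'] u v //= [].
  by move=> /pf[-> ->].
rewrite -!catA => /pf[-> H].
by have [-> ->] := lpf H.
Qed.
Let apf := enc_atom_prefix_free.

Lemma rel2_atom : rel2 (rel_enc (enc_atom enc) (atom_le leE)).
Proof.
have dL := rel1_is_list dV; have dE := rel2_exists_item pf dV dR.
have dF := rel2_forall_exists pf dV dR.
set Ex := exists_item enc leE in dE; set Fa := rel_enc _ _ in dF.
(* [~ k = [:: false]] says that the starred list is nonempty. The list on the right is then nonempty
   too, having an item to cover. *)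
suff : rel2 (fun x y =>
    (exists c, x = false :: c /\ exists d, y = false :: d /\ rel_enc enc leE c d) \/
    (exists c, x = false :: c /\ exists l, y = true :: l /\ Ex c l) \/
    (exists k, x = true :: k /\ exists l, y = true :: l /\ Fa k l /\
       ~ k = [:: false])).
  apply: definable_ext => g; split.
  - move=> [[_ [-> [_ [-> [i [j [-> -> ij]]]]]]]|[|]].
    + by exists (Opt i), (Opt j).
    + move=> [_ [-> [_ [-> [i [[|j s] [-> -> ijs]]]]]]]; first by inversion ijs.
      by exists (Opt i), (Star j s).
    + move=> [_ [-> [_ [-> [[s [t [-> -> st]]] s0]]]]].
      case: s st s0 => [|i s] st s0 //; case: t st => [|j t] st.
        by inversion st as [|? ? H]; inversion H.
      by exists (Star i s), (Star j t).
  - move=> [[C|C A] [[C'|C' A'] [-> -> //= CA]]].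
    + by left; exists (enc C); split=> //; exists (enc C'); split=> //; exists C, C'.
    + right; left; exists (enc C); split=> //; exists (enc_list enc (C' :: A')).
      by split=> //; exists C, (C' :: A').
    + right; right; exists (enc_list enc (C :: A)); split=> //.
      exists (enc_list enc (C' :: A')); split=> //; split=> //.
      by exists (C :: A), (C' :: A').
by rewrite /rel2; define.
Qed.

Lemma rel1_atom : rel1 (is_enc (enc_atom enc)).
Proof.
have dL := rel1_is_list dV.
suff : rel1 (fun x => (exists c, x = false :: c /\ is_enc enc c) \/
    exists l, x = true :: l /\ is_list l /\ ~ l = [:: false]).
  apply: definable_ext => g; split.
    move=> [[_ [-> [i ->]]]|[_ [-> [[[|i s] ->] //]]]]; first by exists (Opt i).
    by exists (Star i s).
  move=> [[C|C A] ->]; first by left; exists (enc C); split=> //; exists C.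
  by right; exists (enc_list enc (C :: A)); split=> //; split=> //; exists (C :: A).
by rewrite /rel1; define.
Qed.

(* [product_le] without the negative premise of the skipping rule. *)
Inductive embeds : seq (atom E) -> seq (atom E) -> Prop :=
| EmbedsNil : embeds [::] [::]
| EmbedsSkip P e Q : embeds P Q -> embeds P (e :: Q)
| EmbedsOpt C P C' Q : leE C C' -> embeds P Q -> embeds (Opt C :: P) (Opt C' :: Q)
| EmbedsStar e P C' A' Q : atom_le leE e (Star C' A') ->
    embeds P (Star C' A' :: Q) -> embeds (e :: P) (Star C' A' :: Q).

(** The converse is obtained through denotations, since every rule of [embeds] is sound for
    inclusion. *)
Lemma product_le_embeds P Q : product_le leE P Q -> embeds P Q.
Proof.
elim=> {P Q} [Q|e P e' Q _ _ IH|C P C' Q CC _ IH|e P C' A' Q ee _ IH].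
- by elim: Q => [|e Q IHQ]; [exact: EmbedsNil | exact: EmbedsSkip].
- exact: EmbedsSkip.
- exact: EmbedsOpt.
- exact: EmbedsStar.
Qed.

Let pair_code (x y : word) := enc_bits x ++ y.

Let pair_code_inj x y x' y' : pair_code x y = pair_code x' y' -> x = x' /\ y = y'.
Proof. exact: enc_bits_prefix_free. Qed.

Let RA := rel_enc (enc_atom enc) (atom_le leE).
Let VA := is_enc (enc_atom enc).

(** The rules of [embeds] read backwards on the unread parts of the two codes. Each move shortens at
    least one part and lengthens neither. *)
Definition embed_move (x y x' y' : word) : Prop :=
  (exists a, VA a /\ y = true :: a ++ y' /\ x' = x) \/
  (exists c, exists d, rel_enc enc leE c d /\ x = true :: false :: c ++ x' /\
     y = true :: false :: d ++ y') \/
  (exists a, exists b, exists r, RA a (true :: b) /\ x = true :: a ++ x' /\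
     y = true :: true :: b ++ r /\ y' = y).

Definition embed_step (z z' : word) : Prop :=
  exists x, exists y, exists x', exists y', z = enc_bits x ++ y /\
    z' = enc_bits x' ++ y' /\ embed_move x y x' y'.

Lemma embed_steps P Q :
  steps embed_step (pair_code (enc_as P) (enc_as Q)) (pair_code [:: false] [:: false])
  <-> embeds P Q.
Proof.
have enc_nil (s : seq (atom E)) : enc_as s = [:: false] -> s = [::] by case: s.
split; last first.
  elim=> {P Q} [|P e Q _ IH|C P C' Q CC _ IH|e P C' A' Q ee _ IH]; first exact: StepsRefl.
  - apply: StepsStep IH; do 4 eexists; do 2 (split; first reflexivity).
    by left; exists (enc_atom enc e); split=> //; exists e.
  - apply: StepsStep IH; do 4 eexists; do 2 (split; first reflexivity).
    by right; left; exists (enc C), (enc C'); split=> //; exists C, C'.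
  - apply: StepsStep IH; do 4 eexists; do 2 (split; first reflexivity).
    right; right; exists (enc_atom enc e), (enc_list enc (C' :: A')), (enc_as Q).
    by split=> //; exists e, (Star C' A').
move: {2 3}(pair_code _ _) (erefl (pair_code (enc_as P) (enc_as Q))) => z zE H.
move eqf : (pair_code [:: false] [:: false]) H => f H.
elim: H P Q zE eqf => {z f} [z|z z' f [x [y [x' [y' [-> [-> mv]]]]]] _ IH] P Q.
  by move=> <- /pair_code_inj[/esym/enc_nil-> /esym/enc_nil->]; exact: EmbedsNil.
move=> /pair_code_inj[xE yE] fE; rewrite -{}xE -{}yE in mv.
case: mv => [[_ [[e ->] [+ x'E]]]|[|]].
- case: Q => [|e' Q] //= -[/apf[-> yE]]; apply: EmbedsSkip.
  by apply: IH fE; rewrite x'E -yE.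
- move=> [_ [_ [[C [C' [-> -> CC]]] [+ +]]]].
  case: P => [|e P] //= -[]; case: e => [C1|C1 A1] //= -[/pf[-> xE]].
  case: Q => [|e' Q] //= -[]; case: e' => [C2|C2 A2] //= -[/pf[-> yE]].
  by apply: EmbedsOpt => //; apply: IH fE; rewrite -xE -yE.
- move=> [_ [b [r [[e [e' [-> e'E ee]]] [+ [+ y'E]]]]]].
  case: P => [|e1 P] //= -[/apf[-> xE]].
  case: e' e'E ee => [C'|C' A'] //= -[->] ee.
  case: Q y'E => [|e2 Q] y'E // H2.
  have [e2E _] : e2 = Star C' A' /\ enc_as Q = r by apply: apf; case: H2.
  subst e2; apply: EmbedsStar => //; apply: IH fE.
  by rewrite y'E -xE.
Qed.

Lemma embed_step_decreasing z z' : embed_step z z' -> size z' < size z.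
Proof.
move=> [x [y [x' [y' [-> [-> mv]]]]]]; rewrite !size_cat !size_enc_bits.
move: mv => [[a [_ [-> ->]]]|[[c [d [_ [-> ->]]]]|[a [b [r [_ [-> [_ ->]]]]]]]];
  by rewrite /= ?size_cat /= ?size_cat; lia.
Qed.

Lemma rel2_embeds : rel2 (rel_enc enc_as embeds).
Proof.
have dRA := rel2_atom; have dVA := rel1_atom; rewrite -/RA -/VA in dRA dVA.
have dL := rel1_is_list dVA.
have dS : definable2 (fun _ : ctx 2 => steps embed_step).
  apply: definable2_steps0; first exact: embed_step_decreasing.
  by rewrite /definable2 /embed_step /embed_move; define.
suff : rel2 (fun x y => is_enc enc_as x /\ is_enc enc_as y /\
    steps embed_step (pair_code x y) (pair_code [:: false] [:: false])).
  apply: definable_ext => g; split=> [[[P PE] [[Q QE]]]|[P [Q [-> -> PQ]]]].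
    by rewrite PE QE => /embed_steps PQ; exists P, Q.
  by split; [exists P | split; [exists Q | exact/embed_steps]].
rewrite /rel2; do 2 (apply: definable_and; first by define).
by rewrite /pair_code; apply: (definable2_app dS); solve_term.
Qed.

Definition matches (P P' : seq E * seq E) : Prop :=
  let cov C := List.Exists (leE C) P'.1 in
  List.Forall cov P.1 /\ matching leE cov P.2 P'.2.

Definition enc_mproduct (P : seq E * seq E) : word :=
  enc_list enc P.1 ++ enc_list enc P.2.

Let EX := exists_item enc leE.
Let R := rel_enc enc leE.

(** The last move discards an item on the right: [MatchNil] accepts leftovers, while the final
    configuration has both lists empty. *)
Definition match_move (l x y x' y' : word) : Prop :=
  (exists c, EX c l /\ x = true :: c ++ x' /\ y' = y) \/
  (exists c, exists d, exists r, exists s, R c d /\ x = true :: c ++ x' /\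
     y = r ++ true :: d ++ s /\ y' = r ++ s /\ is_list (r ++ [:: false]) /\ is_list s) \/
  (exists c, is_enc enc c /\ y = true :: c ++ y' /\ x' = x).

Definition match_step (l z z' : word) : Prop :=
  exists x, exists y, exists x', exists y', z = enc_bits x ++ y /\
    z' = enc_bits x' ++ y' /\ match_move l x y x' y'.

Lemma match_step_decreasing l z z' : match_step l z z' -> size z' < size z.
Proof.
move=> [x [y [x' [y' [-> [-> mv]]]]]]; rewrite !size_cat !size_enc_bits.
move: mv => [[c [_ [-> ->]]]|[[c [d [r [s [_ [-> [-> [-> _]]]]]]]]|[c [_ [-> ->]]]]];
  by rewrite /= ?size_cat /= ?size_cat; lia.
Qed.

Lemma matching_skip cov Cs C' Q : matching leE cov Cs Q -> matching leE cov Cs (C' :: Q).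
Proof.
elim=> {Cs Q} [Q|C Cs Q c _ IH|C Cs C1 Q1 Q2 CC _ IH]; first exact: MatchNil.
  exact: MatchCov.
exact: (@MatchTake _ _ _ C Cs C1 (C' :: Q1)).
Qed.

Lemma match_steps A' Cs Q :
  steps (match_step (enc_list enc A'))
    (pair_code (enc_list enc Cs) (enc_list enc Q)) (pair_code [:: false] [:: false])
  <-> matching leE (fun C => List.Exists (leE C) A') Cs Q.
Proof.
have enc_nil (s : seq E) : enc_list enc s = [:: false] -> s = [::] by case: s.
split; last first.
  elim=> {Cs Q} [Q|C Cs Q cov _ IH|C Cs C' Q1 Q2 CC _ IH].
  - elim: Q => [|C Q IHQ]; first exact: StepsRefl.
    apply: StepsStep IHQ; do 4 eexists; do 2 (split; first reflexivity).
    by right; right; exists (enc C); split=> //; exists C.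
  - apply: StepsStep IH; do 4 eexists; do 2 (split; first reflexivity).
    by left; exists (enc C); split=> //; exists C, A'.
  - have [r [rE Q1E]] := enc_list_app enc Q1.
    apply: StepsStep IH; do 4 eexists; do 2 (split; first reflexivity).
    right; left; exists (enc C), (enc C'), r, (enc_list enc Q2).
    rewrite !Q1E; split; first by exists C, C'.
    by split=> //; split=> //; split=> //; split; [exists Q1 | exists Q2].
move: {2 3}(pair_code _ _) (erefl (pair_code (enc_list enc Cs) (enc_list enc Q))) => z zE H.
move eqf : (pair_code [:: false] [:: false]) H => f H.
elim: H Cs Q zE eqf => {z f} [z|z z' f [x [y [x' [y' [-> [-> mv]]]]]] _ IH] Cs Q.
  by move=> <- /pair_code_inj[/esym/enc_nil-> _]; exact: MatchNil.
move=> /pair_code_inj[xE yE] fE; rewrite -{}xE -{}yE in mv.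
case: mv => [[_ [[C [A [-> /(prefix_free_inj lpf) <- CA]]] [+ y'E]]]|[|]].
- case: Cs => [|C1 Cs] //= -[/pf[-> xE]]; apply: MatchCov => //.
  by apply: IH fE; rewrite y'E -xE.
- move=> [_ [_ [r [s [[C [C' [-> -> CC]]] [+ [+ [y'E [[Q1 rE] [Q2 sE]]]]]]]]]].
  case: Cs => [|C1 Cs] //= -[/pf[-> xE]].
  have [r' [rE' Q1E]] := enc_list_app enc Q1.
  rewrite sE in y'E *; have rr : r = r' by move: rE; rewrite rE' !cats1 => /rcons_inj[].
  rewrite rr in y'E *; rewrite -[true :: enc C' ++ _]/(enc_list enc (C' :: Q2)) -Q1E => /(prefix_free_inj lpf)->.
  apply: MatchTake => //; apply: IH fE.
  by rewrite y'E -Q1E -xE.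
- move=> [_ [[C ->] [+ x'E]]]; case: Q => [|C1 Q] //= -[/pf[-> yE]].
  by apply: matching_skip; apply: IH fE; rewrite x'E -yE.
Qed.

Lemma rel2_matches : rel2 (rel_enc enc_mproduct matches).
Proof.
have dL := rel1_is_list dV; have dEX := rel2_exists_item pf dV dR; rewrite -/EX in dEX.
have dF := rel2_forall_exists pf dV dR; set F := rel_enc _ _ in dF.
have dR' := dR; rewrite -/R in dR'.
have dS : definable2 (fun g : ctx 1 => match_step g.2).
  by rewrite /definable2 /match_step /match_move; define.
have dSt := @definable_steps 1 (fun g => match_step g.2)
    (fun g => @match_step_decreasing g.2) dS.
suff : rel2 (fun x y => exists a, exists c, exists a', exists q,
    x = a ++ c /\ y = a' ++ q /\ is_list c /\ is_list q /\ F a a' /\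
    steps (match_step a') (pair_code c q) (pair_code [:: false] [:: false])).
  apply: definable_ext => g; split.
    move=> [_ [_ [_ [_ [-> [-> [[Cs ->] [[Q ->] [[A [A' [-> -> AA]]]]]]]]]]]].
    by move=> /match_steps CQ; exists (A, Cs), (A', Q).
  move=> [[A Cs] [[A' Q] [-> -> [AA /match_steps CQ]]]].
  exists (enc_list enc A), (enc_list enc Cs), (enc_list enc A'), (enc_list enc Q).
  by do 2 (split; first by []); split; [exists Cs | split; [exists Q | split=> //; exists A, A']].
rewrite /rel2 /pair_code; do 4 (apply: definable_exists_le; [cbv beta | by by_size]).
do 5 (apply: definable_and; first by define).
(* The parameter of [match_step] has to be the most recent variable, so [a'] is copied there. *)
apply: (@definable_let _ (fun g : ctx 6 => g.1.2)
  (fun g l => steps (match_step l) (enc_bits g.1.1.2 ++ g.2) (enc_bits [:: false] ++ [:: false]))).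
  by solve_var.
have dSt' : definable2 (fun g : ctx 7 => steps (match_step g.2)).
  suff H n : definable2 (fun g : ctx n.+1 => steps (match_step g.2)) by exact: H.
  by elim: n => // n; exact: (@definable_weaken_at 3 n).
by apply: (definable2_app dSt'); solve_term.
Qed.

End Products.

(** * Binary numerals *)

Definition bits_val (u : word) : nat := foldr (fun (b : bool) n => b + 2 * n) 0 u.

Lemma bits_val_pos p : bits_val (pos_bits p) = nat_of_pos p.
Proof. by elim: p => //= p ->; lia. Qed.

Lemma nat_bitsK n : bits_val (nat_bits n) = n.
Proof.
rewrite -[RHS]bin_of_natK /nat_bits; case: (bin_of_nat n) => //= p.
exact: bits_val_pos.
Qed.

(** Numerals start with the least significant bit, so the canonical ones are the words not ending in
    [false]. The default [true] admits the empty numeral of 0. *)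
Lemma last_nat_bits n : last true (nat_bits n).
Proof.
rewrite /nat_bits; case: (bin_of_nat n) => //= p.
suff H b : last b (pos_bits p) by exact: H.
by elim: p b => [p IHp|p IHp|] b //=; exact: IHp.
Qed.

Lemma bits_valK u : last true u -> nat_bits (bits_val u) = u.
Proof.
case: u => // b u bu; have [p ->] : exists p, b :: u = pos_bits p.
  elim: u b bu => [|c u IHu] b /= bu; first by exists xH; rewrite /= bu.
  by have [p ->] := IHu c bu; case: b; [exists (xI p) | exists (xO p)].
by rewrite bits_val_pos /nat_bits -[nat_of_pos p]/(nat_of_bin (Npos p)) nat_of_binK.
Qed.

Lemma nat_bits_inj : injective nat_bits.
Proof. exact: can_inj nat_bitsK. Qed.

(** The state is the verdict on the bits read so far. A later difference is at a more significant
    bit and overrides it; missing bits count as [false]. *)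
Lemma rel2_bits_le : rel2 (fun u v => bits_val u <= bits_val v).
Proof.
pose step q (a b : option bool) :=
  if odflt false a == odflt false b then q else odflt false b.
have runE q u v : sync_run step q u v =
    if bits_val u == bits_val v then q else bits_val u < bits_val v.
  have digit r (a b : bool) m n :
      (if m == n then (if a == b then r else b) else m < n) =
      if a + 2 * m == b + 2 * n then r else a + 2 * m < b + 2 * n.
    by case: a; case: b => /=; case: (m =P n) => mn; case: eqP => ? //=; lia.
  elim: u q v => [|a u IHu] q v; last first.
    by case: v => [|b v]; rewrite /= IHu //; [exact: (digit q a false _ 0) | exact: digit].
  elim: v q => [|b v IHv] q //=.
  have /= -> := IHv (step q None (Some b)).
  exact: (digit q false b 0).
have := rel2_sync true step id; apply: definable_ext => g.
rewrite runE; split; first by case: eqP => [->|_ /ltnW].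
by rewrite leq_eqVlt => /orP[->//|H]; case: eqP.
Qed.

Lemma enc_nat_prefix_free : prefix_free enc_nat.
Proof. by move=> m n u v /enc_bits_prefix_free[/nat_bits_inj]. Qed.

(** * Deciding inclusion *)

Definition expr_sub (D : datatype) (e e' : expr D) : Prop := expr_den e `<=` expr_den e'.

Lemma enc_expr_prefix_free D : prefix_free (@enc_expr D).
Proof.
elim: D => [|d A|k D IHD|k D IHD|D IHD|D IHD] /=.
- move=> [m|] [n|] u v //=; last by move=> [->].
  by case=> /enc_nat_prefix_free[-> ->].
- by move=> a b u v /enc_nat_prefix_free[/val_inj/enum_rank_inj].
- move=> e e' u v.
  suff H (s : seq 'I_k) : flatten [seq enc_expr (e i) | i <- s] ++ u =
      flatten [seq enc_expr (e' i) | i <- s] ++ v -> (forall i, i \in s -> e i = e' i) /\ u = v.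
    move=> /H[ee ->]; split=> //; apply: functional_extensionality_dep => i.
    by apply: ee; rewrite mem_enum.
  elim: s => [|i s IHs] //=; rewrite -!catA => /IHD[ei /IHs[es uv]]; split=> // j.
  by rewrite inE => /orP[/eqP->|/es].
- move=> [i C] [j C'] u v /=; rewrite -!catA => /enc_nat_prefix_free[/val_inj ij].
  by subst j => /IHD[-> ->].
- exact/enc_list_prefix_free/enc_atom_prefix_free.
- have pf := enc_list_prefix_free IHD.
  by move=> [A Cs] [A' Q] u v; rewrite /= -!catA => /pf[-> /pf[-> ->]].
Qed.

(** Valid codes are the diagonal of a reflexive relation, so the induction on data types needs to
    carry only inclusion. *)
Lemma is_enc_rel I (enc : I -> word) (r : I -> I -> Prop) :
  prefix_free enc -> (forall i, r i i) -> rel2 (rel_enc enc r) -> rel1 (is_enc enc).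
Proof.
move=> pf rr dR; suff : rel1 (fun x => rel_enc enc r x x).
  by apply: definable_ext => g; split=> [[i [j [-> _ _]]]|[i ->]]; [exists i | exists i, i].
by rewrite /rel1; define.
Qed.

Lemma rel2_nomega : rel2 (rel_enc (@enc_expr DNat) (@expr_sub DNat)).
Proof.
have dle := rel2_bits_le.
have dlast : rel1 (fun u => last true u).
  have := rel1_dfa true (fun _ b => b) id; apply: definable_ext => g.
  suff -> : foldl (fun _ b : bool => b) true g.2 = last true g.2 by [].
  by elim: (g.2) true => //=.
pose can (u : word) : Prop := last true u; rewrite -/can in dlast.
pose bits_le u v : Prop := bits_val u <= bits_val v; rewrite -/bits_le in dle.
suff : rel2 (fun x y => (x = [:: false] /\ y = [:: false]) \/
    exists u, x = true :: enc_bits u /\ can u /\ (y = [:: false] \/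
      exists v, y = true :: enc_bits v /\ can v /\ bits_le u v)).
  have [_ nleP] := presents_nat.
  apply: definable_ext => g; split.
    move=> [[-> ->]|[u [-> [/bits_valK uE [->|[v [-> [/bits_valK vE uv]]]]]]]].
    - by exists None, None.
    - exists (Some (bits_val u)), None.
      by split; [rewrite /= /enc_nat uE | | exact: (nleP (Some _) None).1].
    - exists (Some (bits_val u)), (Some (bits_val v)).
      by split; [rewrite /= /enc_nat uE | rewrite /= /enc_nat vE | exact: (nleP (Some _) (Some _)).1].
  move=> [[m|] [[n|] [-> -> /(nleP _ _).2 //= mn]]]; last by left.
    right; exists (nat_bits m); split=> //; split; first exact: last_nat_bits.
    right; exists (nat_bits n); split=> //; split; first exact: last_nat_bits.
    by rewrite /bits_le !nat_bitsK.
  right; exists (nat_bits m); split=> //; split; first exact: last_nat_bits.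
  by left.
by rewrite /rel2; define.
Qed.

Lemma rel2_flatten (I : eqType) (R : I -> word -> word -> Prop) (s : seq I) :
  uniq s -> (forall i, rel2 (R i)) ->
  rel2 (fun x y => exists f f' : I -> word, [/\ x = flatten (map f s),
    y = flatten (map f' s) & forall i, i \in s -> R i (f i) (f' i)]).
Proof.
move=> + dR; elim: s => [_|i s IHs /= /andP[is_ /IHs{}IHs]].
  suff : rel2 (fun x y => x = [::] /\ y = [::]).
    apply: definable_ext => g; split=> [[-> ->]|[f [f' [-> ->]]]] //.
    by exists (fun=> [::]), (fun=> [::]).
  by rewrite /rel2; define.
set Rs := fun x y => _ in IHs; have dRi := dR i; set Ri := R i in dRi.
suff : rel2 (fun x y => exists x1, exists x2, x = x1 ++ x2 /\
    exists y1, exists y2, y = y1 ++ y2 /\ Ri x1 y1 /\ Rs x2 y2).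
  apply: definable_ext => g; split; last first.
    move=> [f [f' [-> -> fR]]]; exists (f i), (flatten (map f s)); split=> //.
    exists (f' i), (flatten (map f' s)); split=> //; split.
      by apply: fR; rewrite inE eqxx.
    by exists f, f'; split=> // j js; apply: fR; rewrite inE js orbT.
  move=> [x1 [_ [-> [y1 [_ [-> [Rxy [f [f' [-> -> fR]]]]]]]]]].
  pose upd (h : I -> word) z j := if j == i then z else h j.
  have updE h z : map (upd h z) s = map h s.
    by apply/eq_in_map => j js; rewrite /upd; case: eqP => // ji; rewrite -ji js in is_.
  exists (upd f x1), (upd f' y1); rewrite !updE /upd !eqxx; split=> // j.
  by rewrite inE; case: eqP => [->|_ /fR].
by rewrite /rel2; define.
Qed.

Theorem rel2_expr D : rel2 (rel_enc (@enc_expr D) (@expr_sub D)).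
Proof.
elim: D => [|d A|k D IHD|k D IHD|D IHD|D IHD].
- exact: rel2_nomega.
(* All pairs of a finite type are listed, each inclusion being a constant. *)
- suff : rel2 (fun x y => exists ab : A * A, x = @enc_expr (DFin A) ab.1 /\
      y = @enc_expr (DFin A) ab.2 /\ @expr_sub (DFin A) ab.1 ab.2).
    apply: definable_ext => g; split=> [[[a b] [-> [-> ab]]]|[a [b [-> -> ab]]]].
      by exists a, b.
    by exists (a, b); split=> //; split.
  apply: definable_exists_fin => -[a b].
  apply: definable_and; first by define.
  by apply: definable_and; [define | exact: definable_const].
- apply: definable_ext (rel2_flatten (enum_uniq 'I_k) IHD) => g.
  have subP := family_den_sub (fun i => @expr_idealP (D i)).
  split=> [[f [f' [-> -> fR]]]|[e [e' [-> -> /subP ee]]]]; last first.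
    exists (fun i => enc_expr (e i)), (fun i => enc_expr (e' i)); split=> // i _.
    by exists (e i), (e' i); split=> //; exact: ee.
  have /choice_dep[e eP] i : exists e : expr (D i), f i = enc_expr e /\
      exists e', f' i = enc_expr e' /\ expr_sub e e'.
    by have [|e [e' [? ? ?]]] := fR i; [rewrite mem_enum | exists e; split=> //; exists e'].
  have /choice_dep[e' e'P] i := (eP i).2.
  exists e, e'; split.
  + by congr flatten; apply: eq_map => i; exact: (eP i).1.
  + by congr flatten; apply: eq_map => i; exact: (e'P i).1.
  + by apply/subP => i; exact: (e'P i).2.
- have subP := sum_den_sub (fun i => @expr_idealP (D i)).
  suff : rel2 (fun x y => exists i : 'I_k, exists x', x = enc_nat i ++ x' /\
      exists y', y = enc_nat i ++ y' /\ rel_enc (@enc_expr (D i)) (@expr_sub (D i)) x' y').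
    apply: definable_ext => g; split.
      move=> [i [_ [-> [_ [-> [C [C' [-> -> CC]]]]]]]].
      exists (Tagged (fun i => expr (D i)) C), (Tagged (fun i => expr (D i)) C').
      by split=> //; apply/subP; exists i, C, C'.
    move=> [e [e' [-> -> /subP[i [C [C' [-> -> CC]]]]]]].
    exists i, (enc_expr C); split=> //; exists (enc_expr C'); split=> //.
    by exists C, C'.
  apply: definable_exists_fin => i; have dRi := IHD i; set Ri := rel_enc _ _ in dRi.
  by define.
- have pf := @enc_expr_prefix_free D.
  have dV := is_enc_rel pf (fun e => @subset_refl _ (expr_den e)) IHD.
  have subP (e e' : expr D) : expr_sub e e' <-> expr_den e `<=` expr_den e' by [].
  have idl := @expr_ideal D.
  have := rel2_embeds pf dV IHD; apply: definable_ext => g.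
  (* The direction from [embeds] is soundness of its rules; the other goes through [product_le]. *)
  have embP P Q : embeds (@expr_sub D) P Q <->
      product_den (@expr_den D) P `<=` product_den (@expr_den D) Q.
    split=> [|/(product_leP (data_qo D) idl subP)/product_le_embeds //].
    elim=> {P Q} [|P e Q _ IH|C P C' Q CC _ IH|e P C' A' Q ee _ IH] //.
    + by apply: subset_trans IH _; exact: product_consr.
    + by apply: cat_words_sub IH; exact: (atom_le_sub idl subP (e := Opt C) (e' := Opt C')).
    + apply: subset_trans (@star_absorb _ _ _ C' A' Q).
      by apply: cat_words_sub => //; exact: (atom_le_sub idl subP ee).
  by split=> -[P [Q [-> -> /embP PQ]]]; exists P, Q.
- have pf := @enc_expr_prefix_free D.
  have dV := is_enc_rel pf (fun e => @subset_refl _ (expr_den e)) IHD.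
  have subP (e e' : expr D) : expr_sub e e' <-> expr_den e `<=` expr_den e' by [].
  have idl := @expr_ideal D.
  have := rel2_matches pf dV IHD; apply: definable_ext => g.
  have matP P Q : matches (@expr_sub D) P Q <->
      mproduct_den (@expr_den D) P `<=` mproduct_den (@expr_den D) Q.
    case: P Q => A Cs [A' Q]; rewrite (matching_leP (data_qo D) idl subP) //.
  by split=> -[P [Q [-> -> /matP PQ]]]; exists P, Q.
Qed.

(** * Membership in the polynomial hierarchy *)

Lemma rel2_hierarchy (R : word -> word -> Prop) : rel2 R ->
  polynomial_hierarchy (fun x : 2.-tuple word => exists u v, x = [tuple u; v] /\ R u v).
Proof.
move=> dR; apply: in_PH_hierarchy.
(* The head of the tuple is the most recent variable, so the two arguments are exchanged. *)
have : @definable 2 (fun g => R g.2 g.1.2) by define.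
apply: in_PH_ext => x; case/tupleP: x => u x; case/tupleP: x => v x; rewrite tuple0.
split=> [Ruv|[u' [v' [/(congr1 val)[-> ->] //]]]].
by exists u, v; split=> //; exact: val_inj.
Qed.

Lemma polynomial_hierarchy_ext n (L L' : n.-tuple word -> Prop) :
  (forall x, L x <-> L' x) -> polynomial_hierarchy L -> polynomial_hierarchy L'.
Proof. by move=> LL; rewrite (_ : L = L') //; apply/predeqP. Qed.

Lemma expr_sub_hierarchy D :
  polynomial_hierarchy (@expr_problem D (fun C C' => C `<=` C')).
Proof.
have := rel2_hierarchy (@rel2_expr D); apply: polynomial_hierarchy_ext => x.
split=> [[_ [_ [-> [e [e' [-> -> ee]]]]]]|[e [e' [-> ee]]]]; first by exists e, e'.
by exists (enc_expr e), (enc_expr e'); split=> //; exists e, e'.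
Qed.

Lemma expr_eq_hierarchy D :
  polynomial_hierarchy (@expr_problem D (fun C C' => C = C')).
Proof.
have dR := @rel2_expr D; set R := rel_enc _ _ in dR.
have : rel2 (fun x y => R x y /\ R y x) by rewrite /rel2; define.
move=> /rel2_hierarchy; apply: polynomial_hierarchy_ext => x.
have inj := prefix_free_inj (@enc_expr_prefix_free D).
split=> [[_ [_ [-> [[e [e' [-> -> ee']]] [f [f' [/inj <- /inj <- e'e]]]]]]]|].
  by exists e, e'; split=> //; apply/seteqP.
move=> [e [e' [-> ee]]]; exists (enc_expr e), (enc_expr e'); split=> //.
by split; [exists e, e' | exists e', e]; split=> //; rewrite /expr_sub ee.
Qed.

Theorem theorem5p3 :
  (forall D : datatype, noetherian (sob D)) /\
  @presents (option nat) nomega_le (data_space DNat) nomega_den /\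
  (forall (d : Order.disp_t) (A : finPreorderType d),
     @presents A (fun a b => (a <= b)%O) (data_space (DFin A))
       (fun a => [set b : A | (b <= a)%O])) /\
  (forall (k : nat) (D : 'I_k -> datatype),
     @presents (forall i, sob (D i))
       (family_le (fun i => @sob_le (data_space (D i))))
       (data_space (DProd D)) (family_den (fun i => @sob_den (D i)))) /\
  (forall (k : nat) (D : 'I_k -> datatype),
     @presents {i : 'I_k & sob (D i)}
       (sum_le (fun i => @sob_le (data_space (D i))))
       (data_space (DSum D)) (sum_den (fun i => @sob_den (D i)))) /\
  (forall D : datatype,
     @presents (seq (atom (sob D))) (product_le (@sob_le (data_space D)))
       (data_space (DWords D)) (product_den (@sob_den D))) /\
  (forall D : datatype,
     @presents (seq (sob D) * seq (sob D))%type
       (mproduct_le (@sob_le (data_space D)))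
       (data_space (DMultisets D)) (mproduct_den (@sob_den D))) /\
  (forall D : datatype,
     @represents (expr D) (data_space D) (@expr_den D) /\
     polynomial_hierarchy (@expr_problem D (fun C C' => C = C')) /\
     polynomial_hierarchy (@expr_problem D (fun C C' => C `<=` C'))).
Proof.
split; first exact: sob_noetherian.
split; first exact: presents_nat.
split; first exact: presents_fin.
split; first exact: presents_prod.
split; first exact: presents_sum.
split; first exact: presents_words.
split; first exact: presents_multisets.
move=> D; split; first exact: represents_ideal (@expr_idealP D).
by split; [exact: expr_eq_hierarchy | exact: expr_sub_hierarchy].
Qed.
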